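(* For every $\alpha>0$ there exists a constant $\beta>0$ such that every $n$-vertex cubic bridgeless graph has at least $\alpha n-\beta$ perfect matchings.
   Context: Graphs may have parallel edges (multigraphs); a cubic graph is one in which every vertex has degree $3$. A graph is bridgeless if it has no edge whose removal disconnects a connected component. *)

(* Defs.v *)
From mathcomp Require Import all_boot.
From Stdlib Require Import Reals.

Set Implicit Arguments.
Unset Strict Implicit.
Unset Printing Implicit Defensive.

(* A finite multigraph: vertex type V, edge type E, each edge e has two
   endpoints src e and dst e (parallel edges allowed; a loop is an edge with
   src e = dst e). *)

Section MultiGraph.
Variables (V E : finType) (src dst : E -> V).

Definition incident (e : E) (v : V) : bool := (src e == v) || (dst e == v).

(* degree of v, a loop counting twice *)
Definition degree (v : V) : nat :=
  #|[set e | src e == v]| + #|[set e | dst e == v]|.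

Definition cubic : Prop := forall v : V, degree v = 3.

Definition adj_in (F : {set E}) : rel V :=
  fun x y => [exists e in F, ((src e == x) && (dst e == y)) ||
                             ((src e == y) && (dst e == x))].

Definition is_bridge (e : E) : Prop :=
  exists x y : V, connect (adj_in setT) x y /\ ~~ connect (adj_in (setT :\ e)) x y.

Definition bridgeless : Prop := forall e : E, ~ is_bridge e.

Definition perfect_matching (M : {set E}) : bool :=
  [forall e in M, src e != dst e] &&
  [forall v, #|[set e in M | incident e v]| == 1].

Definition num_perfect_matchings : nat := #|[set M : {set E} | perfect_matching M]|.

End MultiGraph.

(* Main.v *)
(** Fix a root r and a maximal laminar family of vertex sets avoiding r whose edge boundary has at
    most three edges.  For X in the family let N X S count the edge sets that saturate X exactly
    once and meet the boundary of X in S, and let the potential of X be the sum of ln (N X {e}) over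
    the boundary edges e (2 ln (N X set0) + ln (N X (bd X)) when |X| is even).  Potential is
    superadditive along the tree of the family: contracting the children of X and its complement
    gives a small graph, and Edmonds' theorem for it yields one matching whose weight is at least
    that of the point 1/3.
    If X has at least three children, the contracted graph is cubic and all its nontrivial odd
    cuts have at least five edges, so every x >= 1/5 with vertex sums 1 lies in its matching
    polytope.  Pushing 1/3 in random directions of the kernel of the vertex constraints shows that
    the potential of X bounds the number of its children polynomially.
    Finally the potential grows by a constant along every five steps down the tree, the hardest
    case being a chain of K4 contractions.  So a tree with top potential D has O((D+5)^4) vertices,
    whereas D <= 3 ln m for the number m of perfect matchings: n is polylogarithmic in m. *)

Require Import Defs.
From Stdlib Require Import Reals.
From mathcomp Require Import all_boot all_order all_algebra ring lra zify.
From mathcomp Require Import Rstruct reals sequences exp.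

Set Implicit Arguments.
Unset Strict Implicit.
Unset Printing Implicit Defensive.

Import Order.TTheory GRing.Theory Num.Theory.

(** * Edmonds' matching polytope *)

Local Open Scope ring_scope.

(** Gains of potential bound the depth of the tree and the number of nodes that carry potential, but
    not the fan-out: a priori a single node could have arbitrarily many one-vertex children. Hence
    the separate bound on the number of children. Its source is entropy: each random direction
    yields a matching of the contracted graph that correlates with it, a fixed matching correlates
    that strongly with very few directions, so many matchings are needed. Logarithms turn the number
    of ways to lift a contracted matching, a product over the children, into a linear weight on
    edges. Every use of Edmonds' theorem then asks only for one matching at least as heavy as a
    given fractional point, so the theorem is proved in that dual form and no convex combination is
    built. The bound [n <= C (3 ln m + 5)^4] is much stronger than superlinear growth of [m]; for
    the theorem it matters that [C] is the same for all graphs. *)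

Definition boundary (V E : finType) (src dst : E -> V) (U : {set V}) : {set E} :=
  [set e | (src e \in U) != (dst e \in U)].

(** * Nonzero solutions of underdetermined linear systems *)

Section Kernel.
Variable R : fieldType.

Lemma kernel_vector (E : finType) (l : seq {ffun E -> R}) :
  (size l < #|E|)%N ->
  exists2 y : {ffun E -> R}, exists e, y e != 0 & {in l, forall f : {ffun E -> R}, \sum_e f e * y e = 0}.
Proof.
move=> szl.
pose A : 'M[R]_(#|E|, size l) := \matrix_(i, j) (nth 0 l j) (enum_val i).
have : kermx A != 0.
  by rewrite kermx_eq0 -row_leq_rank -ltnNge (leq_ltn_trans (rank_leq_col _)).
case/matrix0Pn=> i [j nz].
exists [ffun e => kermx A i (enum_rank e)].
  by exists (enum_val j); rewrite ffunE enum_valK.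
move=> f fl; have ix : (index f l < size l)%N by rewrite index_mem.
have := congr1 (fun B : 'M_(_, _) => B i (Ordinal ix)) (mulmx_ker A).
rewrite !mxE => {2}<-.
rewrite (reindex (@enum_val _ (mem E))) /=; last exact/onW_bij/enum_val_bij.
apply: eq_bigr => k _.
by rewrite ffunE enum_valK mulrC [A _ _]mxE /= nth_index.
Qed.
End Kernel.

Section Edmonds.
Variable R : realFieldType.

(** Edmonds' polytope of the subgraph on [W]. The vertex set is a parameter inside a fixed type and
    edges keep their type, so that contracting an odd set creates no new types. *)
Record feasible (V E : finType) (src dst : E -> V) (W : {set V}) (x : E -> R) : Prop :=
  Feasible {
    feas_ge0 : forall e, 0 <= x e;
    feas_supp : forall e, x e != 0 -> [&& src e \in W, dst e \in W & src e != dst e];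
    feas_vertex : forall v, v \in W -> \sum_(e in boundary src dst [set v]) x e = 1;
    feas_odd : forall U : {set V}, U \subset W -> odd #|U| ->
      1 <= \sum_(e in boundary src dst U) x e }.

(** Double counting: an edge inside [U] lies in two vertex cuts, a boundary edge in one. A loop lies
    in no vertex cut, whence the hypothesis on the support. *)
Lemma sum_vertex_cuts (V E : finType) (src dst : E -> V) (x : E -> R) (U : {set V}) :
  (forall e, x e != 0 -> src e != dst e) ->
  \sum_(v in U) \sum_(e in boundary src dst [set v]) x e =
  \sum_(e in boundary src dst U) x e
  + 2 * \sum_(e | (src e \in U) && (dst e \in U)) x e.
Proof.
move=> nl.
rewrite (eq_bigr (fun v => \sum_e (if e \in boundary src dst [set v] then x e else 0))); last first.
  by move=> v _; rewrite big_mkcond.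
rewrite exchange_big /= mulr_sumr.
rewrite [\sum_(e in boundary src dst U) _]big_mkcond [\sum_(e | (src e \in U) && _) _]big_mkcond.
rewrite -big_split; apply: eq_bigr => e _ /=.
have [->|/nl sd] := eqVneq (x e) 0.
  rewrite mulr0 !if_same addr0; apply: big1 => v _; exact: if_same.
have E1 (a : V) : \sum_(v in U) (if v == a then x e else 0) = if a \in U then x e else 0.
  rewrite -big_mkcondr /=; case: ifP => aU.
    rewrite (eq_bigl (pred1 a)) ?big_pred1_eq // => v /=.
    by case: eqVneq => [->|]; rewrite ?aU ?andbF.
  apply: big_pred0 => v; case: eqVneq => [->|]; by rewrite ?aU ?andbF.
transitivity (\sum_(v in U) ((if v == src e then x e else 0) + (if v == dst e then x e else 0))).
  apply: eq_bigr => v _; rewrite !inE ![_ == v]eq_sym.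
  have [vs|vs] := eqVneq v (src e); have [vd|vd] := eqVneq v (dst e) => /=;
    rewrite ?addr0 ?add0r //.
  by move: sd; rewrite -vs -vd eqxx.
rewrite big_split !E1 inE.
by case: (src e \in U); case: (dst e \in U) => /=; rewrite ?addr0 ?add0r // mulr_natl.
Qed.

(** In every use [c] is an element of [C], so the contracted vertex set is [c |: (W :\: C)]. *)
Definition contract (V : finType) (C : {set V}) (c v : V) := if v \in C then c else v.

(** * Contraction of one side of a tight odd cut *)

Section Contract.
Variables (V E : finType) (src dst : E -> V) (W C : {set V}) (c : V) (x : E -> R).
Hypotheses (fx : feasible src dst W x) (CW : C \subset W) (cC : c \in C) (oC : odd #|C|).
Hypothesis (tC : \sum_(e in boundary src dst C) x e = 1).

Let src' e := contract C c (src e).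
Let dst' e := contract C c (dst e).

Lemma cut_contract_out v : v \notin C -> boundary src' dst' [set v] = boundary src dst [set v].
Proof.
move=> vC; apply/setP => e; rewrite !inE /src' /dst' /contract.
have cv : (c == v) = false by apply: contraNF vC => /eqP <-.
by congr (_ != _); case: ifP => // aC; rewrite cv; apply/esym; apply: contraNF vC => /eqP <-.
Qed.

Lemma cut_contract_in : boundary src' dst' [set c] = boundary src dst C.
Proof.
apply/setP => e; rewrite !inE /src' /dst' /contract.
by congr (_ != _); case: ifP => // aC; rewrite ?eqxx //; apply: contraFF aC => /eqP ->.
Qed.

Lemma cut_contract (U : {set V}) : U \subset c |: (W :\: C) ->
  boundary src' dst' U = boundary src dst (if c \in U then U :|: C else U).
Proof.
move=> UW; apply/setP => e; rewrite !inE /src' /dst' /contract.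
have aux a : ((if a \in C then c else a) \in U) = (a \in (if c \in U then U :|: C else U)).
  case: ifP => aC; case: ifP => cU; rewrite ?inE ?aC ?orbT ?orbF //.
  apply/esym; apply/negP => aU; move: (subsetP UW _ aU); rewrite !inE aC /= orbF => /eqP ac.
  by rewrite -ac aU in cU.
by rewrite !aux.
Qed.

(** Tightness gives vertex sum 1 at [c], oddness of [C] keeps the parity of a set that swallows [C],
    and edges inside [C], now loops, get weight zero. *)
Lemma feasible_contract :
  feasible src' dst' (c |: (W :\: C))
    (fun e => if (src e \in C) && (dst e \in C) then 0 else x e).
Proof.
have sumE (U : {set V}) : \sum_(e in boundary src' dst' U)
    (if (src e \in C) && (dst e \in C) then 0 else x e) = \sum_(e in boundary src' dst' U) x e.
  apply: eq_bigr => e; rewrite !inE /src' /dst' /contract.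
  by case: (boolP (_ && _)) => [/andP[-> ->]|//]; rewrite eqxx.
split.
- by move=> e; case: ifP => // _; apply: feas_ge0 fx _.
- move=> e; case: ifP => [|sd xe]; first by rewrite eqxx.
  have /and3P[sW dW nsd] := feas_supp fx xe.
  rewrite /src' /dst' /contract !inE.
  case: (boolP (src e \in C)) sd; case: (boolP (dst e \in C)) => dC sC //= _;
    rewrite ?sC ?dC ?sW ?dW ?eqxx ?orbT //=.
    by apply: contraNneq dC => <-.
  by apply: contraNneq sC => ->.
- move=> v; rewrite !inE sumE => /orP[/eqP ->|/andP[vC vW]].
    by rewrite cut_contract_in.
  by rewrite cut_contract_out //; apply: feas_vertex fx _ vW.
- move=> U UW oU; rewrite sumE cut_contract //; apply: (feas_odd fx).
    case: ifP => cU.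
      rewrite subUset CW andbT; apply: (subset_trans UW).
      by rewrite subUset sub1set (subsetP CW) // subsetDl.
    apply/subsetP => a aU; have := subsetP UW _ aU.
    by rewrite !inE => /orP[/eqP ac|/andP[]//]; rewrite -ac aU in cU.
  case: ifP => // cU; rewrite cardsU.
  have -> : U :&: C = [set c].
    apply/setP => a; rewrite !inE; apply/andP/eqP => [[aU aC]|->]; last by [].
    by have := subsetP UW _ aU; rewrite !inE aC orbF => /eqP.
  rewrite cards1 oddB ?oddD ?oU ?oC //.
  by rewrite addn_gt0 card_gt0; apply/orP; left; apply/set0Pn; exists c.
Qed.

End Contract.

Definition matches (V E : finType) (src dst : E -> V) (W : {set V}) (M : {set E}) :=
  [forall v in W, #|M :&: boundary src dst [set v]| == 1%N].

Lemma matchesP (V E : finType) (src dst : E -> V) (W : {set V}) (M : {set E}) :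
  reflect (forall v, v \in W -> #|M :&: boundary src dst [set v]| = 1%N) (matches src dst W M).
Proof. by apply: (iffP forall_inP) => H v /H /eqP. Qed.

(* Dual form of "x is a convex combination of perfect matchings on W contained in its support". *)
Definition supports_pm (V E : finType) (src dst : E -> V) (W : {set V}) (x : E -> R) :=
  forall w : E -> R, exists M : {set E},
    [/\ M \subset [set e | x e != 0], matches src dst W M &
        \sum_e w e * x e <= \sum_(e in M) w e].

(** If [W] were odd, its own cut inequality would fail, since no support edge leaves [W]. *)
Lemma feasible_even (V E : finType) (src dst : E -> V) (W : {set V}) (x : E -> R) :
  feasible src dst W x -> ~~ odd #|W|.
Proof.
move=> fx; apply/negP => /(feas_odd fx (subxx _)).
rewrite big1 ?ler10 // => e; rewrite inE; apply: contraNeq => /(feas_supp fx).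
by case/and3P => -> ->.
Qed.

Lemma cut_compl_sum (V E : finType) (src dst : E -> V) (W U : {set V}) (x : E -> R) (f : E -> R) :
  feasible src dst W x -> U \subset W ->
  (forall e, x e = 0 -> f e = 0) ->
  \sum_(e in boundary src dst (W :\: U)) f e = \sum_(e in boundary src dst U) f e.
Proof.
move=> fx UW f0; rewrite big_mkcond [RHS]big_mkcond; apply: eq_bigr => e _.
have [/f0->|/(feas_supp fx)/and3P[sW dW _]] := eqVneq (x e) 0; first by rewrite !if_same.
by rewrite !inE sW dW !andbT; case: (_ \in U); case: (_ \in U).
Qed.

End Edmonds.

(** * Gluing matchings across an odd cut *)

Section SupportsGlue.
Variable R : realFieldType.

Lemma supports_contract (V E : finType) (src dst : E -> V) (W C : {set V}) (c : V) (x : E -> R) :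
  feasible src dst W x -> C \subset W -> c \in C ->
  supports_pm (contract C c \o src) (contract C c \o dst) (c |: (W :\: C))
    (fun e => if (src e \in C) && (dst e \in C) then 0 else x e) ->
  forall w : E -> R, exists M : {set E},
    [/\ M \subset [set e | (x e != 0) && ~~ ((src e \in C) && (dst e \in C))],
        matches src dst (W :\: C) M, #|M :&: boundary src dst C| = 1%N &
        \sum_(e | ~~ ((src e \in C) && (dst e \in C))) w e * x e <= \sum_(e in M) w e].
Proof.
move=> fx CW cC sp w; have [M [Msub Mm Mw]] := sp w; exists M; split.
- apply/subsetP => e /(subsetP Msub); rewrite !inE.
  by case: ifP => _; rewrite ?eqxx ?andbT.
- apply/matchesP => v vW; rewrite -(matchesP _ _ _ _ Mm v); last by rewrite in_setU vW orbT.
  by rewrite (cut_contract_out _ _ cC) //; move: vW; rewrite inE => /andP[].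
- by rewrite -(matchesP _ _ _ _ Mm c) ?setU11 // cut_contract_in.
- apply: le_trans Mw; rewrite big_mkcond le_eqVlt; apply/orP; left; apply/eqP.
  by apply: eq_bigr => e _; case: (_ && _) => //=; rewrite mulr0.
Qed.

(** The dual form of gluing convex combinations. For a cut edge [e], [Mb e] holds a best matching
    inside [U] through [e], and its value, the price of [e]. With prices added on the cut, the
    contraction of [U] supplies the outer half; with prices subtracted, the contraction of the
    complement shows that the part of [w] inside [U] is worth at most the prices. The two
    inequalities add up to the claim. *)
Lemma supports_glue (V E : finType) (src dst : E -> V) (W U : {set V}) (a b : V) (x : E -> R) :
  feasible src dst W x -> U \subset W -> a \in U -> b \in W :\: U ->
  supports_pm (contract U a \o src) (contract U a \o dst) (a |: (W :\: U))
    (fun e => if (src e \in U) && (dst e \in U) then 0 else x e) ->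
  supports_pm (contract (W :\: U) b \o src) (contract (W :\: U) b \o dst)
    (b |: (W :\: (W :\: U)))
    (fun e => if (src e \in W :\: U) && (dst e \in W :\: U) then 0 else x e) ->
  supports_pm src dst W x.
Proof.
move=> fx UW aU bU /(supports_contract fx UW aU) s1 /(supports_contract fx (subsetDl _ _) bU) s2 w.
rewrite (setDDr W W U) setDv set0U (setIidPr UW) in s2.
pose inw (M : {set E}) := \sum_(e in M | (src e \in U) && (dst e \in U)) w e.
have supU (M : {set E}) e : M \subset [set e | (x e != 0) && ~~ ((src e \in W :\: U) && (dst e \in W :\: U))] ->
    e \in M -> [&& x e != 0, src e \in W, dst e \in W & (src e \in U) || (dst e \in U)].
  move=> Ms eM; have := subsetP Ms _ eM; rewrite !inE => /andP[xe].
  by have /and3P[-> -> _] := feas_supp fx xe; rewrite xe !andbT negb_and !negbK.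
pose good e (M : {set E}) := [&& M \subset [set e | (x e != 0) && ~~ ((src e \in W :\: U) && (dst e \in W :\: U))],
  matches src dst U M, #|M :&: boundary src dst (W :\: U)| == 1%N & e \in M].
have exb e : exists Mb : {set E} * R, x e != 0 -> e \in boundary src dst U -> good e Mb.1 /\
    (Mb.2 = inw Mb.1) /\ (forall M, good e M -> inw M <= Mb.2).
  have [xe|xe] := eqVneq (x e) 0; first by exists (set0, 0).
  have [eU|eU] := boolP (e \in boundary src dst U); last by exists (set0, 0).
  (* The indicator weight of [e] has value [x e > 0], so the matching it yields contains [e]. *)
  have [M0 [M0s M0m M0c M0w]] := s2 (fun f => (f == e)%:R).
  have gM0 : good e M0.
    rewrite /good M0s M0m M0c eqxx /=; apply: contraTT M0w => eM; rewrite -ltNge.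
    rewrite big1 => [|f fM]; last by case: eqVneq fM => // ->; rewrite (negPf eM).
    rewrite (bigD1 e) /=; last first.
      by move: eU; rewrite !inE; case: (_ \in U); case: (_ \in U); rewrite /= ?andbF.
    rewrite eqxx mul1r big1 ?addr0 => [|f /andP[_ /negPf ->]]; last by rewrite mul0r.
    by rewrite lt0r xe (feas_ge0 fx).
  have [Mm gMm Mmax] := arg_maxP inw gM0.
  by exists (Mm, inw Mm) => _ _; split.
have [Mb HMb] := fin_all_exists exb.
have [M2 [M2s M2m M2c M2w]] := s2 (fun e => if e \in boundary src dst U then - (Mb e).2 else w e).
have [M1 [M1s M1m M1c M1w]] := s1 (fun e => if e \in boundary src dst U then w e + (Mb e).2 else w e).
have /cards1P[e Ee] : #|M1 :&: boundary src dst U| == 1%N by rewrite M1c.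
have /andP[eM1 eU] : (e \in M1) && (e \in boundary src dst U) by rewrite -in_setI Ee set11.
have xe : x e != 0 by move: (subsetP M1s _ eM1); rewrite inE => /andP[].
have [gM [bE _]] := HMb e xe eU; case/and4P: gM => Ms Mm /eqP Mc eM.
have cutC (M : {set E}) f : M \subset [set e | (x e != 0) && ~~ ((src e \in W :\: U) && (dst e \in W :\: U))] ->
    f \in M -> (f \in boundary src dst (W :\: U)) = (f \in boundary src dst U).
  move=> Ns fN; have /and4P[_ sW dW _] := supU _ _ Ns fN.
  by rewrite !inE sW dW !andbT; case: (_ \in U); case: (_ \in U).
have cutU1 (M : {set E}) : M \subset [set e | (x e != 0) && ~~ ((src e \in W :\: U) && (dst e \in W :\: U))] ->
    M :&: boundary src dst (W :\: U) = M :&: boundary src dst U.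
  move=> Ns; apply/setP => f; rewrite !in_setI; case: (boolP (f \in M)) => //= fM.
  exact: cutC fM.
pose M := M1 :|: (Mb e).1.
have EMb : (Mb e).1 :&: boundary src dst U = [set e].
  move: Mc; rewrite cutU1 // => /eqP/cards1P[e' Ee']; rewrite Ee'.
  have : e \in [set e'] by rewrite -Ee' inE eM.
  by move=> /set1P ->.
have splitM (N : {set E}) g (F : E -> R) : N \subset [set e | (x e != 0) && ~~ ((src e \in W :\: U) && (dst e \in W :\: U))] ->
    N :&: boundary src dst U = [set g] ->
    \sum_(f in N) F f = F g + \sum_(f in N | (src f \in U) && (dst f \in U)) F f.
  move=> Ns Ng; have : g \in [set g] by rewrite set11.
  rewrite -Ng inE => /andP[gN gU].
  rewrite (bigD1 g) //=; congr (_ + _); apply: eq_bigl => f.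
  case: (boolP (f \in N)) => //= fN; have /and4P[_ _ _ sd] := supU _ _ Ns fN.
  have := in_setI f N (boundary src dst U); rewrite Ng !inE fN /= => ->.
  by move: sd; case: (_ \in U); case: (_ \in U).
(* By maximality of the prices, no matching inside [U] is worth more than the price of its cut
   edge. *)
have M2neg : \sum_(f in M2) (if f \in boundary src dst U then - (Mb f).2 else w f) <= 0.
  have /cards1P[g Eg] : #|M2 :&: boundary src dst U| == 1%N by rewrite -cutU1 // M2c.
  have /andP[gM2 gU] : (g \in M2) && (g \in boundary src dst U) by rewrite -in_setI Eg set11.
  have xg : x g != 0 by move: (subsetP M2s _ gM2); rewrite inE => /andP[].
  have [_ [_ /(_ M2)]] := HMb g xg gU.
  rewrite /good M2s M2m M2c eqxx gM2 => /(_ isT) le.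
  rewrite (splitM M2 g _ M2s Eg) gU addrC subr_le0; apply: le_trans le; rewrite le_eqVlt; apply/orP; left; apply/eqP.
  by apply: eq_bigr => f /andP[_ /andP[sU dU]]; rewrite inE sU dU.
exists M; split.
- apply/subsetP => f /setUP[/(subsetP M1s)|/(subsetP Ms)]; by rewrite !inE => /andP[].
- apply/matchesP => v vW; case: (boolP (v \in U)) => vU.
    rewrite -(matchesP _ _ _ _ Mm v vU); congr #|pred_of_set _|; apply/setP => f.
    rewrite !in_setI !in_setU; case: (boolP (f \in (Mb e).1)) => fMb; rewrite ?orbT ?orbF //=.
    apply/negP => /andP[fM1]; rewrite !inE => fv.
    suff : f \in [set e] by move=> /set1P fe; rewrite fe eM in fMb.
    rewrite -Ee in_setI fM1 inE; move: (subsetP M1s _ fM1); rewrite inE => /andP[_].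
    case: (eqVneq (src f) v) fv => [->|_] /=; first by rewrite vU; case: (_ \in U).
    by case: (eqVneq (dst f) v) => // ->; rewrite vU; case: (_ \in U).
  rewrite -(matchesP _ _ _ _ M1m v); last by rewrite inE vU.
  congr #|pred_of_set _|; apply/setP => f.
  rewrite !in_setI !in_setU; case: (boolP (f \in M1)) => fM1; rewrite ?orbT ?orbF //=.
  apply/negP => /andP[fMb]; rewrite !inE => fv.
  suff : f \in [set e] by move=> /set1P fe; rewrite fe eM1 in fM1.
  rewrite -EMb in_setI fMb inE; have /and4P[_ _ _] := supU _ _ Ms fMb.
  case: (eqVneq (src f) v) fv => [->|_] /=; first by rewrite (negPf vU); case: (_ \in U).
  by case: (eqVneq (dst f) v) => // ->; rewrite (negPf vU); case: (_ \in U).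
have -> : \sum_(f in M) w f = \sum_(f in M1) (if f \in boundary src dst U then w f + (Mb f).2 else w f).
  have -> : \sum_(f in M) w f = \sum_(f in M1) w f + inw (Mb e).1.
    rewrite (bigID (fun f => f \in M1)) /=; congr (_ + _).
      by apply: eq_bigl => f; rewrite /M in_setU; case: (f \in M1); rewrite /= ?andbF.
    rewrite /inw; apply: eq_bigl => f; rewrite in_setU; case: (boolP (f \in M1)) => fM1; rewrite ?andbF ?andbT /=.
      apply/esym/negP => /and3P[_ sU dU]; move: (subsetP M1s _ fM1); rewrite inE sU dU.
      by rewrite andbF.
    case: (boolP (f \in (Mb e).1)) => //= fMb; have /and4P[_ _ _ sd] := supU _ _ Ms fMb.
    have : f \notin [set e] by rewrite inE; apply: contraNneq fM1 => ->.
    by rewrite -EMb in_setI fMb inE; move: sd; case: (_ \in U); case: (_ \in U).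
  rewrite -bE (bigD1 e) //= [RHS](bigD1 e) //= eU addrAC; congr (_ + _).
  apply: eq_bigr => f /andP[fM1 fe]; case: ifP => // fU.
  have : f \in [set e] by rewrite -Ee inE fM1.
  by rewrite inE (negPf fe).
apply: le_trans M1w; rewrite -subr_ge0.
have le2 := le_trans M2w M2neg; apply: le_trans (_ : - \sum_(e0 | ~~ ((src e0 \in W :\: U) && (dst e0 \in W :\: U)))
  (if e0 \in boundary src dst U then - (Mb e0).2 else w e0) * x e0 <= _); first by rewrite oppr_ge0.
rewrite -subr_ge0 opprK le_eqVlt; apply/orP; left; apply/eqP/esym.
rewrite big_mkcond [X in _ - X + _]big_mkcond [X in _ + X]big_mkcond /=.
rewrite -sumrB -big_split; apply: big1 => f _ /=.
have [->|xf] := eqVneq (x f) 0; first by rewrite !mulr0 !if_same; ring.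
have /and3P[sW dW _] := feas_supp fx xf; rewrite !inE sW dW !andbT.
by case: (_ \in U); case: (_ \in U) => /=; ring.
Qed.
End SupportsGlue.

Lemma subset_extend (T : finType) (A B : {set T}) (k : nat) :
  A \subset B -> (#|A| <= k <= #|B|)%N -> exists C : {set T}, [/\ A \subset C, C \subset B & #|C| = k].
Proof.
move=> AB; elim: k => [|k IH] /andP[Ak kB].
  by exists A; split=> //; apply/eqP; rewrite -leqn0.
move: Ak; rewrite leq_eqVlt => /orP[/eqP Ak|Ak]; first by exists A.
have [|C [AC CB Ck]] := IH; first by rewrite -ltnS Ak /= ltnW.
have /set0Pn[z] : B :\: C != set0.
  by rewrite -card_gt0 cardsD (setIidPr CB) Ck subn_gt0.
rewrite inE => /andP[zC zB]; exists (z |: C); split.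
- by apply: subset_trans AC (subsetU1 _ _).
- by rewrite subUset sub1set zB.
- by rewrite cardsU1 zC Ck.
Qed.

(** * Edmonds' theorem *)

Section EdmondsTheorem.
Variable R : realFieldType.
Variables (V E : finType).
Implicit Types (src dst : E -> V) (W U : {set V}) (x y w : E -> R).

(** Counts the inequalities that are still strict; a move that preserves the tight ones and gains
    another lowers it. *)
Definition slack_measure src dst W x : nat :=
  #|[set e | x e != 0]| +
  #|[set U : {set V} | [&& U \subset W, odd #|U| & \sum_(e in boundary src dst U) x e != 1]]|.

Definition only_trivial_tight src dst W x :=
  [forall U : {set V}, [&& U \subset W, odd #|U|, (3 <= #|U|)%N & (3 <= #|W :\: U|)%N] ==>
     (\sum_(e in boundary src dst U) x e != 1)].

(** A ratio test as in the simplex method: a move along [y] preserves the tight constraints, and its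
    length is the least ratio of slack to rate of decrease, so that one more constraint becomes
    tight. *)
Lemma kernel_step src dst W x y w :
  feasible src dst W x ->
  (exists e, y e != 0) -> (forall e, y e != 0 -> x e != 0) ->
  (forall v, v \in W -> \sum_(e in boundary src dst [set v]) y e = 0) ->
  (forall U, U \subset W -> odd #|U| -> \sum_(e in boundary src dst U) x e = 1 ->
     \sum_(e in boundary src dst U) y e = 0) ->
  0 <= \sum_e w e * y e ->
  exists x', [/\ feasible src dst W x', (slack_measure src dst W x' < slack_measure src dst W x)%N,
     (forall e, x e = 0 -> x' e = 0) & \sum_e w e * x e <= \sum_e w e * x' e].
Proof.
move=> fx [e0 ye0] yx yv yU wy.
pose rate (i : E + {set V}) := match i with inl e => - y e | inr U => - \sum_(e in boundary src dst U) y e end.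
pose slk (i : E + {set V}) := match i with inl e => x e | inr U => \sum_(e in boundary src dst U) x e - 1 end.
pose ok (i : E + {set V}) := match i with inl e => true | inr U => (U \subset W) && odd #|U| end.
have slk_ge0 i : ok i -> 0 <= slk i.
  by case: i => [e|U] /= => [_|/andP[UW oU]]; rewrite ?subr_ge0 ?(feas_odd fx) // (feas_ge0 fx).
have slk0 i : ok i -> slk i = 0 -> rate i = 0.
  case: i => [e|U] /= => [_ xe|/andP[UW oU] /eqP]; last first.
    by rewrite subr_eq0 => /eqP /(yU _ UW oU) ->; rewrite oppr0.
  by apply/eqP; rewrite oppr_eq0; apply: contraTT isT => /yx; rewrite xe eqxx.
(* Since the vertex sums of [y] vanish, [y] has a negative entry and the move has to stop. *)
have [em yem] : exists e, y e < 0.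
  have /and3P[sW _ sd] := feas_supp fx (yx _ ye0).
  have ec : e0 \in boundary src dst [set src e0] by rewrite !inE eqxx [dst e0 == _]eq_sym (negPf sd).
  apply/existsP; apply: contraT; rewrite negb_exists => /forallP nn.
  have pos e : 0 <= y e by rewrite leNgt nn.
  have /eqP := yv _ sW; rewrite psumr_eq0 // => /allP /(_ e0 (mem_index_enum _)).
  by rewrite ec (negPf ye0).
pose cand i := ok i && (0 < rate i).
have Pi0 : cand (inl em) by rewrite /cand /= oppr_gt0.
have [i /andP[oi ri] imin] := arg_minP (fun i => slk i / rate i) Pi0.
set t := slk i / rate i in imin.
have si : 0 < slk i.
  rewrite lt0r slk_ge0 // andbT; apply: contraTneq ri => /(slk0 _ oi) ->; by rewrite ltxx.
have t0 : 0 < t by rewrite divr_gt0.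
have slk' j : ok j -> t * rate j <= slk j.
  move=> oj; have [rj|rj] := ltrP 0 (rate j).
    by rewrite -ler_pdivlMr //; apply: imin; rewrite /cand oj.
  by apply: le_trans (slk_ge0 _ oj); rewrite pmulr_rle0.
exists (fun e => x e + t * y e).
have sumE (A : {set E}) : \sum_(e in A) (x e + t * y e) = \sum_(e in A) x e + t * \sum_(e in A) y e.
  by rewrite big_split mulr_sumr.
have tight0 e : x e = 0 -> x e + t * y e = 0.
  move=> xe; rewrite xe add0r; apply/eqP; rewrite mulf_eq0 (gt_eqF t0) /=.
  by apply: contraTT isT => /yx; rewrite xe eqxx.
have fx' : feasible src dst W (fun e => x e + t * y e).
  split.
  - by move=> e; have := slk' (inl e) isT; rewrite /= mulrN -subr_ge0 opprK.
  - by move=> e nz; apply: (feas_supp fx); apply: contraNneq nz => /tight0 ->.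
  - by move=> v vW; rewrite sumE yv // mulr0 addr0 (feas_vertex fx).
  - move=> U UW oU; rewrite sumE; have := slk' (inr U); rewrite /= UW oU mulrN => /(_ isT).
    by rewrite lerNl -subr_ge0; lra.
split => //; last first.
  rewrite -subr_ge0 -sumrB (eq_bigr (fun e => t * (w e * y e))) => [|e _]; last by ring.
  by rewrite -mulr_sumr mulr_ge0 // ltW.
have subE : [set e | x e + t * y e != 0] \subset [set e | x e != 0].
  by apply/subsetP => e; rewrite !inE; apply: contraNneq => /tight0 ->.
pose nt x := [set U : {set V} | [&& U \subset W, odd #|U| & \sum_(e in boundary src dst U) x e != 1]].
have subU : nt (fun e => x e + t * y e) \subset nt x.
  apply/subsetP => U; rewrite !inE => /and3P[UW oU]; rewrite UW oU /= sumE.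
  by apply: contraNneq => xU; rewrite xU yU // mulr0 addr0.
have tr : t * rate i = slk i by rewrite /t divfK // gt_eqF.
rewrite /slack_measure -/(nt x) -/(nt (fun e => x e + t * y e)).
clearbody t; case: i oi ri si tr => [e|U] /= oi ri si tr.
  rewrite -addSn leq_add ?subset_leq_card // proper_card //.
  rewrite properE subE /=; apply/subsetPn; exists e; first by rewrite inE gt_eqF.
  by rewrite inE negbK -tr mulrN addNr.
rewrite -addnS leq_add ?subset_leq_card // proper_card //.
rewrite properE subU /=; apply/subsetPn; have [UW oU] := andP oi; exists U; rewrite inE UW oU /=.
  by rewrite -subr_eq0 gt_eqF.
rewrite negbK sumE; apply/eqP; move: tr; rewrite mulrN => tr.
by apply/eqP; rewrite -subr_eq0 addrAC -tr addNr.
Qed.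

(** If the only tight cuts are those around one vertex or its complement, a kernel vector of the
    vertex equations respects all of them; one of [y] and [- y] does not lower the weight. *)
Lemma kernel_supports src dst W x y :
  feasible src dst W x -> only_trivial_tight src dst W x ->
  (exists e, y e != 0) -> (forall e, y e != 0 -> x e != 0) ->
  (forall v, v \in W -> \sum_(e in boundary src dst [set v]) y e = 0) ->
  (forall x', feasible src dst W x' ->
     (slack_measure src dst W x' < slack_measure src dst W x)%N -> supports_pm src dst W x') ->
  supports_pm src dst W x.
Proof.
move=> fx tt y0 yx yv IH w.
have yU U : U \subset W -> odd #|U| -> \sum_(e in boundary src dst U) x e = 1 ->
     \sum_(e in boundary src dst U) y e = 0.
  move=> UW oU xU; have := forallP tt U; rewrite UW oU xU eqxx implybF /= negb_and -!leqNgt.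
  have sub1 (A : {set V}) : odd #|A| -> ~~ (3 <= #|A|)%N -> exists v, A = [set v].
    by move=> oA A3; apply/cards1P; move: oA A3; case: #|A| => [|[|[|]]].
  have oC : odd #|W :\: U|.
    have := feasible_even fx; rewrite -(cardsID U W) (setIidPr UW) oddD oU.
    by case: (odd #|W :\: U|).
  case/orP => [|] U2.
    by have [|v Uv] := sub1 U oU; [rewrite -leqNgt | rewrite Uv yv // -sub1set -Uv].
  have [|v Uv] := sub1 _ oC; first by rewrite -leqNgt.
  rewrite -(cut_compl_sum fx UW) ?Uv ?yv //; last by move=> e xe; apply: contraTeq isT => /yx; rewrite xe eqxx.
  have : v \in W :\: U by rewrite Uv set11.
  by rewrite in_setD => /andP[].
have main y' : (exists e, y' e != 0) -> (forall e, y' e != 0 -> x e != 0) ->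
  (forall v, v \in W -> \sum_(e in boundary src dst [set v]) y' e = 0) ->
  (forall U, U \subset W -> odd #|U| -> \sum_(e in boundary src dst U) x e = 1 ->
     \sum_(e in boundary src dst U) y' e = 0) ->
  0 <= \sum_e w e * y' e -> exists M : {set E},
    [/\ M \subset [set e | x e != 0], matches src dst W M &
        \sum_e w e * x e <= \sum_(e in M) w e].
  move=> y1 y2 y3 y4 y5; have [x' [fx' m s le]] := kernel_step fx y1 y2 y3 y4 y5.
  have [M [Ms Mm Mw]] := IH _ fx' m w; exists M; split => //; last exact: le_trans Mw.
  apply: (subset_trans Ms); apply/subsetP => e; rewrite !inE; apply: contraNneq => /s ->.
  by [].
have [wy|/ltW wy] := lerP 0 (\sum_e w e * y e); first exact: main wy.
apply: (main (fun e => - y e)).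
- by have [e ye] := y0; exists e; rewrite oppr_eq0.
- by move=> e; rewrite oppr_eq0; apply: yx.
- by move=> v vW; rewrite sumrN yv ?oppr0.
- by move=> U *; rewrite sumrN yU ?oppr0.
- rewrite (eq_bigr (fun e => - (w e * y e))) => [|e _]; last by rewrite mulrN.
  by rewrite sumrN oppr_ge0.
Qed.
(** On four vertices split into two pairs, both pairs have vertex sum 2 and the same cut, hence the
    same inner weight. A support edge on one pair thus forces one on the other. *)
Lemma small_matching src dst W x :
  feasible src dst W x -> (#|W| <= 4)%N ->
  exists M : {set E}, M \subset [set e | x e != 0] /\ matches src dst W M.
Proof.
move=> fx W4; have [->|[v vW]] := set_0Vmem W.
  by exists set0; split; [exact: sub0set | apply/matchesP => v; rewrite inE].
have nl e : x e != 0 -> src e != dst e by case/(feas_supp fx)/and3P.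
have edge_in (B : {set V}) : B \subset W -> #|B| = 2 ->
    0 < \sum_(e | (src e \in B) && (dst e \in B)) x e ->
    exists2 f, x f != 0 & B = [set src f; dst f].
  move=> BW B2 pos.
  have /existsP[f /andP[/andP[fs fd] xf]] : [exists f, ((src f \in B) && (dst f \in B)) && (x f != 0)].
    apply: contraTT pos; rewrite negb_exists => /forallP no; rewrite big1 ?ltxx // => f fB.
    by apply/eqP; move: (no f); rewrite fB negbK.
  exists f => //; apply/esym/eqP; rewrite eqEcard subUset !sub1set fs fd B2 cards2.
  by rewrite (nl _ xf).
have cutE f (B : {set V}) u : x f != 0 -> B = [set src f; dst f] -> u \in W ->
    (f \in boundary src dst [set u]) = (u \in B).
  move=> /nl sd -> uW; rewrite !inE ![u == _]eq_sym.
  case: (eqVneq (src f) u) sd => [->|_]; case: (eqVneq (dst f) u) => //= ->; by rewrite ?eqxx.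
have [e0 xe0 e0v] : exists2 e, x e != 0 & e \in boundary src dst [set v].
  have /existsP[f /andP[fv xf]] : [exists f, (f \in boundary src dst [set v]) && (x f != 0)].
    have := feas_vertex fx vW; apply: contra_eqT; rewrite negb_exists => /forallP no.
    rewrite big1 ?[0 == _]eq_sym ?oner_eq0 // => f fB; apply/eqP; move: (no f).
    by rewrite fB negbK.
  by exists f.
have /and3P[sW dW sd] := feas_supp fx xe0.
pose A := [set src e0; dst e0].
have AW : A \subset W by rewrite subUset !sub1set sW dW.
have A2 : #|A| = 2 by rewrite cards2 sd.
pose B := W :\: A.
have BW : B \subset W by apply: subsetDl.
have cB : #|W| = (2 + #|B|)%N by rewrite -(cardsID A W) (setIidPr AW) A2.
have eqB := cut_compl_sum fx AW (fun e (h : x e = 0) => h).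
have sums (U : {set V}) : U \subset W -> \sum_(u in U) \sum_(e in boundary src dst [set u]) x e = #|U|%:R.
  move=> UW; rewrite (eq_bigr (fun _ => 1)) ?sumr_const // => u uU.
  by rewrite (feas_vertex fx) // (subsetP UW).
have /eqP := sum_vertex_cuts A nl; rewrite sums // A2 => /eqP EA.
have := sum_vertex_cuts B nl; rewrite sums // eqB => EB.
have posA : 0 < \sum_(e | (src e \in A) && (dst e \in A)) x e.
  rewrite (bigD1 e0) /=; last by rewrite !inE !eqxx orbT.
  by rewrite ltr_wpDr ?sumr_ge0 // => [e _|]; rewrite ?lt0r ?xe0 (feas_ge0 fx).
have : #|B| = 0%N \/ #|B| = 2.
  have := feasible_even fx; rewrite cB; move: W4; rewrite cB.
  by case: #|B| => [|[|[|k]]] //=; [left|right].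
case=> [/cards0_eq B0|B2].
  have WA : W = A.
    by apply/eqP; rewrite eqEsubset AW andbT -setD_eq0 -/B B0.
  exists [set e0]; split; first by rewrite sub1set inE.
  apply/matchesP => u uW; rewrite (_ : _ :&: _ = [set e0]) ?cards1 //.
  apply/setIidPl; rewrite sub1set (cutE _ A) // -WA //.
have [|f xf Bf] := edge_in B BW B2.
  by move: EA EB posA; rewrite B2; lra.
have AB u : u \in W -> (u \in B) = (u \notin A) by move=> uW; rewrite in_setD uW andbT.
exists [set e0; f]; split; first by rewrite subUset !sub1set !inE xe0.
apply/matchesP => u uW; rewrite setIUl cardsU.
have s1 g (D : {set V}) : x g != 0 -> D = [set src g; dst g] ->
    [set g] :&: boundary src dst [set u] = if u \in D then [set g] else set0.
  move=> xg Dg; rewrite -(cutE g D) //; apply/setP => h; rewrite in_setI in_set1.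
  have [->|hg] := eqVneq h g; case: (boolP (g \in boundary src dst [set u])) => _;
    by rewrite ?in_set1 ?in_set0 ?eqxx ?(negPf hg).
rewrite (s1 e0 A) // (s1 f B) // AB //.
by case: (u \in A); rewrite /= ?setI0 ?set0I !cards1 ?cards0.
Qed.
(* If a, b are the only neighbours of v, then {v, a, b} spans weight at least 1, so its boundary has
   weight at most 3 - 2 = 1. *)
Lemma low_degree_tight src dst W x v :
  feasible src dst W x -> (6 <= #|W|)%N -> v \in W ->
  (#|[set e in boundary src dst [set v] | (x e != 0)%R]| <= 2)%N -> ~~ only_trivial_tight src dst W x.
Proof.
move=> fx W6 vW S2.
set S := [set e in _ | _] in S2.
have nl e : x e != 0 -> src e != dst e by case/(feas_supp fx)/and3P.
pose other e := if src e == v then dst e else src e.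
have TW : v |: [set other e | e in S] \subset W.
  rewrite subUset sub1set vW; apply/subsetP => _ /imsetP[e eS ->].
  move: eS; rewrite inE => /andP[_ /(feas_supp fx)/and3P[sW dW _]].
  by rewrite /other; case: ifP.
have [|U [TU UW U3]] := subset_extend (k := 3) TW.
  rewrite (leq_trans _ W6) // andbT cardsU1.
  have : (#|[set other e | e in S]| <= 2)%N := leq_trans (leq_imset_card _ _) S2.
  by case: (v \notin _) => /=; lia.
rewrite negb_forall; apply/existsP; exists U.
rewrite negb_imply UW U3 /= negbK.
rewrite cardsD (setIidPr UW) U3; apply/andP; split; first by move: W6; lia.
have innerS e : e \in S -> (src e \in U) && (dst e \in U).
  move=> eS; have oU : other e \in U.
    by apply: (subsetP TU); rewrite inE imset_f ?orbT.
  have vU : v \in U by apply: (subsetP TU); rewrite setU11.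
  move: eS; rewrite /other in oU; rewrite !inE.
  case: (eqVneq (src e) v) oU => [->|_] oU; rewrite ?vU ?oU //=.
  by case: (eqVneq (dst e) v) => // ->.
have inU : 1 <= \sum_(e | (src e \in U) && (dst e \in U)) x e.
  rewrite -(feas_vertex fx vW) big_mkcond [leRHS]big_mkcond; apply: ler_sum => e _.
  case: (boolP (e \in boundary src dst [set v])) => ev; last by case: ifP => // _; rewrite (feas_ge0 fx).
  have [->|xe] := eqVneq (x e) 0; first by rewrite if_same.
  by rewrite innerS // inE ev.
have := sum_vertex_cuts U nl.
rewrite (eq_bigr (fun _ => 1)) => [|u uU]; last by rewrite (feas_vertex fx) // (subsetP UW).
rewrite sumr_const U3 => Esum.
have := feas_odd fx UW; rewrite U3 => /(_ isT) ge1.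
by rewrite eq_le ge1 andbT; lra.
Qed.

(** With three support edges at every vertex the support has at least [3/2 |W|] edges, more than the
    [|W|] vertex equations. *)
Lemma kernel_cycle src dst W x :
  feasible src dst W x -> (0 < #|W|)%N ->
  (forall v, v \in W -> (2 < #|[set e in boundary src dst [set v] | (x e != 0)%R]|)%N) ->
  exists y : E -> R, [/\ exists e, y e != 0, forall e, y e != 0 -> x e != 0 &
    forall v, v \in W -> \sum_(e in boundary src dst [set v]) y e = 0].
Proof.
move=> fx W0 deg.
pose S := [set e | x e != 0].
have ltS : (#|W| < #|S|)%N.
  pose z e : R := (x e != 0)%:R.
  have nl e : z e != 0 -> src e != dst e.
    by rewrite pnatr_eq0 eqb0 negbK => /(feas_supp fx)/and3P[].
  have := sum_vertex_cuts W nl; rewrite [X in _ = X + _]big1 ?add0r; last first.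
    move=> e; rewrite /z; case: eqVneq => //= xe; rewrite inE.
    by have /and3P[-> -> _] := feas_supp fx xe.
  have -> : \sum_(e | (src e \in W) && (dst e \in W)) z e = #|S|%:R.
    rewrite -sum1_card natr_sum big_mkcond [RHS]big_mkcond; apply: eq_bigr => e _.
    rewrite inE /z; case: (eqVneq (x e) 0) => xe /=; first by rewrite if_same.
    by have /and3P[-> -> _] := feas_supp fx xe.
  move=> eq2; have : (3 * #|W|)%N%:R <= 2 * #|S|%:R :> R.
    rewrite -eq2 natrM mulr_natr -sumr_const; apply: ler_sum => v vW.
    apply: le_trans (_ : (#|[set e in boundary src dst [set v] | x e != 0]|)%:R <= _).
      by rewrite ler_nat; apply: deg.
    rewrite -sum1_card natr_sum big_mkcond [leRHS]big_mkcond; apply: ler_sum => e _.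
    by rewrite [in leLHS]inE /z; case: (e \in _) => //=; case: eqVneq.
  by rewrite -natrM ler_nat; move: W0; lia.
pose l := [seq [ffun e => (e \in boundary src dst [set v])%:R : R] | v <- enum W] ++
          [seq [ffun e => (e == f)%:R : R] | f <- enum (~: S)].
have szl : (size l < #|E|)%N.
  by rewrite size_cat !size_map -!cardE -(cardsC S) ltn_add2r.
have [y [e ye] ly] := kernel_vector szl.
exists y; split; first by exists e.
- move=> f; apply: contraNneq => xf.
  have /ly : [ffun e => (e == f)%:R : R] \in l.
    rewrite mem_cat; apply/orP; right; apply/mapP; exists f => //.
    by rewrite mem_enum !inE xf eqxx.
  rewrite (bigD1 f) //= ffunE eqxx mul1r big1 ?addr0 => [-> //|g /negPf gf].
  by rewrite ffunE gf mul0r.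
- move=> v vW; have /ly : [ffun e => (e \in boundary src dst [set v])%:R : R] \in l.
    by rewrite mem_cat; apply/orP; left; apply/mapP; exists v; rewrite ?mem_enum.
  move=> y0; rewrite -[RHS]y0 big_mkcond; apply: eq_bigr => f _; rewrite ffunE.
  by case: (f \in _); rewrite ?mul1r ?mul0r.
Qed.

(* Induction on |W|, then on slack_measure: contract both sides of a nontrivial tight odd set, or,
   when there is none, slide along a kernel vector until another constraint becomes tight. *)
Lemma edmonds src dst W x : feasible src dst W x -> supports_pm src dst W x.
Proof.
have [n] := ubnP #|W|; elim: n src dst W x => // n IHn src dst W x.
have [k] := ubnP (slack_measure src dst W x); elim: k x => // k IHk x xk Wn fx.
have IH x' : feasible src dst W x' ->
    (slack_measure src dst W x' < slack_measure src dst W x)%N -> supports_pm src dst W x'.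
  by move=> fx' lt; apply: IHk => //; apply: leq_trans lt _.
case: (boolP (only_trivial_tight src dst W x)) => [tt|]; last first.
  rewrite negb_forall => /existsP[U]; rewrite negb_imply negbK => /andP[/and4P[UW oU U3 C3] /eqP xU].
  have /set0Pn[a aU] : U != set0 by rewrite -card_gt0 (leq_trans _ U3).
  have /set0Pn[b bC] : W :\: U != set0 by rewrite -card_gt0 (leq_trans _ C3).
  have oC : odd #|W :\: U|.
    have := feasible_even fx; rewrite -(cardsID U W) (setIidPr UW) oddD oU.
    by case: (odd #|W :\: U|).
  have cW : #|W| = (#|U| + #|W :\: U|)%N by rewrite -(cardsID U W) (setIidPr UW).
  apply: (supports_glue fx UW aU bC).
    apply: IHn (feasible_contract fx UW aU oU xU).
    rewrite cardsU1; move: Wn C3 U3; rewrite cW; case: (_ \notin _) => /=; lia.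
  apply: IHn (feasible_contract fx (subsetDl _ _) bC oC _); last first.
    by rewrite (cut_compl_sum fx UW (fun e (h : x e = 0) => h)).
  rewrite setDDr setDv set0U (setIidPr UW) cardsU1; move: Wn C3 U3; rewrite cW; case: (_ \notin _) => /=; lia.
(* The tight triple of [low_degree_tight] is nontrivial only if three more vertices remain. On at
   most four vertices an explicit matching supplies the direction [x - 1_M]; if that is zero, [x] is
   the matching. *)
have [W4|W5] := leqP #|W| 4.
  have [M [Ms Mm]] := small_matching fx W4.
  pose y e : R := x e - (e \in M)%:R.
  have [/existsP[e ye]|/existsPn y0] := boolP [exists e, y e != 0].
    apply: (kernel_supports (y := y) fx tt _ _ _ IH); first by exists e.
      move=> f; apply: contraNneq => xf; rewrite /y xf.
      by case: (boolP (f \in M)) => [/(subsetP Ms)|]; rewrite ?inE ?xf ?eqxx ?subr0.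
    move=> v vW; rewrite sumrB (feas_vertex fx vW).
    rewrite (_ : \sum_(i in _) _ = 1) ?subrr // -[RHS](_ : (1%N)%:R = _) //.
    rewrite -(matchesP _ _ _ _ Mm v vW) -sum1_card natr_sum big_mkcond [RHS]big_mkcond.
    by apply: eq_bigr => f _; rewrite in_setI andbC; case: (_ \in boundary _ _ _); case: (f \in M).
  move=> w; exists M; split => //.
  rewrite [leRHS]big_mkcond; apply: ler_sum => e _.
  have := y0 e; rewrite negbK subr_eq0 => /eqP ->.
  by case: (e \in M); rewrite ?mulr1 ?mulr0.
have W6 : (6 <= #|W|)%N.
  rewrite ltn_neqAle W5 andbT; apply: contraTneq (feasible_even fx) => <-; by [].
have W0 : (0 < #|W|)%N by apply: leq_trans W6.
have [|y [y0 yx yv]] := kernel_cycle fx W0.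
  move=> v vW; rewrite ltnNge; apply: contraL tt; exact: low_degree_tight.
exact: kernel_supports fx tt y0 yx yv IH.
Qed.

End EdmondsTheorem.

(** * Fat points of the matching polytope *)

Section Orthonormal.
Variables (R : realType) (E : finType).
Implicit Types (f g z : E -> R).

Definition dot f g : R := \sum_e f e * g e.

Definition orthonormal_fun d (u : nat -> E -> R) :=
  forall i j, (i < d)%N -> (j < d)%N -> dot (u i) (u j) = (i == j)%:R.

Lemma dot_comb d (u : nat -> E -> R) (a b : 'I_d -> R) : orthonormal_fun d u ->
  dot (fun e => \sum_(i < d) a i * u i e) (fun e => \sum_(i < d) b i * u i e) =
  \sum_(i < d) a i * b i.
Proof.
move=> ou; rewrite /dot.
transitivity (\sum_e \sum_(i < d) \sum_(j < d) a i * b j * (u i e * u j e)).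
  apply: eq_bigr => e _; rewrite mulr_suml; apply: eq_bigr => i _.
  by rewrite mulr_sumr; apply: eq_bigr => j _; ring.
rewrite exchange_big; apply: eq_bigr => i _ /=; rewrite exchange_big /=.
rewrite (bigD1 i) //= -mulr_sumr -/(dot _ _) ou // eqxx mulr1.
rewrite big1 ?addr0 // => j ji; rewrite -mulr_sumr -/(dot _ _) ou //.
by rewrite eq_sym (_ : (val j == val i) = (j == i)) // (negPf ji) mulr0.
Qed.

Lemma bessel d (u : nat -> E -> R) z : orthonormal_fun d u ->
  \sum_(i < d) dot (u i) z ^+ 2 <= dot z z.
Proof.
move=> ou; pose c (i : 'I_d) := dot (u i) z.
pose y e := \sum_(i < d) c i * u i e.
have yy : dot y y = \sum_(i < d) c i ^+ 2.
  by rewrite dot_comb //; apply: eq_bigr => i _; rewrite expr2.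
have yz : dot y z = \sum_(i < d) c i ^+ 2.
  rewrite /dot; transitivity (\sum_e \sum_(i < d) c i * (u i e * z e)).
    by apply: eq_bigr => e _; rewrite mulr_suml; apply: eq_bigr => i _; rewrite mulrA.
  by rewrite exchange_big; apply: eq_bigr => i _; rewrite -mulr_sumr expr2.
have : 0 <= \sum_e (z e - y e) ^+ 2 by apply: sumr_ge0 => e _; exact: sqr_ge0.
have -> : \sum_e (z e - y e) ^+ 2 = dot z z - 2 * dot y z + dot y y.
  rewrite /dot mulr_sumr -sumrB -big_split; apply: eq_bigr => e _ /=; ring.
by rewrite yy yz /c; lra.
Qed.

Lemma bessel_coord d (u : nat -> E -> R) e : orthonormal_fun d u ->
  \sum_(i < d) u i e ^+ 2 <= 1.
Proof.
move=> ou; have := bessel (fun e' => (e' == e)%:R) ou.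
have dotE f : dot f (fun e' => (e' == e)%:R) = f e.
  rewrite /dot (bigD1 e) //= eqxx mulr1 big1 ?addr0 // => e' /negPf ->.
  by rewrite mulr0.
by rewrite dotE eqxx (eq_bigr (fun i : 'I_d => u i e ^+ 2)) => [|i _]; rewrite ?dotE.
Qed.

(** Gram-Schmidt without projections: each new vector is taken in the common kernel of [l] and the
    earlier vectors, then normalised. *)
Lemma orthonormal_in_kernel (l : seq {ffun E -> R}) d : (size l + d <= #|E|)%N ->
  exists u : nat -> E -> R, orthonormal_fun d u /\
    forall i, (i < d)%N -> forall f : {ffun E -> R}, f \in l -> \sum_e f e * u i e = 0.
Proof.
elim: d => [|d IH] ld; first by exists (fun _ _ => 0); split.
have [|u [ou lu]] := IH; first by move: ld; lia.
have [|y [e0 ye0] yl] := @kernel_vector R E (l ++ mkseq (fun i => [ffun e => u i e]) d).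
  by rewrite size_cat size_mkseq -addnS.
have pos : 0 < dot y y.
  rewrite /dot (bigD1 e0) //= ltr_wpDr ?sumr_ge0 // => [e _|]; first by rewrite -expr2 sqr_ge0.
  by rewrite -expr2 exprn_even_gt0.
pose v e := y e / Num.sqrt (dot y y).
have s0 : Num.sqrt (dot y y) != 0 by rewrite gt_eqF // sqrtr_gt0.
have dotv f : dot f v = dot f y / Num.sqrt (dot y y).
  by rewrite /dot mulr_suml; apply: eq_bigr => e _; rewrite mulrA.
have uy i : (i < d)%N -> dot (u i) y = 0.
  move=> id; have /yl : [ffun e => u i e] \in l ++ mkseq (fun i => [ffun e => u i e]) d.
    by rewrite mem_cat; apply/orP; right; apply/mapP; exists i; rewrite ?mem_iota.
  by move=> z0; rewrite -[RHS]z0; apply: eq_bigr => e _; rewrite ffunE.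
have dC f g : dot f g = dot g f by apply: eq_bigr => e _; rewrite mulrC.
exists (fun i => if (i < d)%N then u i else v); split.
  move=> i j; rewrite !ltnS => id jd.
  case: ltnP => i_d; case: ltnP => j_d.
  - exact: ou.
  - by rewrite dotv uy // mul0r ltn_eqF // (leq_trans i_d).
  - by rewrite dC dotv uy // mul0r gtn_eqF // (leq_trans j_d).
  - have -> : i = j by apply/eqP; rewrite eqn_leq (leq_trans id) // (leq_trans jd).
    rewrite eqxx dotv dC dotv -[in X in X / _ / _](sqr_sqrtr (ltW pos)).
    by rewrite expr2 mulfK // divff.
move=> i id f fl; case: ltnP => i_d; first exact: lu.
rewrite -/(dot f v) dotv (_ : dot f y = 0) ?mul0r //.
by apply: yl; rewrite mem_cat fl.
Qed.

End Orthonormal.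

(** * Exponential moments of random signs *)

Section Signs.
Variable R : realType.

Definition sg (b : bool) : R := if b then 1 else -1.

(** [expR (- a) >= 1 - a] gives [expR a <= (1 - a)^-1], and [(1 - a)(1 + a + 2 a^2) = 1 + a^2 (1 - 2
    a)]. *)
Lemma expR_le_quadratic (a : R) : a <= 2^-1 -> expR a <= 1 + a + 2 * a ^+ 2.
Proof.
move=> a1; have p : 0 < 1 - a by lra.
rewrite -[a in expR a]opprK expRN.
apply: le_trans (_ : (1 - a)^-1 <= _).
  by rewrite lef_pV2 ?posrE ?expR_gt0 // -[1 - a]/(1 + - a) expR_ge1Dx.
rewrite -[leLHS]mul1r ler_pdivrMr //.
have : 0 <= a ^+ 2 * (1 - 2 * a) by rewrite mulr_ge0 ?sqr_ge0 //; lra.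
by rewrite expr2; nra.
Qed.

(** A weak form of [cosh a <= exp (a^2 / 2)]: for small [a] the linear terms cancel, for large [a]
    already [|a| <= 2 a^2]. *)
Lemma expR_sym (a : R) : expR a + expR (- a) <= 2 * expR (2 * a ^+ 2).
Proof.
have [small|large] := lerP `|a| 2^-1.
  move: small; rewrite ler_norml => /andP[a1 a2].
  have := expR_le_quadratic a2; have : - a <= 2^-1 by lra.
  move=> /expR_le_quadratic; rewrite sqrrN.
  by have := expR_ge1Dx (2 * a ^+ 2); lra.
have sq : `|a| <= 2 * a ^+ 2.
  by rewrite -real_normK ?num_real //; nra.
have h1 : expR a <= expR (2 * a ^+ 2) by rewrite ler_expR (le_trans _ sq) // ler_norm.
have h2 : expR (- a) <= expR (2 * a ^+ 2) by rewrite ler_expR (le_trans _ sq) // -normrN ler_norm.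
by lra.
Qed.

(** The exponential of the sum factors over independent signs: Hoeffding's bound, summed over all
    sign vectors rather than averaged. *)
Lemma sum_signs d (a : 'I_d -> R) :
  \sum_(g : {ffun 'I_d -> bool}) expR (\sum_i sg (g i) * a i) <=
  2 ^+ d * expR (2 * \sum_i a i ^+ 2).
Proof.
rewrite (eq_bigr (fun g : {ffun 'I_d -> bool} => \prod_i expR (sg (g i) * a i))); last first.
  by move=> g _; rewrite expR_sum.
rewrite -(bigA_distr_bigA (fun i b => expR (sg b * a i))) /=.
rewrite mulr_sumr expR_sum -[d in 2 ^+ d]card_ord -prodr_const -big_split /=.
apply: ler_prod => i _; rewrite big_bool /= /sg mul1r mulN1r.
by rewrite expR_sym andbT addr_ge0 // expR_ge0.
Qed.

End Signs.

(** * Matchings of a cubic graph whose matching polytope contains all points [>= 1/5] *)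

Section FatPolytope.
Variables (R : realType) (V E : finType) (src dst : E -> V) (W : {set V}) (F : {set E}) (r : V).
Hypothesis rW : r \in W.
Hypothesis F_in : forall e, e \in F -> [&& src e \in W, dst e \in W & src e != dst e].
Hypothesis cubF : forall v, v \in W -> #|F :&: boundary src dst [set v]| = 3.
Hypothesis fat : forall x : E -> R, (forall e, e \notin F -> x e = 0) ->
  (forall e, e \in F -> 5%:R^-1 <= x e) ->
  (forall v, v \in W -> \sum_(e in boundary src dst [set v]) x e = 1) ->
  supports_pm src dst W x.

Definition pm_in (L : {set E}) := (L \subset F) && matches src dst W L.
Definition pm_through e := #|[set L | pm_in L && (e \in L)]|.

Lemma sum_F_vertex (x : E -> R) : (forall e, e \notin F -> x e = 0) ->
  \sum_(v in W) \sum_(e in boundary src dst [set v]) x e = 2 * \sum_e x e.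
Proof.
move=> xF; rewrite sum_vertex_cuts => [|e xe]; last first.
  have /F_in/and3P[] // : e \in F by apply: contraNT xe => /xF ->.
rewrite big1 ?add0r => [|e]; last first.
  rewrite inE; case: (boolP (e \in F)) => [/F_in/and3P[-> -> _] //|/xF //].
congr (_ * _); rewrite big_mkcond; apply: eq_bigr => e _.
by case: (boolP (e \in F)) => [/F_in/and3P[-> -> _]|/xF ->] //; rewrite if_same.
Qed.

Lemma card_sub_F (L : {set E}) k : L \subset F ->
  (forall v, v \in W -> #|L :&: boundary src dst [set v]| = k) -> (#|W| * k = 2 * #|L|)%N.
Proof.
move=> LF Lk; apply/eqP; rewrite -(eqr_nat R) !natrM.
have := @sum_F_vertex (fun e => (e \in L)%:R) _; rewrite (eq_bigr (fun _ => k%:R)); last first.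
  move=> v vW; rewrite -(Lk v vW) -sum1_card natr_sum big_mkcond [RHS]big_mkcond.
  by apply: eq_bigr => e _; rewrite in_setI; case: (e \in L); case: (e \in _).
rewrite sumr_const -[_ *+ _]mulr_natr mulrC => ->; last first.
  by move=> e eF; rewrite (contraNF (subsetP LF e) eF).
apply/eqP; congr (_ * _); rewrite -sum1_card natr_sum [RHS]big_mkcond.
by apply: eq_bigr => e _; case: (e \in L).
Qed.

Lemma card_F : (#|W| * 3 = 2 * #|F|)%N.
Proof. exact: card_sub_F (subxx _) cubF. Qed.

Lemma card_pm L : pm_in L -> (#|W| = 2 * #|L|)%N.
Proof.
by case/andP=> LF /matchesP Lm; rewrite -(card_sub_F LF Lm) muln1.
Qed.

(** Dimension count: [3/2 |W|] edges, minus [|W| - 1] vertex equations, minus the three edges at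
    [r], where the equation then holds by itself. Since the vectors vanish at [r], a weight placed
    on the root edges is orthogonal to them. *)
Lemma edge_family d : (2 * d + 4 <= #|W|)%N ->
  exists u : nat -> E -> R, orthonormal_fun d u /\ forall i, (i < d)%N ->
    [/\ forall e, e \notin F -> u i e = 0, forall e, e \in boundary src dst [set r] -> u i e = 0 &
        forall v, v \in W -> \sum_(e in boundary src dst [set v]) u i e = 0].
Proof.
move=> dW.
pose l := [seq [ffun e => (e \in boundary src dst [set v])%:R : R] | v <- enum (W :\ r)] ++
          [seq [ffun e => (e == f)%:R : R] | f <- enum (~: F)] ++
          [seq [ffun e => (e == f)%:R : R] | f <- enum (F :&: boundary src dst [set r])].
have [|u [ou lu]] := @orthonormal_in_kernel R E l d.
  rewrite /l !size_cat !size_map -!cardE cubF // -(cardsC F).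
  have := cardsD1 r W; rewrite rW; have := card_F; move: dW; lia.
have l1 i f : (i < d)%N -> (f \notin F) || (f \in F :&: boundary src dst [set r]) -> u i f = 0.
  move=> id fF; have /(lu i id) : [ffun e => (e == f)%:R : R] \in l.
    rewrite !mem_cat; apply/orP; right.
    by case/orP: fF => fF; apply/orP; [left|right]; apply: map_f; rewrite mem_enum // inE.
  rewrite (bigD1 f) //= ffunE eqxx mul1r big1 ?addr0 // => e /negPf ef.
  by rewrite ffunE ef mul0r.
have l2 i e : (i < d)%N -> e \in boundary src dst [set r] -> u i e = 0.
  by move=> id er; apply: l1 => //; rewrite inE er andbT orbC orbN.
exists u; split => // i id; split=> [e eF|e er|v vW]; first by rewrite l1 ?eF.
  exact: l2.
have [->|vr] := eqVneq v r; first by apply: big1 => e; exact: l2.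
have /(lu i id) e0 : [ffun e => (e \in boundary src dst [set v])%:R : R] \in l.
  by rewrite mem_cat; apply/orP; left; apply: map_f; rewrite mem_enum !inE vr.
rewrite -[RHS]e0 big_mkcond; apply: eq_bigr => e _; rewrite ffunE.
by case: (e \in _); rewrite ?mul1r ?mul0r.
Qed.

Definition third_point (t : R) (y : E -> R) e : R := if e \in F then 3%:R^-1 + t * y e else 0.

(** The bound [- 2/15 = 1/5 - 1/3] keeps [third_point] in the range of [fat]. *)
Lemma third_supports (t : R) (y : E -> R) :
  (forall e, e \notin F -> y e = 0) -> (forall e, - (2 / 15%:R) <= t * y e) ->
  (forall v, v \in W -> \sum_(e in boundary src dst [set v]) y e = 0) ->
  forall w : E -> R, exists2 L, pm_in L &
    3%:R^-1 * (\sum_(e in F) w e) + t * dot w y <= \sum_(e in L) w e.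
Proof.
move=> yF ty yv w.
have [||v vW|L [Ls Lm Lw]] := @fat (third_point t y) _ _ _ w.
- by move=> e /negPf eF; rewrite /third_point eF.
- by move=> e eF; rewrite /third_point eF; have := ty e; lra.
- rewrite big_mkcond (eq_bigr (fun e => (if e \in F :&: boundary src dst [set v] then 3%:R^-1 else 0) +
    t * (if e \in boundary src dst [set v] then y e else 0))); last first.
    move=> e _; rewrite /third_point in_setI.
    by case: (boolP (e \in F)) => [_|/yF ->]; case: (e \in _); rewrite /= ?mulr0 ?addr0.
  rewrite big_split /= -big_mkcond sumr_const cubF // -mulr_sumr -big_mkcond yv //.
  by rewrite mulr0 addr0; field.
exists L.
  rewrite /pm_in Lm andbT; apply: (subset_trans Ls); apply/subsetP => e.
  by rewrite inE /third_point; case: ifP => //; rewrite eqxx.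
apply: le_trans Lw; rewrite le_eqVlt; apply/orP; left; apply/eqP.
rewrite [\sum_(e in F) _]big_mkcond !mulr_sumr -big_split; apply: eq_bigr => e _ /=.
by rewrite /third_point; case: (boolP (e \in F)) => [_|/yF ->]; ring.
Qed.

Lemma pm_through_gt0 e : e \in F -> (0 < pm_through e)%N.
Proof.
move=> eF; have [|||L Lpm Lw] := @third_supports 0 (fun _ => 0) _ _ _ (fun f => (f == e)%:R) => //.
- by move=> f; rewrite mulr0; lra.
- by move=> v _; rewrite big1.
apply/card_gt0P; exists L; rewrite inE Lpm; apply: contraTT Lw => eL.
rewrite mul0r addr0 -ltNge [ltLHS]big1 => [|f fL]; last first.
  by case: eqVneq => // fe; rewrite -fe fL in eL.
rewrite (bigD1 e) //= eqxx big1 ?addr0 => [|f /andP[_ /negPf ->]] //; first by rewrite mulr1 invr_gt0 ltr0n.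
Qed.

Lemma pm_root_edge L : pm_in L ->
  exists2 e, e \in F :&: boundary src dst [set r] & L :&: boundary src dst [set r] = [set e].
Proof.
case/andP=> LF /matchesP /(_ r rW) /eqP/cards1P[e Le]; exists e => //.
have : e \in L :&: boundary src dst [set r] by rewrite Le set11.
by rewrite !inE => /andP[/(subsetP LF) -> ->].
Qed.

(** If every root edge [e] lay in at most one matching [N e], subtracting [y (N e)] at [e] would
    turn a unit kernel vector [y] into a weight [w] that vanishes on all matchings although
    [dot w y = 1]. The points [1/3] and [1/3 + 2/15 y], tested against [- w] and [w], then
    contradict each other. *)
Lemma exists_two_pm : (6 <= #|W|)%N ->
  exists e L1 L2, [/\ e \in F :&: boundary src dst [set r], pm_in L1, pm_in L2,
    e \in L1 :&: L2 & L1 != L2].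
Proof.
move=> W6.
have [|u [ou uP]] := @edge_family 1; first by move: W6; lia.
have [yF yr yv] := uP 0%N isT; set y := u 0%N in yF yr yv.
have yy : dot y y = 1 by rewrite ou.
have y1 e : `|y e| <= 1.
  have := bessel_coord e ou; rewrite big_ord1 -/y -real_normK ?num_real // => le1.
  by rewrite -(ler_pXn2r (n := 2)) ?nnegrE // expr1n.
pose B := F :&: boundary src dst [set r].
pose N e : {set E} := odflt set0 [pick L | pm_in L && (e \in L)].
have [/existsP[e /existsP[L1 /existsP[L2 /and5P[h1 h2 h3 h4 h5]]]]|no] := boolP [exists e, exists L1 : {set E}, exists L2 : {set E},
  [&& e \in B, pm_in L1, pm_in L2, e \in L1 :&: L2 & L1 != L2]].
  by exists e, L1, L2.
exfalso.
have NL e L : e \in B -> pm_in L -> e \in L -> N e = L.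
  move=> eB pL eL; rewrite /N; case: pickP => [L' /andP[pL' eL'] /=|/(_ L)]; last by rewrite pL eL.
  apply/eqP; apply: contraNT no => LL'; apply/existsP; exists e; apply/existsP; exists L'.
  by apply/existsP; exists L; rewrite eB pL pL' inE eL eL' LL'.
pose w e : R := y e - (if e \in B then \sum_(f in N e) y f else 0).
have w0 L : pm_in L -> \sum_(e in L) w e = 0.
  move=> pL; have [e eB Le] := pm_root_edge pL.
  have /andP[eL er] : (e \in L) && (e \in boundary src dst [set r]) by rewrite -in_setI Le set11.
  rewrite sumrB [X in _ - X](bigD1 e) //= eB (NL e L) // [X in _ - (_ + X)]big1 ?addr0 ?subrr // => f /andP[fL fe].
  case: ifP => //; rewrite inE => /andP[_ fr]; have : f \in [set e] by rewrite -Le inE fL.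
  by rewrite inE (negPf fe).
have wy : dot w y = 1.
  rewrite -yy; apply: eq_bigr => e _; rewrite /w; case: ifP; rewrite ?subr0 // inE => /andP[_ /yr ->].
  by rewrite !mulr0.
have [|L pL] := @third_supports (2 / 15%:R) y yF _ yv w.
  move=> e; have := y1 e; rewrite ler_norml => /andP[]; lra.
rewrite (w0 L pL) wy.
have [|L' pL'] := @third_supports 0 y yF _ yv (fun e => - w e).
  by move=> e; rewrite mul0r; lra.
by rewrite !sumrN (w0 L' pL') mul0r addr0 mulrN; lra.
Qed.

Definition root_entropy : R := \sum_(e in F :&: boundary src dst [set r]) ln (pm_through e)%:R.

Let D := root_entropy.

(** The matchings through one root edge share total mass 1, and there are three root edges. *)
Lemma sum_inv_through :
  \sum_(L | pm_in L) expR (- \sum_(e in L :&: boundary src dst [set r]) ln (pm_through e)%:R) = 3 :> R.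
Proof.
transitivity (\sum_(L : {set E} | pm_in L) \sum_(e in F :&: boundary src dst [set r])
   if e \in L then (pm_through e)%:R^-1 else 0 : R).
  apply: eq_bigr => L pL; have [e eB Le] := pm_root_edge pL; rewrite Le big_set1.
  rewrite expRN lnK; last by rewrite posrE ltr0n pm_through_gt0 //; move: eB; rewrite inE => /andP[].
  have eL : e \in L by have := set11 e; rewrite -Le inE => /andP[].
  rewrite (bigD1 e) //= eL big1 ?addr0 // => f /andP[]; rewrite inE => /andP[_ fB] fe.
  case: ifP => // fL; have : f \in [set e] by rewrite -Le inE fL.
  by rewrite inE (negPf fe).
rewrite exchange_big /= (eq_bigr (fun _ => 1)) ?sumr_const ?cubF // => e.
rewrite inE => /andP[eF _]; rewrite -big_mkcondr sumr_const.
rewrite (_ : #|_| = pm_through e); last by apply: eq_card => L; rewrite !inE.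
by rewrite -[_ *+ _]mulr_natr mulVf // pnatr_eq0 -lt0n pm_through_gt0.
Qed.

(** * Random directions and the entropy bound *)

Section Bound.
Variables (d : nat) (u : nat -> E -> R) (s : R).
Hypotheses (ou : orthonormal_fun d u) (s0 : 0 < s).
Hypothesis uP : forall i, (i < d)%N ->
    [/\ forall e, e \notin F -> u i e = 0, forall e, e \in boundary src dst [set r] -> u i e = 0 &
        forall v, v \in W -> \sum_(e in boundary src dst [set v]) u i e = 0].

Let signed (g : {ffun 'I_d -> bool}) e : R := \sum_i sg R (g i) * u i e.
Let good (g : {ffun 'I_d -> bool}) := [forall e, `|signed g e| <= s].

Lemma signed_off g e : (e \notin F) || (e \in boundary src dst [set r]) -> signed g e = 0.
Proof.
move=> eP; apply: big1 => i _; have [u1 u2 _] := uP (ltn_ord i).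
by case/orP: eP => [/u1|/u2] ->; rewrite mulr0.
Qed.

Lemma signed_vertex g v : v \in W -> \sum_(e in boundary src dst [set v]) signed g e = 0.
Proof.
move=> vW; rewrite exchange_big big1 // => i _; have [_ _ u3] := uP (ltn_ord i).
by rewrite -mulr_sumr u3 ?mulr0.
Qed.

Lemma signed_norm g : dot (signed g) (signed g) = d%:R.
Proof.
rewrite dot_comb // (eq_bigr (fun _ => 1)) ?sumr_const ?card_ord // => i _.
by rewrite /sg; case: (g i); ring.
Qed.

(* Union bound over the edges; s ^+ 2 = 8 ln (6 |W|) makes at least half of the signs good. *)
Lemma few_bad :
  \sum_(g : {ffun 'I_d -> bool}) (~~ good g)%:R <=
  #|F|%:R * (2 * (2 ^+ d * expR (- (s ^+ 2 / 8%:R)))) :> R.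
Proof.
(* The minimiser of the Chernoff exponent [- q s + 2 q^2], whose minimum is [- s^2 / 8]. *)
pose q := s / 4.
have q0 : 0 <= q by rewrite /q divr_ge0 // ltW.
apply: le_trans (_ : \sum_(g : {ffun 'I_d -> bool}) \sum_(e in F)
   expR (- (q * s)) * (expR (\sum_i sg R (g i) * (q * u i e)) + expR (\sum_i sg R (g i) * (- q * u i e))) <= _).
  apply: ler_sum => g _; case: (boolP (good g)) => [_|].
    by apply: sumr_ge0 => e _; rewrite mulr_ge0 ?addr_ge0 ?expR_ge0.
  rewrite negb_forall => /existsP[e]; rewrite -ltNge => large.
  have eF : e \in F.
    apply: contraTT large => eF; rewrite signed_off ?eF // normr0 -leNgt ltW //.
  rewrite (bigD1 e) //= ler_wpDr //.
    by apply: sumr_ge0 => f _; rewrite mulr_ge0 ?addr_ge0 ?expR_ge0.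
  have e1 (z : R) : \sum_i sg R (g i) * (z * u i e) = z * signed g e.
    by rewrite mulr_sumr; apply: eq_bigr => i _; ring.
  rewrite !e1 mulrDr -!expRD.
  have : 1 <= expR (- (q * s) + q * `|signed g e|).
    by rewrite -expR0 ler_expR addrC -mulrBr mulr_ge0 // subr_ge0 ltW.
  move=> /le_trans; apply; case: (ler0P (signed g e)) => _.
    by rewrite mulNr -mulrN ler_wpDl // expR_ge0.
  by rewrite ler_wpDr // expR_ge0.
rewrite exchange_big /= mulr_natl -sumr_const; apply: ler_sum => e _.
rewrite -mulr_sumr big_split /=.
have bnd (z : R) : z ^+ 2 = q ^+ 2 -> \sum_(g : {ffun 'I_d -> bool}) expR (\sum_i sg R (g i) * (z * u i e)) <=
   2 ^+ d * expR (2 * q ^+ 2).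
  move=> zq; apply: le_trans (sum_signs _) _.
  rewrite ler_pM2l ?exprn_gt0 // ler_expR ler_pM2l //.
  rewrite (eq_bigr (fun i : 'I_d => q ^+ 2 * u i e ^+ 2)) => [|i _]; last by rewrite exprMn zq.
  by rewrite -mulr_sumr ler_piMr ?sqr_ge0 // bessel_coord.
have := lerD (bnd q erefl) (bnd (- q) (sqrrN q)).
move=> h; apply: le_trans (ler_wpM2l (expR_ge0 _) h) _.
have -> : - (s ^+ 2 / 8) = - (q * s) + 2 * q ^+ 2 by rewrite /q; field.
by rewrite expRD le_eqVlt; apply/orP; left; apply/eqP; ring.
Qed.

(** A good direction scaled by [2 / (15 s)] stays above [- 2/15]. The test weight charges a matching
    [ln (pm_through e)] at its root edge [e]; the direction vanishes there, so the charge enters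
    only through its value [D / 3] at the point 1/3. *)
Lemma good_sign_pm g (tau : R) : good g -> 0 <= tau ->
  exists2 L, pm_in L & tau * (2 / (15%:R * s)) * d%:R - D / 3 <=
   tau * (\sum_(e in L) signed g e) - \sum_(e in L :&: boundary src dst [set r]) ln (pm_through e)%:R.
Proof.
move=> /forallP gg tau0.
have off e : e \notin F -> signed g e = 0 by move=> eF; rewrite signed_off ?eF.
pose w e := tau * signed g e - (if e \in boundary src dst [set r] then ln (pm_through e)%:R else 0).
have [|L pL] := @third_supports (2 / (15%:R * s)) (signed g) off _ (@signed_vertex g) w.
  move=> e; have := gg e; rewrite ler_norml => /andP[ge _].
  apply: le_trans (_ : 2 / (15%:R * s) * - s <= _).
    by rewrite le_eqVlt; apply/orP; left; apply/eqP; field; rewrite gt_eqF.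
  by rewrite ler_wpM2l // divr_ge0 // mulr_ge0 // ltW.
move=> le; exists L => //.
have -> : tau * (\sum_(e in L) signed g e) - \sum_(e in L :&: boundary src dst [set r]) ln (pm_through e)%:R
   = \sum_(e in L) w e.
  rewrite /w sumrB -mulr_sumr; congr (_ - _); rewrite -big_mkcondr.
  by apply: eq_bigl => e; rewrite in_setI.
apply: le_trans le; rewrite le_eqVlt; apply/orP; left; apply/eqP.
have -> : \sum_(e in F) w e = - D.
  rewrite /w sumrB -mulr_sumr.
  have -> : \sum_(e in F) signed g e = 0.
    have := sum_F_vertex off; rewrite big1 => [|v vW]; last exact: signed_vertex.
    move=> /esym/eqP; rewrite mulf_eq0 pnatr_eq0 /= => /eqP s00; rewrite -[RHS]s00 big_mkcond.
    by apply: eq_bigr => e _; case: ifPn => // /off ->.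
  rewrite mulr0 sub0r -big_mkcondr; congr (- _); rewrite /D /root_entropy.
  by apply: eq_bigl => e; rewrite in_setI.
have -> : dot w (signed g) = tau * d%:R.
  rewrite -(signed_norm g) /dot mulr_sumr; apply: eq_bigr => e _; rewrite /w.
  case: ifPn => er; rewrite ?subr0 ?mulrA // signed_off ?er ?orbT //; ring.
by ring.
Qed.

(** The one matching found for a good sign vector is bounded by the sum over all matchings with
    weights [c L]. For fixed [L] the sum over signs is at most [2^d exp (2 tau^2 |L|)] by
    [sum_signs] and Bessel, with [2 |L| = |W|]; the weights sum to 3. *)
Lemma entropy_exp (tau : R) : 0 <= tau ->
  \sum_(g : {ffun 'I_d -> bool}) (good g)%:R * expR (tau * (2 / (15%:R * s)) * d%:R - D / 3) <=
  3 * 2 ^+ d * expR (tau ^+ 2 * #|W|%:R).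
Proof.
move=> tau0.
pose c L := expR (- \sum_(e in L :&: boundary src dst [set r]) ln (pm_through e)%:R : R).
apply: le_trans (_ : \sum_(g : {ffun 'I_d -> bool}) \sum_(L | pm_in L)
    c L * expR (\sum_i sg R (g i) * (tau * \sum_(e in L) u i e)) <= _).
  apply: ler_sum => g _; case: (boolP (good g)) => gg; rewrite ?mul1r ?mul0r; last first.
    by apply: sumr_ge0 => L _; rewrite mulr_ge0 // expR_ge0.
  have [L pL le] := good_sign_pm gg tau0.
  rewrite (bigD1 L) //= ler_wpDr //; first by apply: sumr_ge0 => L' _; rewrite mulr_ge0 // expR_ge0.
  rewrite -expRD ler_expR; apply: le_trans le _; rewrite addrC lerD2l le_eqVlt; apply/orP; left; apply/eqP.
  rewrite exchange_big mulr_sumr; apply: eq_bigr => i _ /=.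
  by rewrite -mulr_sumr; ring.
rewrite exchange_big /= -sum_inv_through -mulrA mulr_suml; apply: ler_sum => L pL.
rewrite -mulr_sumr ler_pM2l ?expR_gt0 //; apply: le_trans (sum_signs _) _.
rewrite ler_pM2l ?exprn_gt0 // ler_expR.
rewrite (eq_bigr (fun i : 'I_d => tau ^+ 2 * (\sum_(e in L) u i e) ^+ 2)) => [|i _]; last by rewrite exprMn.
rewrite -mulr_sumr (card_pm pL) natrM [leRHS]mulrCA ler_pM2l // ler_wpM2l ?sqr_ge0 //.
have := bessel (fun e => (e \in L)%:R) ou.
have dL f : dot f (fun e => (e \in L)%:R) = \sum_(e in L) f e.
  by rewrite [RHS]big_mkcond; apply: eq_bigr => e _; case: (e \in L); rewrite ?mulr1 ?mulr0.
rewrite (eq_bigr (fun i : 'I_d => (\sum_(e in L) u i e) ^+ 2)) => [|i _]; last by rewrite dL.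
move=> /le_trans; apply; rewrite dL -sum1_card natr_sum.
by apply: ler_sum => e ->.
Qed.

End Bound.

(** The exponents give [d^2 / (225 s^2 |W|) <= D / 3 + 5]. With [d >= |W| / 4] and
    [s^2 = 8 ln (6 |W|) <= 40 sqrt |W|] the constant is [16 * 225 * 40 = 144000], the product in the
    statement. *)
Lemma fat_bound : (8 <= #|W|)%N ->
  Num.sqrt #|W|%:R <= (12 * 12 * 10 * 100) * (D / 3 + 5).
Proof.
move=> W8; have [k Wk] : exists k, #|W| = (2 * k)%N.
  exists #|W|./2; have := card_F; have := odd_double_half #|W|; lia.
set h : R := #|W|%:R.
have k4 : (4 <= k)%N by move: W8; rewrite Wk; lia.
(* The largest dimension that [edge_family] allows. *)
pose d := (k - 2)%N.
have [|u [ou uP]] := @edge_family d; first by rewrite Wk /d; lia.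
have h0 : 0 < h by rewrite ltr0n (leq_trans _ W8).
have hk : h = 2 * k%:R by rewrite /h Wk natrM.
have h8 : 8 <= h by rewrite ler_nat.
pose t := ln (6 * h).
have t0 : 0 < t by apply: ln_gt0; lra.
pose s := Num.sqrt (8 * t).
have s2 : s ^+ 2 = 8 * t by rewrite sqr_sqrtr // mulr_ge0 // ltW.
have s0 : 0 < s by rewrite sqrtr_gt0 mulr_gt0.
pose a (g : {ffun 'I_d -> bool}) := [forall e, `|\sum_i sg R (g i) * u i e| <= s].
have bad := few_bad ou s0 uP.
have Fk : #|F|%:R = 3 * k%:R :> R.
  by rewrite -natrM; congr _%:R; have := card_F; rewrite Wk; lia.
have ex : expR (- (s ^+ 2 / 8)) = (6 * h)^-1.
  rewrite s2 mulrAC divff ?mul1r ?expRN ?lnK // ?pnatr_eq0 // posrE; lra.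
have p2 : 0 < 2 ^+ d :> R by rewrite exprn_gt0.
have bad2 : \sum_(g : {ffun 'I_d -> bool}) (~~ a g)%:R <= 2 ^+ d / 2 :> R.
  apply: le_trans bad _; rewrite ex Fk hk le_eqVlt; apply/orP; left; apply/eqP.
  by field; rewrite pnatr_eq0 -lt0n (leq_trans _ k4).
have tot : \sum_(g : {ffun 'I_d -> bool}) (a g)%:R + \sum_(g : {ffun 'I_d -> bool}) (~~ a g)%:R = 2 ^+ d :> R.
  rewrite -big_split (eq_bigr (fun _ => 1)) => [|g _]; last by case: (a g); rewrite /= ?addr0 ?add0r.
  by rewrite sumr_const card_ffun card_bool card_ord natrX.
(* The maximiser of [2 tau d / (15 s) - tau^2 h]. *)
pose tau := d%:R / (15%:R * s * h) : R.
have tau0 : 0 <= tau by rewrite divr_ge0 // !mulr_ge0 // ltW.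
have := entropy_exp ou s0 uP tau0; rewrite -/(a _) -mulr_suml.
set A := tau * _ * _ - _ => le1.
(* At least half of the [2^d] sign vectors are good, which leaves a factor [2 * 3 = 6 <= exp 5]. *)
have le2 : expR A <= expR (5 + tau ^+ 2 * h).
  rewrite [leRHS]expRD; have := expR_ge1Dx (5 : R); have := expR_gt0 A; have := expR_gt0 (tau ^+ 2 * h).
  move: le1; rewrite -/h; set X := expR A; set Y := expR (_ * _); set Z := expR 5.
  set G := \sum_(g : _) _ => le1 Y0 X0 Z6.
  have G2 : 2 ^+ d / 2 <= G by move: tot bad2; rewrite -/G; lra.
  have : 2 ^+ d / 2 * X <= 2 ^+ d * (3 * Y).
    apply: le_trans (_ : G * X <= _); first by rewrite ler_wpM2r // ltW.
    by apply: le_trans le1 _; rewrite mulrA [2 ^+ d * 3]mulrC.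
  rewrite -mulrA ler_pM2l // => XY.
  apply: le_trans (_ : 6 * Y <= _); first by lra.
  apply: ler_wpM2r; [exact: ltW | apply: le_trans Z6; lra].
move: le2; rewrite ler_expR => le2.
have le3 : d%:R ^+ 2 / (225%:R * s ^+ 2 * h) <= D / 3 + 5.
  move: le2; rewrite /A; set x := D / 3.
  have -> : tau * (2 / (15%:R * s)) * d%:R = 2 * (d%:R ^+ 2 / (225%:R * s ^+ 2 * h)).
    by rewrite /tau; field; rewrite !gt_eqF.
  have -> : tau ^+ 2 * h = d%:R ^+ 2 / (225%:R * s ^+ 2 * h).
    by rewrite /tau; field; rewrite !gt_eqF.
  by lra.
pose q := Num.sqrt h.
have q2 : q ^+ 2 = h by rewrite sqr_sqrtr // ltW.
have q0 : 0 < q by rewrite sqrtr_gt0.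
(* [6 h <= (5/2 q)^2], and [ln p] is at most [p] at [p = 5/2 q]. *)
have tq : t <= 5 * q.
  have p : 0 < 5 / 2 * q by rewrite mulr_gt0 // divr_gt0.
  apply: le_trans (_ : ln ((5 / 2 * q) ^+ 2) <= _).
    rewrite ler_ln ?posrE ?exprn_gt0 //; last by lra.
    by rewrite exprMn q2; lra.
  have lp := ln_sublinear p; rewrite lnXn // -[_ *+ 2]mulr_natr; lra.
have dh : h / 4 <= d%:R.
  rewrite hk /d natrB ?(leq_trans _ k4) //; have : 4 <= k%:R :> R by rewrite ler_nat.
  lra.
have K0 : 0 < 12 * 12 * 10 * 100 :> R by rewrite !mulr_gt0.
rewrite -/q [leRHS]mulrC -ler_pdivrMr //; apply: le_trans le3.
rewrite s2 ler_pdivlMr; last by rewrite !mulr_gt0.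
apply: le_trans (_ : q / (12 * 12 * 10 * 100) * (225%:R * (8 * (5 * q)) * h) <= _).
  apply: ler_wpM2l; first by rewrite divr_ge0 ?(ltW q0) ?(ltW K0).
  by apply: ler_wpM2r; [exact: ltW | rewrite !ler_pM2l].
have -> : q / (12 * 12 * 10 * 100) * (225%:R * (8 * (5 * q)) * h) = (h / 4) ^+ 2 by rewrite -q2; field.
by rewrite ler_pXn2r // nnegrE ?ler0n // divr_ge0 // ltW.
Qed.

End FatPolytope.

(** * Gluing matchings along a partition *)

Local Open Scope nat_scope.

Section Boundary.
Variables (V E : finType) (src dst : E -> V).
Local Notation bd := (boundary src dst).
Implicit Types (A B X Y : {set V}) (L M S : {set E}).

Lemma boundaryC X : bd (~: X) = bd X.
Proof. by apply/setP => e; rewrite !inE; case: (_ \in X); case: (_ \in X). Qed.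

Lemma boundary0 : bd set0 = set0.
Proof. by apply/setP => e; rewrite !inE. Qed.

Lemma boundary_setU A B : [disjoint A & B] ->
  bd (A :|: B) = (bd A :|: bd B) :\: (bd A :&: bd B).
Proof.
move=> dAB; apply/setP => e; rewrite !inE.
have nAB z : (z \in A) && (z \in B) = false.
  by apply/negP => /andP[zA zB]; have := disjointFr dAB zA; rewrite zB.
move: (nAB (src e)) (nAB (dst e)).
by do 2![case: (src e \in _)]; do 2![case: (dst e \in _)].
Qed.

Lemma card_boundary_setU A B : [disjoint A & B] ->
  #|bd (A :|: B)| + 2 * #|bd A :&: bd B| = #|bd A| + #|bd B|.
Proof.
move=> dAB; rewrite boundary_setU // cardsD (setIidPr _); last first.
  by apply: subset_trans (subsetIl _ _) (subsetUl _ _).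
have := cardsUI (bd A) (bd B).
have := subset_leq_card (subset_trans (subsetIl (bd A) (bd B)) (subsetUl _ (bd B))).
lia.
Qed.

Lemma boundary_setU_sub A B : bd (A :|: B) \subset bd A :|: bd B.
Proof.
apply/subsetP => e; rewrite !inE.
by do 2![case: (src e \in _)]; do 2![case: (dst e \in _)].
Qed.

Definition touch X : {set E} := [set e | (src e \in X) || (dst e \in X)].

Lemma boundary_touch X : bd X \subset touch X.
Proof. by apply/subsetP => e; rewrite !inE; case: (_ \in X); case: (_ \in X). Qed.

Definition states X S : {set {set E}} :=
  [set M : {set E} | [&& M \subset touch X, M :&: bd X == S & matches src dst X M]].

Definition nstates X S := #|states X S|.

Section Glue.
Variables (X : {set V}) (P : {set {set V}}).
Hypotheses (tP : trivIset P) (cP : cover P = X).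

(** The edges that survive when each part is contracted to a point. *)
Definition seams : {set E} := \bigcup_(Y in P) bd Y.

Lemma boundary_seams : bd X \subset seams.
Proof.
apply/subsetP => e; rewrite inE -cP => ce; apply/bigcupP.
have aux z : z \in cover P -> exists2 Y, Y \in P & z \in Y by move/bigcupP.
case sX: (src e \in cover P); case dX: (dst e \in cover P); move: ce; rewrite sX dX // => _.
  have [Y YP sY] := aux _ sX; exists Y => //; rewrite inE sY.
  by apply: contraFneq dX => dY; apply/bigcupP; exists Y; rewrite -?dY.
have [Y YP dY] := aux _ dX; exists Y => //; rewrite inE dY.
by apply: contraFneq sX => sY; apply/bigcupP; exists Y; rewrite ?sY.
Qed.

Lemma touch_two Y Z e : Y \in P -> Z \in P -> Y != Z -> e \in touch Y -> e \in touch Z ->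
  (e \in bd Y) && (e \in bd Z).
Proof.
move=> YP ZP YZ; have dYZ := (trivIsetP tP) _ _ YP ZP YZ.
have nYZ z : (z \in Y) && (z \in Z) = false.
  by apply/negP => /andP[zA zB]; have := disjointFr dYZ zA; rewrite zB.
rewrite !inE; move: (nYZ (src e)) (nYZ (dst e)).
by do 2![case: (src e \in _)]; do 2![case: (dst e \in _)].
Qed.

Section OneSeam.
Variables (L S : {set E}).
Hypotheses (LQ : L \subset seams) (LS : L :&: bd X = S).

Let fam := pfamily set0 (mem P) (fun Y => states Y (L :&: bd Y)).
Let glue (f : {ffun {set V} -> {set E}}) := \bigcup_(Y in P) f Y.

Lemma famP f Y : f \in fam -> Y \in P ->
  [/\ f Y \subset touch Y, f Y :&: bd Y = L :&: bd Y & matches src dst Y (f Y)].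
Proof.
move=> /pfamilyP[_ ff] YP; have := ff Y YP.
by rewrite inE => /and3P[? /eqP ? ?].
Qed.

Lemma glue_touch f Y : f \in fam -> Y \in P -> glue f :&: touch Y = f Y.
Proof.
move=> ff YP; have [fs fb _] := famP ff YP; apply/setP => e; rewrite in_setI; apply/andP/idP.
  case=> /bigcupP[Z ZP eZ] eY; have [->//|YZ] := eqVneq Y Z.
  have [gs gb _] := famP ff ZP.
  have /andP[bY bZ] := touch_two YP ZP YZ eY (subsetP gs _ eZ).
  have : e \in L :&: bd Z by rewrite -gb inE eZ.
  rewrite inE => /andP[eL _]; have : e \in f Y :&: bd Y by rewrite fb inE eL.
  by rewrite inE => /andP[].
move=> eY; split; last exact: (subsetP fs).
by apply/bigcupP; exists Y.
Qed.

Lemma glue_states f : f \in fam -> (glue f \in states X S) && (glue f :&: seams == L).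
Proof.
move=> ff.
have gbd Y : Y \in P -> glue f :&: bd Y = L :&: bd Y.
  move=> YP; have [_ <- _] := famP ff YP; rewrite -(glue_touch ff YP) -setIA.
  by rewrite (setIidPr (boundary_touch Y)).
have gL : glue f :&: seams = L.
  rewrite -[RHS](setIidPl LQ); apply/setP => e; rewrite !in_setI.
  apply/andP/andP => -[eg es]; split => //; have /bigcupP[Y YP eY] := es;
    have : e \in L :&: bd Y = (e \in glue f :&: bd Y) by rewrite gbd.
    by rewrite !in_setI eY eg !andbT => ->.
  by rewrite !in_setI eY eg !andbT => <-.
rewrite gL eqxx andbT inE; apply/and3P; split.
- apply/bigcupsP => Y YP; have [fs _ _] := famP ff YP; apply: (subset_trans fs).
  have YX : Y \subset X by rewrite -cP; apply: bigcup_sup YP.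
  by apply/subsetP => e; rewrite !inE => /orP[] /(subsetP YX) ->; rewrite ?orbT.
- by rewrite -(setIidPr boundary_seams) setIA gL LS.
- apply/matchesP => v; rewrite -cP => /bigcupP[Y YP vY].
  have [_ _ /matchesP /(_ v vY) <-] := famP ff YP; congr #|pred_of_set _|.
  rewrite -(glue_touch ff YP) -setIA; congr (_ :&: _); apply/esym/setIidPr.
  apply/subsetP => e; rewrite !inE.
  by case: (eqVneq (src e) v) => [->|_]; rewrite ?vY //= => /eqP; case: eqVneq => // -> _; rewrite vY orbT.
Qed.

(** Local states that agree with [L] on the boundaries glue injectively: an edge touching two parts
    is a seam, where [L] decides, so intersecting the union with [touch Y] recovers the state chosen
    in [Y]. *)
Lemma prod_states_le :
  \prod_(Y in P) nstates Y (L :&: bd Y) <= #|[set M in states X S | M :&: seams == L]|.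
Proof.
have -> : \prod_(Y in P) nstates Y (L :&: bd Y) = #|fam|.
  rewrite -sum1_card (eq_bigr (fun Y => \sum_(M in states Y (L :&: bd Y)) 1)) => [|Y _]; last first.
    by rewrite sum1_card.
  rewrite (big_distr_big_dep set0) /=; apply: eq_bigr => f _.
  by rewrite big1.
have inj : {in fam &, injective glue}.
  move=> f g ff gg efg; apply/ffunP => Y; have [YP|YP] := boolP (Y \in P).
    by rewrite -(glue_touch ff YP) -(glue_touch gg YP) efg.
  have out h : h \in fam -> h Y = set0.
    move=> /pfamilyP[/supportP hh _]; exact: hh.
  by rewrite !out.
rewrite -(card_in_imset inj); apply: subset_leq_card; apply/subsetP => _ /imsetP[f ff ->].
by rewrite inE glue_states.
Qed.

End OneSeam.

(** Different traces on the seams give disjoint sets of states, so their numbers add. *)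
Lemma nstates_glue S (LL : {set {set E}}) :
  (forall L, L \in LL -> L \subset seams /\ L :&: bd X = S) ->
  \sum_(L in LL) \prod_(Y in P) nstates Y (L :&: bd Y) <= nstates X S.
Proof.
move=> LLP; apply: leq_trans (_ : \sum_(L in LL) #|[set M in states X S | M :&: seams == L]| <= _).
  by apply: leq_sum => L /LLP[LQ LS]; apply: prod_states_le.
rewrite /nstates -sum1_card.
rewrite (eq_bigr (fun L => \sum_(M in states X S) (M :&: seams == L))) => [|L _]; last first.
  by rewrite -sum1_card big_mkcond [RHS]big_mkcond; apply: eq_bigr => M _; rewrite in_set; case: (M \in states X S) => //=; case: (_ == _).
rewrite exchange_big; apply: leq_sum => M _ /=.
rewrite big_mkcond (bigD1 (M :&: seams)) //= eqxx big1 => [|L]; first by case: ifP.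
by rewrite eq_sym => /negPf ->; case: (L \in LL).
Qed.

End Glue.
End Boundary.

(** * Laminar families of small edge cuts *)

Section Sides.
Variables (V E : finType) (src dst : E -> V) (root : V).
Local Notation bd := (boundary src dst).
Hypothesis vertex3 : forall v, #|bd [set v]| = 3.
Hypothesis no_bridge : forall X, #|bd X| != 1.
Implicit Types (X Y Z : {set V}) (SS UU : {set {set V}}).

(** Removing a vertex changes the size of the boundary by 3 up to an even number. *)
Lemma odd_boundary X : odd #|bd X| = odd #|X|.
Proof.
have [n] := ubnP #|X|; elim: n X => // n IH X Xn.
have [->|[v vX]] := set_0Vmem X; first by rewrite boundary0 !cards0.
have dv : [disjoint [set v] & X :\ v] by rewrite disjoints1 setD11.
have := card_boundary_setU src dst dv; rewrite setD1K // vertex3 => bdX.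
have := IH (X :\ v); rewrite (cardsD1 v X) vX in Xn *; move=> /(_ Xn).
rewrite oddD => <-; have := congr1 odd bdX.
by rewrite oddD mul2n odd_double addbF oddD => ->.
Qed.

Definition laminar SS :=
  [forall X in SS, forall Y in SS, [|| X \subset Y, Y \subset X | [disjoint X & Y]]].

(** Excluding [root] picks one of the two sides of every small cut. *)
Definition side_family SS :=
  laminar SS && [forall X in SS, [&& X != set0, root \notin X & #|bd X| <= 3]].

Variable SS : {set {set V}}.
Hypothesis maxSS : maxset side_family SS.

Lemma side_laminar X Y : X \in SS -> Y \in SS -> [|| X \subset Y, Y \subset X | [disjoint X & Y]].
Proof.
move=> XS YS; have /andP[/forall_inP /(_ X XS) /forall_inP /(_ Y YS) // _] := maxsetp maxSS.
Qed.

Lemma sideP X : X \in SS -> [&& X != set0, root \notin X & #|bd X| <= 3].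
Proof. by move=> XS; have /andP[_ /forall_inP /(_ X XS)] := maxsetp maxSS. Qed.

Lemma add_side Z : Z != set0 -> root \notin Z -> #|bd Z| <= 3 ->
  (forall X, X \in SS -> [|| X \subset Z, Z \subset X | [disjoint X & Z]]) -> Z \in SS.
Proof.
move=> Z0 rZ Z3 cZ; have -> : SS = Z |: SS; last exact: setU11.
apply/esym; apply: (maxsetsup maxSS) (subsetU1 _ _); apply/andP; split.
  apply/forall_inP => X /setU1P[->|XS]; apply/forall_inP => Y /setU1P[->|YS].
  - by rewrite subxx.
  - by have := cZ Y YS; rewrite disjoint_sym; case/or3P => ->; rewrite ?orbT.
  - exact: cZ.
  - exact: side_laminar.
by apply/forall_inP => X /setU1P[->|/sideP //]; rewrite Z0 rZ.
Qed.

Lemma singleton_side v : v != root -> [set v] \in SS.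
Proof.
move=> vr; apply: add_side; rewrite ?inE ?vertex3 ?[root == _]eq_sym //.
  by apply/set0Pn; exists v; rewrite set11.
move=> X _; rewrite sub1set disjoint_sym disjoints1.
by case: (v \in X); rewrite /= ?orbT.
Qed.

Lemma top_side : ~: [set root] != set0 -> ~: [set root] \in SS.
Proof.
move=> T0; apply: add_side; rewrite ?boundaryC ?vertex3 ?inE ?eqxx // => X XS.
have /and3P[_ rX _] := sideP XS; apply/orP; left.
by apply/subsetP => v vX; rewrite !inE; apply: contraNneq rX => <-.
Qed.

Definition children X : {set {set V}} :=
  [set Y in SS | (Y \proper X) && [forall Z in SS, ~~ ((Y \proper Z) && (Z \proper X))]].

Lemma childP X Y : Y \in children X -> [/\ Y \in SS, Y \proper X &
  forall Z, Z \in SS -> Y \proper Z -> Z \proper X -> False].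
Proof.
rewrite inE => /and3P[YS YX /forall_inP m]; split=> // Z ZS YZ ZX.
by have := m Z ZS; rewrite YZ ZX.
Qed.

Lemma sub_child X Y : Y \in SS -> Y \proper X -> exists2 Z, Z \in children X & Y \subset Z.
Proof.
have [n] := ubnP (#|X| - #|Y|); elim: n Y => // n IH Y Yn YS YX.
have [Yc|] := boolP (Y \in children X); first by exists Y.
rewrite inE YS YX /= negb_forall => /existsP[Z]; rewrite negb_imply negbK => /and3P[ZS YZ ZX].
have [|Z' Z'c ZZ'] := IH Z _ ZS ZX.
  by have := proper_card YZ; have := proper_card ZX; move: Yn; lia.
by exists Z' => //; apply: subset_trans ZZ'; apply: proper_sub.
Qed.

Lemma trivIset_children X : trivIset (children X).
Proof.
apply/trivIsetP => A B /childP[AS AX Am] /childP[BS BX Bm] AB.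
case/or3P: (side_laminar AS BS) => // sub; exfalso.
  by apply: (Am B BS) => //; rewrite properEneq AB.
by apply: (Bm A AS) => //; rewrite properEneq eq_sym AB.
Qed.

Lemma cover_children X : X \in SS -> 1 < #|X| -> cover (children X) = X.
Proof.
move=> XS X1; apply/eqP; rewrite eqEsubset; apply/andP; split.
  by apply/bigcupsP => Y /childP[_ /proper_sub].
apply/subsetP => v vX; have /and3P[_ rX _] := sideP XS.
have vr : v != root by apply: contraNneq rX => <-.
have vp : [set v] \proper X.
  by rewrite properEcard sub1set vX cards1.
have [Z Zc vZ] := sub_child (singleton_side vr) vp.
by apply/bigcupP; exists Z => //; rewrite -sub1set.
Qed.

(** A union of children crosses no member of the family: a member inside [X] is [X] or lies in a
    child, any other contains [X] or misses it. If its cut were small, maximality would put the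
    union into the family, hence inside one child, which is impossible for two disjoint nonempty
    children. *)
Lemma boundary_union_children X UU : X \in SS -> UU \subset children X ->
  1 < #|UU| < #|children X| -> 3 < #|bd (cover UU)|.
Proof.
move=> XS UC /andP[U1 U2]; rewrite ltnNge; apply/negP => le3.
set Z := cover UU in le3.
have UZ A : A \in UU -> A \subset Z by move=> AU; rewrite /Z /cover; apply: bigcup_sup.
have neq0 A : A \in children X -> A != set0 by move=> /childP[/sideP/and3P[]].
have disjZ A : A \in children X -> A \notin UU -> [disjoint A & Z].
  move=> AC AU; apply: bigcup_disjoint => B BU.
  apply: (trivIsetP (trivIset_children X)) => //; first exact: (subsetP UC).
  by apply: contraNneq AU => ->.
have [A AU] : exists A, A \in UU by apply/set0Pn; rewrite -card_gt0 ltnW.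
have AC := subsetP UC _ AU.
have ZX : Z \proper X.
  rewrite properE; apply/andP; split.
    by apply/bigcupsP => B /(subsetP UC)/childP[_ /proper_sub].
  have /subsetPn[B BC BU] : ~~ (children X \subset UU).
    by apply: contraL U2 => /subset_leq_card; rewrite -leqNgt.
  have /set0Pn[v vB] := neq0 _ BC.
  apply/subsetPn; exists v; last by rewrite (disjointFr (disjZ B BC BU)).
  by have /childP[_ /proper_sub/subsetP/(_ _ vB)] := BC.
have ZS : Z \in SS.
  apply: add_side => //.
  - by have /set0Pn[v vA] := neq0 _ AC; apply/set0Pn; exists v; apply: (subsetP (UZ A AU)).
  - by have /and3P[_ rX _] := sideP XS; apply: contra rX; apply/subsetP/proper_sub.
  move=> T TS; case/or3P: (side_laminar TS XS) => [TX|XT|dTX].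
  - have [TeX|TnX] := eqVneq T X; first by rewrite TeX (proper_sub ZX) orbT.
    have TpX : T \proper X by rewrite properEneq TnX.
    have [B BC TB] := sub_child TS TpX.
    have [BU|BU] := boolP (B \in UU); first by rewrite (subset_trans TB (UZ B BU)).
    by rewrite (disjointWl TB (disjZ B BC BU)) !orbT.
  - by rewrite (subset_trans (proper_sub ZX) XT) orbT.
  - by rewrite (disjointWr (proper_sub ZX) dTX) !orbT.
have [B BC ZB] := sub_child ZS ZX.
have UB C : C \in UU -> C = B.
  move=> CU; have CC := subsetP UC _ CU; apply/eqP; apply: contraT => CB.
  have := (trivIsetP (trivIset_children X)) _ _ CC BC CB.
  have /set0Pn[v vC] := neq0 _ CC => /disjointFr /(_ vC).
  by rewrite (subsetP ZB) // (subsetP (UZ C CU)).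
have : UU \subset [set B] by apply/subsetP => C /UB ->; rewrite set11.
by move/subset_leq_card; rewrite cards1 leqNgt U1.
Qed.

End Sides.

Lemma cover_setD1 (T : finType) (P : {set {set T}}) Y : Y \in P ->
  cover P = Y :|: cover (P :\ Y).
Proof. by move=> YP; rewrite /cover (big_setD1 Y). Qed.

Lemma disjoint_cover_setD1 (T : finType) (P : {set {set T}}) Y : trivIset P -> Y \in P ->
  [disjoint Y & cover (P :\ Y)].
Proof.
move=> tP YP; apply: bigcup_disjoint => B; rewrite !inE => /andP[BY BP].
by apply: (trivIsetP tP) => //; rewrite eq_sym.
Qed.

(** The contracted multigraph keeps the edge type; its vertices are the parts, and [pblock] maps an
    end to its part. *)
Lemma boundary_pblock (V E : finType) (src dst : E -> V) (P UU : {set {set V}}) :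
  trivIset P -> cover P = setT -> UU \subset P ->
  boundary (pblock P \o src) (pblock P \o dst) UU = boundary src dst (cover UU).
Proof.
move=> tP cP UP; have aux v : (pblock P v \in UU) = (v \in cover UU).
  apply/idP/bigcupP => [pU|[B BU vB]]; last by rewrite (def_pblock tP (subsetP UP _ BU) vB).
  by exists (pblock P v) => //; rewrite mem_pblock cP inE.
by apply/setP => e; rewrite !inE /= !aux.
Qed.

Section Structure.
Variables (V E : finType) (src dst : E -> V) (root : V).
Local Notation bd := (boundary src dst).
Hypothesis vertex3 : forall v, #|bd [set v]| = 3.
Hypothesis no_bridge : forall X, #|bd X| != 1.
Variable SS : {set {set V}}.
Hypothesis maxSS : maxset (side_family src dst root) SS.
Local Notation Ch := (children SS).

Lemma odd_side X : X \in SS -> odd #|X| -> #|bd X| = 3.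
Proof.
move=> /(sideP maxSS)/and3P[_ _]; rewrite -(odd_boundary vertex3) => le3 oX.
by move: le3 oX (no_bridge X); case: #|bd X| => [|[|[|[|]]]].
Qed.

Lemma even_side X : X \in SS -> ~~ odd #|X| -> #|bd X| <= 2.
Proof.
move=> /(sideP maxSS)/and3P[_ _]; rewrite -(odd_boundary vertex3).
by case: #|bd X| => [|[|[|[|]]]].
Qed.

Lemma card_children X : X \in SS -> 1 < #|X| -> 1 < #|Ch X|.
Proof.
move=> XS X1; have cX := cover_children vertex3 maxSS XS X1.
rewrite ltnNge; apply/negP; rewrite leq_eqVlt ltnS leqn0 cards_eq0.
case/orP => [/cards1P[Y Ye]|/eqP Ye]; move: cX; rewrite Ye /cover.
  rewrite big_set1 => YX; have /childP[_] : Y \in Ch X by rewrite Ye set11.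
  by rewrite YX properxx.
by rewrite big_set0 => X0; move: X1; rewrite -X0 cards0.
Qed.

Lemma child_pair_boundary X A B : X \in SS -> 2 < #|Ch X| -> A \in Ch X -> B \in Ch X -> A != B ->
  3 < #|bd (A :|: B)|.
Proof.
move=> XS C2 AC BC AB; have -> : A :|: B = cover [set A; B].
  by rewrite /cover big_setU1 ?inE // big_set1.
apply: (boundary_union_children maxSS XS); last by rewrite cards2 AB.
by rewrite subUset !sub1set AC.
Qed.

Lemma child_compl_boundary X A : X \in SS -> 2 < #|Ch X| -> A \in Ch X ->
  3 < #|bd (cover (Ch X :\ A))|.
Proof.
move=> XS C2 AC; apply: (boundary_union_children maxSS XS); first exact: subD1set.
by move: C2; rewrite (cardsD1 A) AC; lia.
Qed.

Lemma child_disjoint X A B : A \in Ch X -> B \in Ch X -> A != B -> [disjoint A & B].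
Proof. exact: (trivIsetP (trivIset_children maxSS X)). Qed.

(** An even child [Y] has at most two boundary edges but is joined to some child [B], so [Y :|: B]
    would have at most [2 + 3 - 2] of them. If [X] were even, a child [p] owning an edge of [bd X]
    would send at most two edges to its siblings, and their union would have at most [2 + 4 - 3]
    boundary edges; an empty [bd X] gives [0 + 6 - 3]. *)
Lemma many_children_odd X : X \in SS -> 1 < #|X| -> 2 < #|Ch X| ->
  odd #|X| /\ forall Y, Y \in Ch X -> odd #|Y|.
Proof.
move=> XS X1 C2; have cX := cover_children vertex3 maxSS XS X1.
have tC := trivIset_children maxSS X.
have step A : A \in Ch X -> #|bd X| + 2 * #|bd A :&: bd (cover (Ch X :\ A))| = #|bd A| + #|bd (cover (Ch X :\ A))|.
  move=> AC; rewrite -card_boundary_setU ?disjoint_cover_setD1 //.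
  by rewrite -cover_setD1 // cX.
have X3 : #|bd X| <= 3 by have /and3P[] := sideP maxSS XS.
have oC Y : Y \in Ch X -> odd #|Y|.
  move=> YC; apply: contraT => eY; have /childP[YS _ _] := YC.
  have Y2 := even_side YS eY; have Z4 := child_compl_boundary XS C2 YC; have := step Y YC => st.
  have /card_gt0P[e] : 0 < #|bd Y :&: bd (cover (Ch X :\ Y))| by lia.
  rewrite inE => /andP[eYb eZ].
  have : e \in seams src dst (Ch X :\ Y) by apply: (subsetP (boundary_seams _ _ erefl)) eZ.
  case/bigcupP => B; rewrite in_setD1 => /andP[BY BC] eB.
  have /childP[BS _ _] := BC; have /and3P[_ _ B3] := sideP maxSS BS.
  have YB : Y != B by rewrite eq_sym.
  have := child_pair_boundary XS C2 YC BC YB.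
  have := card_boundary_setU src dst (child_disjoint YC BC YB).
  have : 0 < #|bd Y :&: bd B| by apply/card_gt0P; exists e; rewrite inE eYb.
  lia.
split=> //; apply: contraT => eX; have X2 := even_side XS eX.
have [p pC pX] : exists2 p, p \in Ch X & (#|bd X| = 0) \/ exists2 e, e \in bd X & e \in bd p.
  have [Xe|[e eX']] := set_0Vmem (bd X).
    have /card_gt0P[p pC] : 0 < #|Ch X| by lia.
    by exists p => //; left; rewrite Xe cards0.
  have /bigcupP[p pC ep] := subsetP (boundary_seams src dst cX) _ eX'.
  by exists p => //; right; exists e.
have /childP[pS _ _] := pC; have p3 := odd_side pS (oC p pC).
have Z4 := child_compl_boundary XS C2 pC; have st := step p pC.
have k3 : #|bd p :&: bd (cover (Ch X :\ p))| <= 3 by rewrite -p3 subset_leq_card ?subsetIl.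
case: pX => [X0|[e eX' ep]]; first lia.
have : #|bd p :&: bd (cover (Ch X :\ p))| < 3; last by lia.
rewrite -p3; apply: proper_card; rewrite properE subsetIl /=.
apply/subsetPn; exists e => //; rewrite inE ep /=.
move: eX'; rewrite -[in bd X]cX (cover_setD1 pC) boundary_setU ?disjoint_cover_setD1 //.
by rewrite inE inE ep /= => /andP[].
Qed.

End Structure.

(** * The potential of a node *)

Local Open Scope ring_scope.

Section Potential.
Variables (R : realType) (V E : finType) (src dst : E -> V) (root : V).
Local Notation bd := (boundary src dst).
Local Notation N := (nstates src dst).
Hypothesis vertex3 : forall v, #|bd [set v]| = 3.
Hypothesis no_bridge : forall X, (#|bd X| != 1)%N.
Variable SS : {set {set V}}.
Hypothesis maxSS : maxset (side_family src dst root) SS.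
Local Notation Ch := (children SS).

Definition potential (X : {set V}) : R :=
  if odd #|X| then \sum_(e in bd X) ln (N X [set e])%:R
  else 2 * ln (N X set0)%:R + ln (N X (bd X))%:R.

(** Since [ln 0] is 0 here, logarithms of counts can be compared only once the counts are known to
    be positive. *)
Definition positive (X : {set V}) : bool :=
  if odd #|X| then [forall e in bd X, 0 < N X [set e]]%N
  else (0 < N X set0)%N && (0 < N X (bd X))%N.

Lemma ln_nat_ge0 n : 0 <= ln n%:R :> R.
Proof.
by case: n => [|n]; [rewrite ln0 | rewrite ln_ge0 // ler1n].
Qed.

Lemma potential_ge0 X : 0 <= potential X.
Proof.
rewrite /potential; case: ifP => _; first by apply: sumr_ge0 => e _; exact: ln_nat_ge0.
by rewrite addr_ge0 ?mulr_ge0 ?ln_nat_ge0.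
Qed.

Lemma ln_natM m n : (0 < m)%N -> (0 < n)%N -> ln (m * n)%:R = ln m%:R + ln n%:R :> R.
Proof. by move=> m0 n0; rewrite natrM lnM // posrE ltr0n. Qed.

Lemma ler_ln_nat m n : (0 < m)%N -> (m <= n)%N -> ln m%:R <= ln n%:R :> R.
Proof. by move=> m0 mn; rewrite ler_ln ?posrE ?ltr0n ?(leq_trans m0) // ler_nat. Qed.

Lemma ln_prod_nat (I : finType) (P : pred I) (F : I -> nat) : (forall i, P i -> (0 < F i)%N) ->
  ln (\prod_(i | P i) F i)%N%:R = \sum_(i | P i) ln (F i)%:R :> R.
Proof.
move=> F0; pose K (m : nat) (x : R) := (0 < m)%N /\ ln m%:R = x.
suff [] : K (\prod_(i | P i) F i)%N (\sum_(i | P i) ln (F i)%:R) by [].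
apply: big_ind2; first by split; rewrite ?ln1.
- by move=> m1 x1 m2 x2 [m10 <-] [m20 <-]; split; rewrite ?muln_gt0 ?m10 ?ln_natM.
- by move=> i Pi; split; rewrite ?F0.
Qed.

Lemma odd_sum_odd (I : finType) (A : {set I}) (F : I -> nat) : (forall i, i \in A -> odd (F i)) ->
  odd (\sum_(i in A) F i)%N = odd #|A|.
Proof.
move=> oF; rewrite -sum1_card.
apply: (big_ind2 (fun a b => odd a = odd b)) => [//|a b c d ab cd|i iA]; last exact: oF.
by rewrite !oddD ab cd.
Qed.

(** * The contracted graph of a node with at least three children *)

Section Node.
Variable X : {set V}.
Hypotheses (XS : X \in SS) (X1 : (1 < #|X|)%N) (C2 : (2 < #|Ch X|)%N).
Hypothesis posC : forall Y, Y \in Ch X -> positive Y.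

Let oX : odd #|X|. Proof. by have [] := many_children_odd vertex3 no_bridge maxSS XS X1 C2. Qed.
Let oC Y : Y \in Ch X -> odd #|Y|.
Proof. by have [_] := many_children_odd vertex3 no_bridge maxSS XS X1 C2; apply. Qed.
Let tC : trivIset (Ch X). Proof. exact: trivIset_children maxSS X. Qed.
Let cC : cover (Ch X) = X. Proof. exact: (cover_children vertex3 maxSS XS X1). Qed.

Let C3 Y : Y \in Ch X -> #|bd Y| = 3.
Proof. by move=> YC; have /childP[YS _ _] := YC; apply: (odd_side vertex3 no_bridge maxSS YS (oC YC)). Qed.

Let P := ~: X |: Ch X.
Let F := seams src dst (Ch X).
Let s' := pblock P \o src.
Let d' := pblock P \o dst.

Lemma compl_notin_children : ~: X \notin Ch X.
Proof.
apply/negP => /childP[_ /proper_sub/subsetP sub _].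
have : root \in ~: X by rewrite inE; have /and3P[] := sideP maxSS XS.
by move=> r; have := sub _ r; move: r; rewrite inE => /negPf ->.
Qed.

Lemma trivIset_node : trivIset P.
Proof.
apply/trivIsetP => A B /setU1P[->|AC] /setU1P[->|BC] AB; rewrite ?eqxx // in AB *.
- by rewrite disjoint_sym -subsets_disjoint; have /childP[_ /proper_sub] := BC.
- by rewrite -subsets_disjoint; have /childP[_ /proper_sub] := AC.
- exact: (trivIsetP tC).
Qed.

Lemma cover_node : cover P = setT.
Proof. by rewrite /cover /P big_setU1 ?compl_notin_children //= -/(cover _) cC setUC setUCr. Qed.

Lemma boundary_node (UU : {set {set V}}) : UU \subset P -> boundary s' d' UU = bd (cover UU).
Proof. by move=> UP; apply: boundary_pblock => //; [exact: trivIset_node | exact: cover_node]. Qed.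

Lemma boundary_node1 (Y : {set V}) : Y \in P -> boundary s' d' [set Y] = bd Y.
Proof. by move=> YP; rewrite boundary_node ?sub1set // /cover big_set1. Qed.

Lemma node_part3 (Y : {set V}) : Y \in P -> #|bd Y| = 3.
Proof. by case/setU1P => [->|/C3 //]; rewrite boundaryC (odd_side vertex3 no_bridge maxSS XS oX). Qed.

Lemma node_seams_sub Y : Y \in P -> bd Y \subset F.
Proof.
case/setU1P => [->|YC]; first by rewrite boundaryC; apply: boundary_seams.
exact: (bigcup_sup Y).
Qed.

Lemma node_cubic Y : Y \in P -> #|F :&: boundary s' d' [set Y]| = 3.
Proof. by move=> YP; rewrite boundary_node1 // (setIidPr (node_seams_sub YP)) node_part3. Qed.

Lemma node_seam_in e : e \in F -> [&& s' e \in P, d' e \in P & s' e != d' e].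
Proof.
have inP v : pblock P v \in P by rewrite pblock_mem // cover_node inE.
case/bigcupP => Y YC eY; rewrite !inP /=; apply/eqP => sd.
have : e \in boundary s' d' [set Y] by rewrite boundary_node1 // inE YC orbT.
by rewrite !inE sd eqxx.
Qed.

Lemma node_card : #|P| = #|Ch X|.+1.
Proof. by rewrite cardsU1 compl_notin_children. Qed.

Lemma odd_card_children : odd #|Ch X|.
Proof. by rewrite -(odd_sum_odd oC) (eqP tC) cC. Qed.

(** Maximality gives more than three edges, and parity excludes four. *)
Lemma node_odd_cut (UU : {set {set V}}) : UU \subset Ch X -> odd #|UU| -> (1 < #|UU| < #|Ch X|)%N ->
  (5 <= #|bd (cover UU)|)%N.
Proof.
move=> UC oU U2; have := boundary_union_children maxSS XS UC U2.
have tU : trivIset UU.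
  by apply/trivIsetP => A B AU BU; apply: (trivIsetP tC); apply: (subsetP UC).
have : odd #|bd (cover UU)|.
  rewrite (odd_boundary vertex3) -(eqP tU) odd_sum_odd // => A AU.
  exact: oC (subsetP UC _ AU).
by case: #|bd _| => [|[|[|[|[|k]]]]].
Qed.

(** Five edges of weight [1/5] satisfy the cut inequality. Of [UU] and its complement in [P], one
    avoids [~: X] and so consists of children. *)
Lemma node_fat (x : E -> R) : (forall e, e \notin F -> x e = 0) ->
  (forall e, e \in F -> 5%:R^-1 <= x e) ->
  (forall Y, Y \in P -> \sum_(e in boundary s' d' [set Y]) x e = 1) ->
  supports_pm s' d' P x.
Proof.
move=> x0 x5 xP; apply: edmonds.
have xge e : 0 <= x e.
  by have [/x5|/x0 ->//] := boolP (e \in F); apply: le_trans; rewrite invr_ge0.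
have xF e : x e != 0 -> e \in F by move=> xe; apply: contraNT xe => /x0 ->.
have five (UU : {set {set V}}) : UU \subset Ch X -> odd #|UU| -> (1 < #|UU| < #|Ch X|)%N ->
    1 <= \sum_(e in bd (cover UU)) x e.
  move=> UC oU U2; have h5 := node_odd_cut UC oU U2.
  apply: le_trans (_ : \sum_(e in bd (cover UU)) 5%:R^-1 <= _).
    rewrite sumr_const -[_ *+ _]mulr_natr mulrC ler_pdivlMr ?mul1r ?ltr0n // ler_nat.
    exact: h5.
  apply: ler_sum => e eU; apply: x5.
  have : e \in seams src dst UU by apply: (subsetP (boundary_seams _ _ erefl)) eU.
  by case/bigcupP => Y YU eY; apply/bigcupP; exists Y => //; apply: (subsetP UC).
split=> //; first by move=> e /xF; exact: node_seam_in.
move=> UU UP oU.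
have evP : ~~ odd #|P| by rewrite node_card /= odd_card_children.
have UUP : UU != P by apply: contraNneq evP => <-.
have compl : \sum_(e in boundary s' d' UU) x e = \sum_(e in boundary s' d' (P :\: UU)) x e.
  rewrite big_mkcond [RHS]big_mkcond; apply: eq_bigr => e _.
  have [/xF/node_seam_in/and3P[sP dP _]|/negbNE/eqP ->] := boolP (x e != 0); last by rewrite !if_same.
  rewrite [e \in boundary _ _ UU]inE [e \in boundary _ _ (P :\: UU)]inE !in_setD sP dP !andbT.
  by case: (_ \in UU); case: (_ \in UU).
have oPU : odd #|P :\: UU|.
  have := cardsID UU P; rewrite (setIidPr UP) => cP; move: evP; rewrite -cP oddD oU.
  by case: (odd _).
have cP : #|P| = (#|UU| + #|P :\: UU|)%N by have := cardsID UU P; rewrite (setIidPr UP).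
have single (A : {set {set V}}) : A \subset P -> #|A| = 1%N -> \sum_(e in boundary s' d' A) x e = 1.
  move=> AP /eqP/cards1P[Y AY]; rewrite AY xP // -sub1set -AY //.
have [U1|U1] := leqP #|UU| 1.
  by rewrite single //; apply/eqP; rewrite eqn_leq U1; case: #|UU| oU.
have [D1|D1] := leqP #|P :\: UU| 1.
  by rewrite compl single ?subsetDl //; apply/eqP; rewrite eqn_leq D1; case: #|_| oPU.
have [XU|XU] := boolP (~: X \in UU).
  have sub : P :\: UU \subset Ch X.
    by apply/subsetP => Y; rewrite in_setD => /andP[YU /setU1P[YX|//]]; rewrite YX XU in YU.
  rewrite compl boundary_node ?subsetDl //; apply: five => //; rewrite D1 /=.
  by rewrite -ltnS -node_card cP; move: U1; move: #|UU| #|P :\: UU| => a b; clear; lia.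
have sub : UU \subset Ch X.
  apply/subsetP => Y YU; have /setU1P[YX|//] := subsetP UP _ YU.
  by rewrite -YX YU in XU.
rewrite boundary_node //; apply: five => //; rewrite U1 /=.
by rewrite -ltnS -node_card cP; move: D1; move: #|UU| #|P :\: UU| => a b; clear; lia.
Qed.

Let pm := pm_in s' d' P F.
(** The number of lifts of a contracted matching: one state chosen independently in each child. *)
Let wt (L : {set E}) : nat := (\prod_(Y in Ch X) N Y (L :&: bd Y))%N.
Let XP : ~: X \in P. Proof. exact: setU11. Qed.
Let ChP Y : Y \in Ch X -> Y \in P. Proof. by move=> YC; rewrite inE YC orbT. Qed.

Lemma pm_edge (L : {set E}) Y : pm L -> Y \in P -> exists2 e, e \in bd Y & L :&: bd Y = [set e].
Proof.
case/andP=> _ /matchesP Lm YP; have /eqP/cards1P[e Le] := Lm Y YP.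
rewrite boundary_node1 // in Le; exists e => //.
by have := set11 e; rewrite -Le inE => /andP[].
Qed.

Lemma pm_edgeX (L : {set E}) : pm L -> exists2 e, e \in bd X & L :&: bd X = [set e].
Proof. by move=> pL; have := pm_edge pL XP; rewrite boundaryC. Qed.

Let posN Y e : Y \in Ch X -> e \in bd Y -> (0 < N Y [set e])%N.
Proof. by move=> YC eY; have := posC YC; rewrite /positive oC // => /forall_inP; apply. Qed.

Lemma wt_gt0 L : pm L -> (0 < wt L)%N.
Proof.
move=> pL; rewrite /wt; apply: prodn_cond_gt0 => Y YC.
by have [e eY ->] := pm_edge pL (ChP YC); apply: posN.
Qed.

Lemma wt_family e (LL : {set {set E}}) : (forall L, L \in LL -> pm L /\ L :&: bd X = [set e]) ->
  (\sum_(L in LL) wt L <= N X [set e])%N.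
Proof.
move=> LP; apply: (nstates_glue tC cC) => L /LP[pL Le]; split=> //.
by case/andP: pL.
Qed.

Lemma pm_through_le e : e \in bd X -> (pm_through s' d' P F e <= N X [set e])%N.
Proof.
move=> eX; have LP L : L \in [set L | pm L && (e \in L)] -> pm L /\ L :&: bd X = [set e].
  rewrite inE => /andP[pL eL]; split => //; have [f fX Lf] := pm_edgeX pL.
  have : e \in [set f] by rewrite -Lf inE eL.
  by rewrite Lf inE => /eqP ->.
apply: leq_trans (wt_family LP); rewrite /pm_through -sum1_card.
by apply: leq_sum => L /LP[pL _]; apply: wt_gt0.
Qed.

Let fatN := node_fat.

Lemma node_positive : positive X.
Proof.
rewrite /positive oX; apply/forall_inP => e eX; apply: leq_trans (pm_through_le eX).
have eF : e \in F by apply: (subsetP (node_seams_sub XP)); rewrite boundaryC.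
exact: (pm_through_gt0 node_cubic fatN eF).
Qed.

(** Its total over [F] compares the potentials of the children with that of [X], while on a matching
    it is the logarithm of [wt L / N X [set e]], a ratio at most 1. *)
Let w e : R := (\sum_(Y in Ch X) if e \in bd Y then ln (N Y [set e])%:R else 0)
   - (if e \in bd X then ln (N X [set e])%:R else 0).

Lemma node_w_total : \sum_(e in F) w e = \sum_(Y in Ch X) potential Y - potential X.
Proof.
rewrite /w sumrB; congr (_ - _); last first.
  rewrite /potential oX -big_mkcondr; apply: eq_bigl => e.
  case: (boolP (e \in bd X)) => eX; rewrite ?andbF ?andbT //.
  by apply: (subsetP (node_seams_sub XP)); rewrite boundaryC.
rewrite exchange_big; apply: eq_bigr => Y YC; rewrite /potential oC // -big_mkcondr.
apply: eq_bigl => e; case: (boolP (e \in bd Y)) => eY; rewrite ?andbF ?andbT //.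
exact: (subsetP (node_seams_sub (ChP YC))).
Qed.

Lemma node_w_pm L e : pm L -> L :&: bd X = [set e] ->
  \sum_(f in L) w f = ln (wt L)%:R - ln (N X [set e])%:R.
Proof.
move=> pL Le; have [LF _] := andP pL.
have one Y g (f : E -> R) : L :&: bd Y = [set g] -> \sum_(e in L) (if e \in bd Y then f e else 0) = f g.
  by move=> Lg; rewrite -big_mkcondr -[RHS](big_set1 +%R g f) -Lg; apply: eq_bigl => h; rewrite in_setI.
rewrite /w sumrB (one X e) //; congr (_ - _).
rewrite /wt ln_prod_nat => [|Y YC]; last first.
  by have [g gY ->] := pm_edge pL (ChP YC); apply: posN.
rewrite exchange_big; apply: eq_bigr => Y YC.
by have [g gY Lg] := pm_edge pL (ChP YC); rewrite (one Y g) // Lg.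
Qed.

Lemma node_w_le0 L : pm L -> \sum_(f in L) w f <= 0.
Proof.
move=> pL; have [e eX Le] := pm_edgeX pL; rewrite (node_w_pm pL Le) subr_le0.
apply: ler_ln_nat; first exact: wt_gt0.
have := @wt_family e [set L]; rewrite big_set1; apply=> L' /set1P -> //.
Qed.

(** At the point 1/3 the weight [w] has a third of the difference of potentials as value, and some
    matching, of weight at most 0, is at least as heavy. *)
Lemma node_potential : \sum_(Y in Ch X) potential Y <= potential X.
Proof.
have [||| L pL] := @third_supports R _ _ s' d' P F node_cubic fatN 0 (fun _ => 0) _ _ _ w => //.
- by move=> e; rewrite mulr0; lra.
- by move=> Y _; rewrite big1.
rewrite node_w_total mul0r addr0; have := node_w_le0 pL; lra.
Qed.

(* Apply Edmonds' theorem to 2/5 - (1/10) (1_L1 + 1_L2) >= 1/5, where L1 <> L2 are matchings of the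
   contracted graph through a common edge of bd X. *)
Lemma node_gain : (4 < #|Ch X|)%N ->
  \sum_(Y in Ch X) potential Y + ln 2 / 2 <= potential X.
Proof.
move=> C4; have P6 : (6 <= #|P|)%N by rewrite node_card.
have [e [L1 [L2 [eX p1 p2 e12 L12]]]] := exists_two_pm XP node_seam_in node_cubic fatN P6.
rewrite boundary_node1 // boundaryC inE in eX; case/andP: eX => eF eX.
rewrite inE in e12; case/andP: e12 => e1 e2.
have LX L : pm L -> e \in L -> L :&: bd X = [set e].
  move=> pL eL; have [f fX Lf] := pm_edgeX pL; rewrite Lf; congr [set _].
  by apply/esym/eqP; rewrite -in_set1 -Lf inE eL.
pose y f : R := if f \in F then 15%:R^-1 - 10%:R^-1 * ((f \in L1)%:R + (f \in L2)%:R) else 0.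
have yF f : f \notin F -> y f = 0 by rewrite /y => /negPf ->.
have yge f : - (2 / 15%:R) <= 1 * y f.
  by rewrite /y; case: (f \in F); case: (f \in L1); case: (f \in L2) => /=; lra.
have sumL L Y : pm L -> Y \in P -> \sum_(f in boundary s' d' [set Y]) (if f \in F then (f \in L)%:R else 0) = 1 :> R.
  move=> pL YP; have [g gY Lg] := pm_edge pL YP; rewrite boundary_node1 //.
  transitivity (\sum_(f in [set g]) (1 : R)); last by rewrite big_set1.
  rewrite -Lg big_mkcond [RHS]big_mkcond; apply: eq_bigr => f _; rewrite in_setI andbC.
  case: (boolP (f \in bd Y)) => //= fY; rewrite (subsetP (node_seams_sub YP)) //.
  by case: (f \in L).
have yv Y : Y \in P -> \sum_(f in boundary s' d' [set Y]) y f = 0.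
  move=> YP.
  transitivity (\sum_(f in boundary s' d' [set Y]) ((if f \in F then 15%:R^-1 else 0) -
     10%:R^-1 * ((if f \in F then (f \in L1)%:R else 0) + (if f \in F then (f \in L2)%:R else 0))) : R).
    by apply: eq_bigr => f _; rewrite /y; case: (f \in F) => //; rewrite addr0 mulr0 subr0.
  rewrite sumrB -mulr_sumr big_split /= (sumL L1) // (sumL L2) // -big_mkcondr.
  rewrite (_ : \sum_(f in _ | _) _ = 15%:R^-1 *+ 3); first by field.
  rewrite sumr_const; congr (_ *+ _); apply: etrans (node_cubic YP); apply: eq_card => f.
  by rewrite unfold_in in_setI andbC.
have [L pL] := @third_supports R _ _ s' d' P F node_cubic fatN 1 y yF yge yv w.
have wLle := node_w_le0 pL; move=> le.
have yw : dot w y = 15%:R^-1 * (\sum_(f in F) w f) - 10%:R^-1 * (\sum_(f in L1) w f + \sum_(f in L2) w f).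
  rewrite /dot mulrDr !mulr_sumr [\sum_(f in F) _]big_mkcond [\sum_(f in L1) _]big_mkcond [\sum_(f in L2) _]big_mkcond.
  rewrite -big_split -sumrB; apply: eq_bigr => f _ /=; rewrite /y.
  case: (boolP (f \in F)) => fF.
    by case: (f \in L1); case: (f \in L2) => /=; ring.
  have out L' : pm L' -> f \in L' = false by move=> /andP[/subsetP sub _]; apply: contraNF fF => /sub.
  by rewrite !out //; ring.
(* Both matchings end in the same edge [e], so their lifts add up: [wt L1 + wt L2 <= N X [set e]],
   and [4 a b <= (a + b)^2]. The final comparison turns [2 ln 2] into
   [(2 ln 2 / 10) / (2/5) = ln 2 / 2]. *)
have w12 : \sum_(f in L1) w f + \sum_(f in L2) w f <= - (2 * ln 2).
  rewrite (node_w_pm p1 (LX L1 p1 e1)) (node_w_pm p2 (LX L2 p2 e2)).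
  have W1 := wt_gt0 p1; have W2 := wt_gt0 p2.
  have : (wt L1 + wt L2 <= N X [set e])%N.
    have := @wt_family e [set L1; L2]; rewrite big_setU1 ?inE // big_set1; apply.
    by move=> L' /set2P[] ->; split => //; apply: LX.
  move=> le12; have : ln (4 * (wt L1 * wt L2))%:R <= ln (N X [set e] * N X [set e])%:R :> R.
    apply: ler_ln_nat; first by rewrite !muln_gt0 W1.
    apply: leq_trans (leq_mul le12 le12).
    by rewrite mulnn; have [] := nat_AGM2 (wt L1) (wt L2).
  have NX : (0 < N X [set e])%N by apply: leq_trans le12; rewrite addn_gt0 W1.
  rewrite !ln_natM ?muln_gt0 ?W1 //.
  have -> : ln 4 = 2 * ln 2 :> R by rewrite -[4%N]/(2 ^ 2)%N natrX lnXn // mulr_natl.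
  lra.
have := node_w_total; move: le wLle; rewrite yw; lra.
Qed.

(** Every contracted matching lifts, so [pm_through e <= N X [set e]] and the root entropy is at
    most the potential. *)
Lemma node_size : (6 < #|Ch X|)%N ->
  Num.sqrt (#|Ch X|.+1)%:R <= (12 * 12 * 10 * 100) * (potential X / 3 + 5).
Proof.
move=> C6; have P8 : (8 <= #|P|)%N by rewrite node_card.
have := fat_bound XP node_seam_in node_cubic fatN P8; rewrite node_card.
move=> /le_trans; apply; rewrite ler_pM2l ?mulr_gt0 // lerD2r ler_pM2r ?invr_gt0 //.
rewrite /root_entropy /potential oX boundary_node1 // boundaryC.
rewrite (setIidPr _); last by apply: boundary_seams.
apply: ler_sum => e eX; apply: ler_ln_nat; last exact: pm_through_le.
have eF : e \in F by apply: (subsetP (node_seams_sub XP)); rewrite boundaryC.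
exact: (pm_through_gt0 node_cubic fatN eF).
Qed.

End Node.
End Potential.

(** * Nodes with three or two children *)

Lemma set1I_if (T : finType) (a : T) (A : {set T}) :
  [set a] :&: A = if a \in A then [set a] else set0.
Proof.
case: ifP => aA; first by apply/setIidPl; rewrite sub1set.
by apply/setP => b; rewrite !inE; case: eqVneq => //= ->.
Qed.

Section SmallNodes.
Variables (R : realType) (V E : finType) (src dst : E -> V) (root : V).
Local Notation bd := (boundary src dst).
Local Notation N := (nstates src dst).
Hypothesis vertex3 : forall v, #|bd [set v]| = 3.
Hypothesis no_bridge : forall X, (#|bd X| != 1)%N.
Variable SS : {set {set V}}.
Hypothesis maxSS : maxset (side_family src dst root) SS.
Local Notation Ch := (children SS).
Local Notation positive := (positive src dst).
Local Notation potential := (potential R src dst).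

Lemma disjoint_three_boundaries (A B C : {set V}) e : [disjoint A & B] -> [disjoint A & C] ->
  [disjoint B & C] -> e \in bd A -> e \in bd B -> e \notin bd C.
Proof.
move=> /pred0P/= AB /pred0P/= AC /pred0P/= BC; rewrite !inE.
move: (AB (src e)) (AC (src e)) (BC (src e)) (AB (dst e)) (AC (dst e)) (BC (dst e)) => /=.
by do 3![case: (src e \in _)]; do 3![case: (dst e \in _)].
Qed.

(** * Three children: contraction to K4 *)

Section Three.
Variable X : {set V}.
Hypotheses (XS : X \in SS) (X1 : (1 < #|X|)%N) (C3 : #|Ch X| = 3).
Hypothesis posC : forall Y, Y \in Ch X -> positive Y.

Let C2 : (2 < #|Ch X|)%N. Proof. by rewrite C3. Qed.
Let oX : odd #|X|. Proof. by have [] := many_children_odd vertex3 no_bridge maxSS XS X1 C2. Qed.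
Let oC Y : Y \in Ch X -> odd #|Y|.
Proof. by have [_] := many_children_odd vertex3 no_bridge maxSS XS X1 C2; apply. Qed.
Let tC : trivIset (Ch X). Proof. exact: trivIset_children maxSS X. Qed.
Let cC : cover (Ch X) = X. Proof. exact: (cover_children vertex3 maxSS XS X1). Qed.
Let B3 Y : Y \in Ch X -> #|bd Y| = 3.
Proof. by move=> YC; have /childP[YS _ _] := YC; apply: (odd_side vertex3 no_bridge maxSS YS (oC YC)). Qed.
Let X3 : #|bd X| = 3. Proof. exact: (odd_side vertex3 no_bridge maxSS XS oX). Qed.

(** Two children share at most one edge, and [A] has at most one in [bd X], as otherwise two
    children would have a union with a small cut. Three edges in three places leave exactly one in
    each. *)
Lemma three_edges (A B D : {set V}) : Ch X = A |: (B |: [set D]) -> A != B -> A != D -> B != D ->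
  exists a b d, [/\ bd A :&: bd X = [set a], bd A :&: bd B = [set b], bd A :&: bd D = [set d] &
    bd A = [set a; b; d]].
Proof.
move=> CE AB AD BD.
have AC : A \in Ch X by rewrite CE setU11.
have BC : B \in Ch X by rewrite CE !inE eqxx orbT.
have DC : D \in Ch X by rewrite CE !inE eqxx !orbT.
have dis := child_disjoint maxSS.
have pair U W : U \in Ch X -> W \in Ch X -> U != W -> (#|bd U :&: bd W| <= 1)%N.
  move=> UC WC UW; have := child_pair_boundary maxSS XS C2 UC WC UW.
  have := card_boundary_setU src dst (dis _ _ _ UC WC UW); rewrite (B3 UC) (B3 WC).
  by move: #|bd (U :|: W)| #|bd U :&: bd W| => a k; clear; lia.
have XE : X = A :|: (B :|: D).
  by rewrite -cC CE /cover !big_setU1 ?inE ?negb_or ?AB ?AD //= big_set1.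
have dA : [disjoint A & B :|: D] by rewrite disjoints_subset setCU subsetI -!disjoints_subset (dis _ _ _ AC BC AB) (dis _ _ _ AC DC AD).
have bdXE := boundary_setU src dst dA; rewrite -XE in bdXE.
have AX1 : (#|bd A :&: bd X| <= 1)%N.
  have := card_boundary_setU src dst dA; rewrite -XE X3 (B3 AC) => eq1.
  have := child_pair_boundary maxSS XS C2 BC DC BD => gt3.
  have := cardsID (bd (B :|: D)) (bd A); rewrite (B3 AC) => eq2.
  have -> : bd A :&: bd X = bd A :\: bd (B :|: D).
    rewrite bdXE; apply/setP => e; rewrite !in_setI !in_setD !in_setI !in_setU.
    by case: (e \in bd A); case: (e \in bd (B :|: D)).
  move: eq1 gt3 eq2; move: #|bd (B :|: D)| #|bd A :&: _| #|bd A :\: _| => z k d.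
  by clear; lia.
have sub : bd A \subset (bd A :&: bd X) :|: ((bd A :&: bd B) :|: (bd A :&: bd D)).
  apply/subsetP => e eA; rewrite -!setIUr in_setI eA /= bdXE in_setU in_setD in_setI in_setU eA /=.
  rewrite andbT; case: (boolP (e \in bd (B :|: D))) => //= eBD.
  by have := subsetP (boundary_setU_sub _ _ B D) _ eBD.
have h1 := pair A B AC BC AB; have h2 := pair A D AC DC AD.
have [e1 e2 e3] : [/\ #|bd A :&: bd X| == 1%N, #|bd A :&: bd B| == 1%N & #|bd A :&: bd D| == 1%N].
  have := leq_trans (subset_leq_card sub) (leq_card_setU _ _); rewrite (B3 AC).
  have := (leq_card_setU (bd A :&: bd B) (bd A :&: bd D)).1.
  move: AX1 h1 h2; move: #|bd A :&: bd X| #|bd A :&: bd B| #|bd A :&: bd D| #|_ :|: _| => a b c d.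
  clear; move=> *; split; apply/eqP; lia.
have [a aE] := cards1P e1; have [b bE] := cards1P e2; have [d dE] := cards1P e3.
exists a, b, d; split=> //; apply/eqP; rewrite eqEsubset; apply/andP; split.
  by move: sub; rewrite aE bE dE setUA.
by rewrite -aE -bE -dE !subUset !subsetIl.
Qed.

(* Contracting gives K4: s e is the edge of bd X in the matching of K4 containing e, and l is the edge
   of bd Y in bd X, for which all of bd Y may be used as well. *)
Lemma k4_step Y : Y \in Ch X -> exists (s : E -> E) (l : E),
  [/\ l \in bd Y, {in bd Y, forall e, s e \in bd X}, {in bd Y &, injective s} &
   [/\ {in bd Y, forall e, N Y [set e] <= N X [set s e]}%N,
       (N Y [set l] + N Y (bd Y) <= N X [set s l])%N &
       (N Y [set l] <= N X (bd X))%N]].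
Proof.
move=> YC; have c2 : #|Ch X :\ Y| == 2.
  by move: C3; rewrite (cardsD1 Y) YC add1n => -[->].
have [P [Q [PQ CPQ]]] := cards2P _ c2.
have CE : Ch X = Y |: (P |: [set Q]) by rewrite -CPQ setD1K.
have nY : Y \notin [set P; Q] by rewrite -CPQ in_setD1 eqxx.
have [YP YQ] : Y != P /\ Y != Q by apply/andP; rewrite -negb_or -!in_set1 -in_setU.
have PC : P \in Ch X by rewrite CE !inE eqxx orbT.
have QC : Q \in Ch X by rewrite CE !inE eqxx !orbT.
have dis := child_disjoint maxSS.
have [yr [yp [yq [YX YPe YQe YE]]]] := three_edges CE YP YQ PQ.
have CE2 : Ch X = P |: (Y |: [set Q]) by rewrite CE setUCA.
have PY : P != Y by rewrite eq_sym.
have [pr [py [pq [PX PYe PQe PE]]]] := three_edges CE2 PY PQ YQ.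
have CE3 : Ch X = Q |: (Y |: [set P]) by rewrite CE [P |: _]setUC setUCA.
have QY : Q != Y by rewrite eq_sym.
have QP : Q != P by rewrite eq_sym.
have [qr [qy [qp [QX QYe QPe QE]]]] := three_edges CE3 QY QP YP.
have {}PYe : bd P :&: bd Y = [set yp] by rewrite setIC.
have {}QYe : bd Q :&: bd Y = [set yq] by rewrite setIC.
have {}QPe : bd Q :&: bd P = [set pq] by rewrite setIC.
have dYP := dis _ _ _ YC PC YP; have dYQ := dis _ _ _ YC QC YQ; have dPQ := dis _ _ _ PC QC PQ.
have dX A : A \in Ch X -> [disjoint A & ~: X].
  by move=> /childP[_ /proper_sub AX _]; rewrite -subsets_disjoint.
have dYX := dX _ YC; have dPX := dX _ PC; have dQX := dX _ QC.
have in2 (A B : {set V}) e : bd A :&: bd B = [set e] -> (e \in bd A) /\ (e \in bd B).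
  by move=> ABe; apply/andP; rewrite -in_setI ABe set11.
have out3 (A B C : {set V}) e : bd A :&: bd B = [set e] -> [disjoint A & B] -> [disjoint A & C] ->
    [disjoint B & C] -> (e \in bd C) = false.
  move=> /in2[eA eB] dAB dAC dBC; apply/negbTE.
  exact: disjoint_three_boundaries dAB dAC dBC eA eB.
have outX (A B : {set V}) e : bd A :&: bd B = [set e] -> [disjoint A & B] -> A \in Ch X -> B \in Ch X ->
    (e \in bd X) = false.
  by move=> ABe dAB AC BC; rewrite -(boundaryC src dst X); apply: (out3 A B) => //; apply: dX.
have outX' (A B : {set V}) e : bd A :&: bd X = [set e] -> [disjoint A & B] -> A \in Ch X -> B \in Ch X ->
    (e \in bd B) = false.
  move=> ABe dAB AC BC; apply: (out3 A (~: X)); rewrite ?boundaryC //; first exact: dX.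
  by rewrite disjoint_sym dX.
have dPY : [disjoint P & Y] by rewrite disjoint_sym.
have dQY : [disjoint Q & Y] by rewrite disjoint_sym.
have dQP : [disjoint Q & P] by rewrite disjoint_sym.
have [yrY yrX] := in2 _ _ _ YX; have [ypY ypP] := in2 _ _ _ YPe; have [yqY yqQ] := in2 _ _ _ YQe.
have [prP prX] := in2 _ _ _ PX; have [qrQ qrX] := in2 _ _ _ QX; have [pqP pqQ] := in2 _ _ _ PQe.
have yrP := outX' _ _ _ YX dYP YC PC; have yrQ := outX' _ _ _ YX dYQ YC QC.
have prY := outX' _ _ _ PX dPY PC YC; have prQ := outX' _ _ _ PX dPQ PC QC.
have qrY := outX' _ _ _ QX dQY QC YC; have qrP := outX' _ _ _ QX dQP QC PC.
have ypX := outX _ _ _ YPe dYP YC PC; have yqX := outX _ _ _ YQe dYQ YC QC.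
have pqX := outX _ _ _ PQe dPQ PC QC.
have ypQ := out3 _ _ _ _ YPe dYP dYQ dPQ; have yqP := out3 _ _ _ _ YQe dYQ dYP dQP.
have pqY := out3 _ _ _ _ PQe dPQ dPY dQY.
have mem_rw := (yrY, yrX, yrP, yrQ, ypY, ypP, ypX, ypQ, yqY, yqQ, yqX, yqP, prP, prX, prY, prQ,
  qrQ, qrX, qrY, qrP, (pqP, pqQ, pqX, pqY)).
have seam_in A e : A \in Ch X -> e \in bd A -> e \in seams src dst (Ch X).
  by move=> AC eA; apply/bigcupP; exists A.
have ne (A : {set V}) e f : (e \in bd A) -> (f \in bd A) = false -> (e == f) = false.
  by move=> eA fA; apply: contraTF eA => /eqP ->; rewrite fA.
have pos A e : A \in Ch X -> e \in bd A -> (0 < N A [set e])%N.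
  by move=> AC eA; have := posC AC; rewrite /positive oC // => /forall_inP; apply.
have prodE (F : {set V} -> nat) : (\prod_(A in Ch X) F A = F Y * (F P * F Q))%N.
  by rewrite CE big_setU1 ?inE ?negb_or ?YP ?YQ //= big_setU1 ?inE //= big_set1.
have glue1 (L : {set E}) S : L \subset seams src dst (Ch X) -> L :&: bd X = S ->
    (N Y (L :&: bd Y) * (N P (L :&: bd P) * N Q (L :&: bd Q)) <= N X S)%N.
  move=> LQ LS; have := @nstates_glue _ _ src dst X (Ch X) tC cC S [set L].
  by rewrite big_set1 prodE; apply=> L' /set1P ->.
have yr_yq : (yr == yq) = false by apply: (ne X); rewrite mem_rw.
have yr_yp : (yr == yp) = false by apply: (ne X); rewrite mem_rw.
have yp_yq : (yp == yq) = false by apply: (ne P); rewrite mem_rw.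
have yr_pr : (yr == pr) = false by apply: (ne Y); rewrite mem_rw.
have yr_qr : (yr == qr) = false by apply: (ne Y); rewrite mem_rw.
have pr_qr : (pr == qr) = false by apply: (ne P); rewrite mem_rw.
(* With [r] for the outside, the perfect matchings of K4 are [yr, pq], then [yp, qr], and
   [yq, pr]. *)
pose s e := if e == yr then yr else if e == yq then pr else qr.
have s1 : s yr = yr by rewrite /s eqxx.
have s2 : s yq = pr by rewrite /s eqxx eq_sym yr_yq.
have s3 : s yp = qr by rewrite /s eq_sym yr_yp yp_yq.
have L1 : (N Y [set yr] <= N Y [set yr] * (N P [set pq] * N Q [set pq]))%N.
  by rewrite leq_pmulr // muln_gt0 !pos.
(* Both traces [[set yr; pq]] and [bd Y] meet [bd X] exactly in [yr], so their lifts add up. *)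
have E1 : (N Y [set yr] + N Y (bd Y) <= N X [set yr])%N.
  have := @nstates_glue _ _ src dst X (Ch X) tC cC [set yr] [set [set yr; pq]; bd Y].
  have nE : [set yr; pq] \notin [set bd Y].
    by rewrite in_set1; apply/eqP => EY; move: pqY; rewrite -EY set22.
  rewrite (big_setU1 _ nE) /=.
  rewrite big_set1 !prodE; move=> le; apply: leq_trans (le _); last first.
    move=> L /set2P[] ->; split.
    - by rewrite subUset !sub1set (seam_in Y) // (seam_in P).
    - by rewrite setIUl !set1I_if !mem_rw setU0.
    - by apply/subsetP => e; apply: seam_in.
    - exact: YX.
  rewrite !setIUl !set1I_if !mem_rw setU0 !set0U setIid YPe YQe.
  apply: leq_add => //; rewrite leq_pmulr // muln_gt0 !pos //.
have yEP e : e \in bd Y -> [\/ e = yr, e = yp | e = yq].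
  by rewrite YE => /setUP[/set2P[]|/set1P] ->; [constructor 1 | constructor 2 | constructor 3].
exists s, yr; split=> //.
- by move=> e /yEP[] ->; rewrite ?s1 ?s2 ?s3 mem_rw.
- have neq (a b : E) : (a == b) = false -> a <> b by move=> + ab; rewrite ab eqxx.
  have n1 := neq _ _ yr_pr; have n2 := neq _ _ yr_qr; have n3 := neq _ _ pr_qr.
  by move=> e f /yEP[] -> /yEP[] ->; rewrite ?s1 ?s2 ?s3; move: n1 n2 n3; clear; congruence.
split.
- move=> e /yEP[] ->; rewrite ?s1 ?s2 ?s3.
  + by apply: leq_trans E1; rewrite leq_addr.
  + have := @glue1 [set yp; qr] [set qr]; rewrite !setIUl !set1I_if !mem_rw !set0U !setU0.
    rewrite subUset !sub1set (seam_in Y) // (seam_in Q) // => /(_ isT erefl); apply: leq_trans.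
    by rewrite leq_pmulr // muln_gt0 !pos.
  + have := @glue1 [set yq; pr] [set pr]; rewrite !setIUl !set1I_if !mem_rw !set0U !setU0.
    rewrite subUset !sub1set (seam_in Y) // (seam_in P) // => /(_ isT erefl); apply: leq_trans.
    by rewrite leq_pmulr // muln_gt0 !pos.
- by rewrite s1.
(* The trace [bd X]: each child uses only its edge to the outside. *)
- have XC : bd X \subset seams src dst (Ch X) by apply: boundary_seams.
  have := glue1 _ _ XC (setIid _); rewrite ![bd X :&: _]setIC YX PX QX; apply: leq_trans.
  by rewrite leq_pmulr // muln_gt0 !pos.
Qed.

End Three.
End SmallNodes.

(** * Nodes with two children, by parity *)

Section TwoChildren.
Variables (R : realType) (V E : finType) (src dst : E -> V) (root : V).
Local Notation bd := (boundary src dst).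
Local Notation N := (nstates src dst).
Hypothesis vertex3 : forall v, #|bd [set v]| = 3.
Hypothesis no_bridge : forall X, (#|bd X| != 1)%N.
Variable SS : {set {set V}}.
Hypothesis maxSS : maxset (side_family src dst root) SS.
Local Notation Ch := (children SS).
Local Notation positive := (positive src dst).
Local Notation potential := (potential R src dst).

Section Two.
Variables P Q : {set V}.
Hypotheses (PS : P \in SS) (QS : Q \in SS) (XS : P :|: Q \in SS) (PQ : [disjoint P & Q]).
Hypotheses (posP : positive P) (posQ : positive Q).
Let X := P :|: Q.

Lemma glue_two (LL : {set {set E}}) S :
  (forall L : {set E}, L \in LL -> L \subset bd P :|: bd Q /\ L :&: bd X = S) ->
  (\sum_(L in LL) N P (L :&: bd P) * N Q (L :&: bd Q) <= N X S)%N.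
Proof.
have P0 : P != set0 by have /and3P[] := sideP maxSS PS.
have nPQ : P != Q.
  by apply: contraNneq P0 => E0; move: PQ; rewrite E0 -setI_eq0 setIid.
have tPQ : trivIset [set P; Q].
  apply/trivIsetP => A B /set2P[] -> /set2P[] -> //; rewrite ?eqxx //.
  by rewrite disjoint_sym.
have cPQ : cover [set P; Q] = X by rewrite /cover big_setU1 ?inE //= big_set1.
have sPQ : seams src dst [set P; Q] = bd P :|: bd Q by rewrite /seams big_setU1 ?inE //= big_set1.
move=> LP; have := @nstates_glue _ _ src dst X [set P; Q] tPQ cPQ S LL; rewrite sPQ => /(_ LP).
apply: leq_trans; rewrite leq_eqVlt; apply/orP; left; apply/eqP; apply: eq_bigr => L _.
by rewrite big_setU1 ?inE //= big_set1.
Qed.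

Lemma glue_two1 (L S : {set E}) : L \subset bd P :|: bd Q -> L :&: bd X = S ->
  (N P (L :&: bd P) * N Q (L :&: bd Q) <= N X S)%N.
Proof.
by move=> LQ LS; have := @glue_two [set L] S; rewrite big_set1; apply=> L' /set1P ->.
Qed.

Let oX : odd #|X| = odd #|P| (+) odd #|Q|.
Proof. by rewrite /X cardsU (_ : P :&: Q = set0) ?cards0 ?subn0 ?oddD //; apply/eqP; rewrite setI_eq0. Qed.

Let bdXE : bd X = (bd P :|: bd Q) :\: (bd P :&: bd Q).
Proof. exact: boundary_setU. Qed.

Let cardX : (#|bd X| + 2 * #|bd P :&: bd Q| = #|bd P| + #|bd Q|)%N.
Proof. exact: card_boundary_setU. Qed.

Lemma two_even : ~~ odd #|P| -> ~~ odd #|Q| ->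
  positive X /\ potential P + potential Q <= potential X.
Proof.
move=> eP eQ; have eX : odd #|X| = false by rewrite oX (negPf eP) (negPf eQ).
move: posP posQ; rewrite /positive /potential eX (negPf eP) (negPf eQ) => /andP[p0 p1] /andP[q0 q1].
have h0 : (N P set0 * N Q set0 <= N X set0)%N.
  by have := @glue_two1 set0 set0; rewrite !set0I sub0set => /(_ isT erefl).
have h1 : (N P (bd P) * N Q (bd Q) <= N X (bd X))%N.
  have := @glue_two1 (bd P :|: bd Q) (bd X) (subxx _).
  rewrite (setIidPr (subsetUl _ _)) (setIidPr (subsetUr _ _)) => /(_ _); apply.
  by apply/setIidPr; rewrite bdXE subsetDl.
have z0 : (0 < N P set0 * N Q set0)%N by rewrite muln_gt0 p0.
have z1 : (0 < N P (bd P) * N Q (bd Q))%N by rewrite muln_gt0 p1.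
split; first by rewrite (leq_trans z0 h0) (leq_trans z1 h1).
have := ler_ln_nat R z0 h0; have := ler_ln_nat R z1 h1.
by rewrite !ln_natM //; lra.
Qed.

(** [bd P] has 0 or 2 edges, half of them shared with [Q]. In the second case the other edge [f]
    replaces the shared edge [g] in the boundary: [f] is reached with all of [bd P] used, the two
    remaining edges with none of it. *)
Lemma two_mixed : ~~ odd #|P| -> odd #|Q| ->
  positive X /\ potential P + potential Q <= potential X.
Proof.
move=> eP oQ; have oX1 : odd #|X| by rewrite oX (negPf eP) oQ.
move: posP posQ; rewrite /positive /potential oX1 (negPf eP) oQ => /andP[p0 p1] /forall_inP q.
have Q3 := odd_side vertex3 no_bridge maxSS QS oQ; have X3 := odd_side vertex3 no_bridge maxSS XS oX1.
have hQ e : e \in bd X -> e \in bd Q -> (N P set0 * N Q [set e] <= N X [set e])%N.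
  move=> eX eQ; have eP' : (e \in bd P) = false.
    by move: eX; rewrite bdXE !inE /= -!/(e \in _) => /andP[]; rewrite -!in_set; move: eQ; rewrite !inE => ->; case: (_ != _).
  have := @glue_two1 [set e] [set e]; rewrite !set1I_if eX eQ eP' sub1set in_setU eQ orbT.
  by move=> /(_ isT erefl).
have k1 : (#|bd P| = 2 * #|bd P :&: bd Q|)%N.
  by move: cardX; rewrite Q3 X3; move: #|bd P| #|bd P :&: bd Q| => a b; clear; lia.
have P2 := even_side vertex3 maxSS PS eP.
have [K0|K1] : #|bd P :&: bd Q| = 0%N \/ #|bd P :&: bd Q| = 1%N.
  by move: k1 P2; move: #|bd P| #|bd P :&: bd Q| => a b; clear; lia.
  have bP0 : bd P = set0 by apply/eqP; rewrite -cards_eq0 k1 K0.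
  have bX : bd X = bd Q by rewrite bdXE bP0 set0U set0I setD0.
  have h e : e \in bd Q -> (N P set0 * N Q [set e] <= N X [set e])%N.
    by move=> eQ; apply: hQ; rewrite ?bX.
  split.
    by apply/forall_inP => e; rewrite bX => eQ; apply: leq_trans (h e eQ); rewrite muln_gt0 p0 q.
  rewrite bX bP0 (_ : 2 * _ + _ = \sum_(e in bd Q) ln (N P set0)%:R); last first.
    by rewrite sumr_const Q3; ring.
  rewrite -big_split; apply: ler_sum => e eQ /=.
  rewrite -ln_natM ?q //; apply: ler_ln_nat (h e eQ); by rewrite muln_gt0 p0 q.
have /cards1P[g gE] : #|bd P :&: bd Q| == 1%N by rewrite K1.
have /andP[gP gQ] : (g \in bd P) && (g \in bd Q) by rewrite -in_setI gE set11.
have /cards1P[f fE] : #|bd P :\ g| == 1%N.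
  by move: k1; rewrite K1 (cardsD1 g) gP add1n => -[->].
have /setD1P[fg fP] : f \in bd P :\ g by rewrite fE set11.
have fQ : (f \in bd Q) = false.
  by apply: contraNF fg => fQ; rewrite -in_set1 -gE in_setI fP.
have PE : bd P = [set f; g] by rewrite -fE setUC setD1K.
have XE : bd X = f |: (bd Q :\ g).
  rewrite bdXE gE PE; apply/setP => e; rewrite !inE.
  case: (eqVneq e g) => [->|eg] /=; last by rewrite orbF.
  by rewrite eq_sym (negPf fg).
have fX : f \in bd X by rewrite XE setU11.
have hf : (N P (bd P) * N Q [set g] <= N X [set f])%N.
  have := @glue_two1 (bd P) [set f]; rewrite subsetUl setIid gE => /(_ isT); apply.
  by rewrite XE PE setIUl !set1I_if !inE eqxx /= eq_sym (negPf fg) eqxx setU0.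
have h e : e \in bd Q :\ g -> (N P set0 * N Q [set e] <= N X [set e])%N.
  by move=> /[dup] eQ /setD1P[_ eQ']; apply: hQ; rewrite // XE setU1r.
split.
  apply/forall_inP => e; rewrite XE => /setU1P[->|/[dup] eQg /setD1P[_ eQ]].
    by apply: leq_trans hf; rewrite muln_gt0 p1 q.
  by apply: leq_trans (h e eQg); rewrite muln_gt0 p0 q.
have fn : f \notin bd Q :\ g by rewrite inE fQ andbF.
rewrite XE big_setU1 //= (big_setD1 g gQ) /=.
have : \sum_(e in bd Q :\ g) (ln (N P set0)%:R + ln (N Q [set e])%:R) <= \sum_(e in bd Q :\ g) ln (N X [set e])%:R :> R.
  apply: ler_sum => e /[dup] eQg /setD1P[_ eQ]; rewrite -ln_natM ?q //; apply: ler_ln_nat (h e eQg).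
  by rewrite muln_gt0 p0 q.
rewrite big_split /= sumr_const (_ : #|_| = 2); last first.
  by move: Q3; rewrite (cardsD1 g) gQ add1n => -[].
have : ln (N P (bd P))%:R + ln (N Q [set g])%:R <= ln (N X [set f])%:R :> R.
  by rewrite -ln_natM ?q //; apply: ler_ln_nat hf; rewrite muln_gt0 p1 q.
rewrite -[_ *+ 2]mulr_natl; lra.
Qed.

(** The two or three shared edges are alternatives that add up in [N X set0]. This count has weight
    2 in the potential, where [(a + b)^2 >= 4 a b], or weight 3 when [bd X] is empty, where
    [(a + b + c)^3 >= 2 a b c]. *)
Lemma two_odd : odd #|P| -> odd #|Q| ->
  positive X /\ potential P + potential Q + ln 2 <= potential X.
Proof.
move=> oP oQ; have eX : odd #|X| = false by rewrite oX oP oQ.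
move: posP posQ; rewrite /positive /potential eX oP oQ => /forall_inP p /forall_inP q.
have Q3 := odd_side vertex3 no_bridge maxSS QS oQ; have P3 := odd_side vertex3 no_bridge maxSS PS oP.
have X2 : (#|bd X| <= 2)%N by apply: (even_side vertex3 maxSS XS); rewrite eX.
set K := bd P :&: bd Q.
have pq g : g \in K -> (0 < N P [set g] * N Q [set g])%N.
  by rewrite inE => /andP[gP gQ]; rewrite muln_gt0 p // q.
have hK : (\sum_(g in K) N P [set g] * N Q [set g] <= N X set0)%N.
  have := @glue_two [set [set g] | g in K] set0.
  rewrite big_imset /=; last by move=> a b _ _; apply: set1_inj.
  move=> le; apply: leq_trans (le _); last first.
    move=> _ /imsetP[g /setIP[gP gQ] ->]; split; first by rewrite sub1set in_setU gP.
    by rewrite set1I_if bdXE in_setD in_setI gP gQ.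
  apply: leq_sum => g /setIP[gP gQ]; by rewrite !set1I_if gP gQ.
have K3 : (#|K| = 3 \/ #|K| = 2)%N.
  move: cardX X2; rewrite P3 Q3 -/K; have := subset_leq_card (subsetIl (bd P) (bd Q)); rewrite -/K P3.
  by move: #|bd X| #|K| => a b; clear; lia.
have sumP : \sum_(e in bd P) ln (N P [set e])%:R = \sum_(g in K) ln (N P [set g])%:R + \sum_(e in bd P :\: K) ln (N P [set e])%:R :> R.
  by rewrite (big_setID K) /= (setIidPr _) // subsetIl.
have sumQ : \sum_(e in bd Q) ln (N Q [set e])%:R = \sum_(g in K) ln (N Q [set g])%:R + \sum_(e in bd Q :\: K) ln (N Q [set e])%:R :> R.
  by rewrite (big_setID K) /= (setIidPr _) // subsetIr.
have sumK : \sum_(g in K) ln (N P [set g])%:R + \sum_(g in K) ln (N Q [set g])%:R =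
    \sum_(g in K) ln (N P [set g] * N Q [set g])%:R :> R.
  rewrite -big_split; apply: eq_bigr => g /setIP[gP gQ] /=; by rewrite ln_natM ?p ?q.
case: K3 => Kc.
  have KP : K = bd P by apply/eqP; rewrite eqEcard subsetIl P3 Kc.
  have KQ : K = bd Q by apply/eqP; rewrite eqEcard subsetIr Q3 Kc.
  have bX0 : bd X = set0 by rewrite bdXE -KP -KQ setUid setIid setDv.
  have [a [b [c [Ka ab ac bc]]]] : exists a b c, [/\ K = a |: (b |: [set c]), a != b, a != c & b != c].
    have /card_gt0P[a aK] : (0 < #|K|)%N by rewrite Kc.
    have c2 : #|K :\ a| == 2 by move: Kc; rewrite (cardsD1 a) aK add1n => -[->].
    have [b [c [bc Kbc]]] := cards2P _ c2.
    have /setD1P[ba _] : b \in K :\ a by rewrite Kbc set21.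
    have /setD1P[ca _] : c \in K :\ a by rewrite Kbc set22.
    by exists a, b, c; rewrite -Kbc setD1K // eq_sym ba eq_sym ca.
  have big3 (T : Type) (idx : T) (op : Monoid.com_law idx) (F : E -> T) :
      \big[op/idx]_(g in K) F g = op (F a) (op (F b) (F c)).
    by rewrite Ka big_setU1 ?inE ?negb_or ?ab ?ac //= big_setU1 ?inE //= big_set1.
  have aK : a \in K by rewrite Ka !inE eqxx.
  have bK : b \in K by rewrite Ka !inE eqxx !orbT.
  have cK : c \in K by rewrite Ka !inE eqxx !orbT.
  move: hK (pq a aK) (pq b bK) (pq c cK) sumK; rewrite !big3 /=.
  set x := (N P [set a] * _)%N; set y := (N P [set b] * _)%N; set z := (N P [set c] * _)%N.
  move=> hK x0 y0 z0 sumK; clearbody x y z.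
  have NX : (0 < N X set0)%N by apply: leq_trans hK; rewrite addn_gt0 x0.
  rewrite bX0 NX; split=> //.
  have : ln (2 * (x * (y * z)))%:R <= ln (N X set0 * (N X set0 * N X set0))%:R :> R.
    apply: ler_ln_nat; first by rewrite !muln_gt0 x0 y0.
    apply: leq_trans (leq_mul hK (leq_mul hK hK)).
    move: x0 y0 z0; clear; case: x => // x; case: y => // y; case: z => // z _ _ _; nia.
  rewrite !ln_natM ?muln_gt0 ?NX ?x0 ?y0 //.
  move: sumP sumQ; rewrite -KP -KQ setDv !big_set0 !addr0 => _ _.
  rewrite !big3 /=; lra.
have c2 : #|K| == 2 by rewrite Kc.
have [g [h [gh Kgh]]] := cards2P _ c2.
have cP : #|bd P :\: K| == 1%N by rewrite cardsD (setIidPr (subsetIl _ _)) P3 -/K Kc.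
have cQ : #|bd Q :\: K| == 1%N by rewrite cardsD (setIidPr (subsetIr _ _)) Q3 -/K Kc.
have [f fE] := cards1P cP; have [f' fE'] := cards1P cQ.
have /setDP[fP fK] : f \in bd P :\: K by rewrite fE set11.
have /setDP[fQ' fK'] : f' \in bd Q :\: K by rewrite fE' set11.
have fQ : (f \in bd Q) = false by apply: contraNF fK => fQ; rewrite inE fP.
have fP' : (f' \in bd P) = false by apply: contraNF fK' => fP'; rewrite inE fP'.
have XE : bd X = [set f; f'] by rewrite bdXE -/K setDUl fE fE'.
have hX : (N P [set f] * N Q [set f'] <= N X (bd X))%N.
  have := @glue_two1 (bd X) (bd X) _ (setIid _); rewrite {1}bdXE subsetDl => /(_ isT).
  by rewrite XE !setIUl !set1I_if fP fQ fP' fQ' setU0 set0U.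
have z1 : (0 < N P [set f] * N Q [set f'])%N by rewrite muln_gt0 p // q.
have gK : g \in K by rewrite Kgh set21.
have hhK : h \in K by rewrite Kgh set22.
have big2 (T : Type) (idx : T) (op : Monoid.com_law idx) (F : E -> T) :
    \big[op/idx]_(g in K) F g = op (F g) (F h).
  by rewrite Kgh big_setU1 ?inE //= big_set1.
move: hK (pq g gK) (pq h hhK) sumK; rewrite sumP sumQ fE fE' !big_set1 !big2 /=.
set x := (N P [set g] * _)%N; set y := (N P [set h] * _)%N.
move=> hK x0 y0 sumK; clearbody x y.
have NX : (0 < N X set0)%N by apply: leq_trans hK; rewrite addn_gt0 x0.
split; first by rewrite NX (leq_trans z1 hX).
have : ln (4 * (x * y))%:R <= ln (N X set0 * N X set0)%:R :> R.
  apply: ler_ln_nat; first by rewrite !muln_gt0 x0 y0.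
  by apply: leq_trans (leq_mul hK hK); rewrite mulnn; have [] := nat_AGM2 x y.
have := ler_ln_nat R z1 hX.
rewrite !ln_natM ?muln_gt0 ?NX ?x0 ?y0 ?p ?q //.
have -> : ln 4 = 2 * ln 2 :> R by rewrite -[4%N]/(2 ^ 2)%N natrX lnXn // mulr_natl.
have : 0 <= ln 2 :> R by exact: ln_nat_ge0.
lra.
Qed.

End Two.
End TwoChildren.

(** * Counting vertices by potential *)

Section Growth.
Variables (R : realType) (V E : finType) (src dst : E -> V) (root : V).
Local Notation bd := (boundary src dst).
Local Notation N := (nstates src dst).
Hypothesis vertex3 : forall v, #|bd [set v]| = 3.
Hypothesis no_bridge : forall X, (#|bd X| != 1)%N.
Variable SS : {set {set V}}.
Hypothesis maxSS : maxset (side_family src dst root) SS.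
Local Notation Ch := (children SS).
Implicit Types X Y : {set V}.
Local Notation positive := (positive src dst).
Local Notation potential := (potential R src dst).

Lemma single_states v e : e \in bd [set v] -> (0 < N [set v] [set e])%N.
Proof.
move=> ev; apply/card_gt0P; exists [set e]; rewrite inE sub1set.
have ev1 : [set e] :&: bd [set v] = [set e] by rewrite set1I_if ev.
rewrite (subsetP (boundary_touch src dst _) _ ev) ev1 eqxx /=.
by apply/matchesP => u /set1P ->; rewrite ev1 cards1.
Qed.

Lemma sum_card_children X : X \in SS -> (1 < #|X|)%N -> (\sum_(Y in Ch X) #|Y|)%N = #|X|.
Proof.
by move=> XS X1; rewrite (eqP (trivIset_children maxSS X)) (cover_children vertex3 maxSS XS X1).
Qed.

(** The threshold is the gain provided by [node_gain]. *)
Definition substantial X := ln 2 / 2 <= potential X.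

(** The sides allowed to miss the threshold. The count in the second clause makes the next K4 step
    gain. *)
Definition tiny X := (#|X| == 1)%N || (#|X| == 3)%N && (0 < N X (bd X))%N.

Lemma tiny_odd X : tiny X -> odd #|X|.
Proof. by case/orP => [/eqP ->|/andP[/eqP ->]]. Qed.

Lemma tiny_le3 X : tiny X -> (#|X| <= 3)%N.
Proof. by case/orP => [/eqP ->|/andP[/eqP ->]]. Qed.

(** Unites the parity cases; the names are chosen so that in the mixed case the even child is
    [P]. *)
Lemma two_node X : X \in SS -> (1 < #|X|)%N -> #|Ch X| = 2%N ->
  (forall Y, Y \in Ch X -> positive Y) -> exists P Q, [/\ Ch X = [set P; Q], P != Q, positive X,
    potential P + potential Q <= potential X &
    [\/ [/\ odd #|P|, odd #|Q| & potential P + potential Q + ln 2 <= potential X],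
        ~~ odd #|P| /\ ~~ odd #|Q| | [/\ ~~ odd #|P|, odd #|Q| & odd #|X|]]].
Proof.
move=> XS X1 C2 posC; have [P [Q [PQ CE]]] := cards2P _ (introT eqP C2).
have PC : P \in Ch X by rewrite CE set21.
have QC : Q \in Ch X by rewrite CE set22.
have XE : P :|: Q = X by rewrite -(cover_children vertex3 maxSS XS X1) CE /cover big_setU1 ?inE //= big_set1.
have /childP[PS _ _] := PC; have /childP[QS _ _] := QC.
have dPQ := child_disjoint maxSS PC QC PQ.
have oX : odd #|X| = odd #|P| (+) odd #|Q|.
  by rewrite -XE cardsU (_ : P :&: Q = set0) ?cards0 ?subn0 ?oddD //; apply/eqP; rewrite setI_eq0.
have l2 : 0 <= ln 2 :> R by exact: ln_nat_ge0.
have [pP pQ] := (posC _ PC, posC _ QC).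
have XS' : P :|: Q \in SS by rewrite XE.
case: (boolP (odd #|P|)) => oP; case: (boolP (odd #|Q|)) => oQ.
- have [] := two_odd R vertex3 no_bridge maxSS PS QS XS' dPQ pP pQ oP oQ; rewrite XE => pX le.
  by exists P, Q; split=> //; [lra | constructor 1].
- have dQP : [disjoint Q & P] by rewrite disjoint_sym.
  have XS2 : Q :|: P \in SS by rewrite setUC.
  have [] := two_mixed R vertex3 no_bridge maxSS QS PS XS2 dQP pQ pP oQ oP; rewrite setUC XE => pX le.
  exists Q, P; rewrite setUC eq_sym; split=> //; constructor 3; split=> //.
  by rewrite oX oP (negPf oQ).
- have [] := two_mixed R vertex3 no_bridge maxSS PS QS XS' dPQ pP pQ oP oQ; rewrite XE => pX le.
  by exists P, Q; split=> //; constructor 3; split=> //; rewrite oX oQ (negPf oP).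
- have [] := two_even R maxSS PS dPQ pP pQ oP oQ; rewrite XE => pX le.
  by exists P, Q; split=> //; constructor 2.
Qed.

Lemma node_sum X : X \in SS -> (1 < #|X|)%N -> (forall Y, Y \in Ch X -> positive Y) ->
  positive X /\ \sum_(Y in Ch X) potential Y <= potential X.
Proof.
move=> XS X1 posC; have := card_children vertex3 maxSS XS X1.
rewrite leq_eqVlt => /orP[/eqP/esym C2|C2].
  have [P [Q [CE PQ pX le _]]] := two_node XS X1 C2 posC.
  by rewrite CE big_setU1 ?inE //= big_set1.
by split; [exact: (node_positive R vertex3 no_bridge maxSS XS X1 C2 posC) |
  exact: (node_potential R vertex3 no_bridge maxSS XS X1 C2 posC)].
Qed.

Lemma child_le_sum X Y : Y \in Ch X -> potential Y <= \sum_(Z in Ch X) potential Z.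
Proof.
by move=> YC; rewrite (big_setD1 Y) //= lerDl sumr_ge0 // => Z _; exact: potential_ge0.
Qed.

Lemma odd_potential X e n : odd #|X| -> e \in bd X -> (0 < n)%N -> (n <= N X [set e])%N ->
  ln n%:R <= potential X.
Proof.
move=> oX eX n0 nN; rewrite /potential oX (big_setD1 e) //=; apply: ler_wpDr.
  by apply: sumr_ge0 => f _; exact: ln_nat_ge0.
exact: ler_ln_nat.
Qed.

(** If all children are tiny, hence odd, two of them gain by [two_odd] and five or more by
    [node_gain]. Three give a K4: tiny again if all are single vertices, while a child [Y] of three
    vertices yields [N Y [set l] + N Y (bd Y) >= 2]. *)
Lemma side_substantial_or_tiny X : X \in SS -> positive X /\ (substantial X \/ tiny X).
Proof.
have [n] := ubnP #|X|; elim: n X => // n IH X Xn XS.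
have l2 : 0 <= ln 2 :> R by exact: ln_nat_ge0.
have [X1|] := ltnP 1 #|X|; last first.
  rewrite leq_eqVlt ltnS leqn0 => /orP[X1|]; last first.
    by rewrite cards_eq0; have /and3P[/negPf ->] := sideP maxSS XS.
  split; last by right; rewrite /tiny X1.
  have /cards1P[v Xv] := X1; rewrite /positive Xv cards1.
  by apply/forall_inP => e; exact: single_states.
have IHC Y : Y \in Ch X -> positive Y /\ (substantial Y \/ tiny Y).
  move=> /childP[YS YX _]; apply: IH => //.
  by have := proper_card YX; move: #|Y| #|X| Xn => a b; clear; lia.
have posC Y : Y \in Ch X -> positive Y by case/IHC.
have [pX leX] := node_sum XS X1 posC; split=> //.
have [/exists_inP[Y YC sY]|] := boolP [exists Y in Ch X, substantial Y].
  by left; apply: le_trans sY _; apply: le_trans leX; apply: child_le_sum.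
rewrite negb_exists_in => /forall_inP noS.
have tC Y : Y \in Ch X -> tiny Y.
  by move=> YC; have [_ [sY|//]] := IHC Y YC; have := noS Y YC; rewrite sY.
have := card_children vertex3 maxSS XS X1; rewrite leq_eqVlt => /orP[/eqP/esym C2|C2].
  have [P [Q [CE PQ _ _ ]]] := two_node XS X1 C2 posC.
  have PC : P \in Ch X by rewrite CE set21.
  have QC : Q \in Ch X by rewrite CE set22.
  have oP := tiny_odd (tC _ PC); have oQ := tiny_odd (tC _ QC).
  case=> [[_ _ le]|[]|[]]; rewrite ?oP //; left; rewrite /substantial.
  by have := potential_ge0 R src dst P; have := potential_ge0 R src dst Q; lra.
have oCh := odd_card_children vertex3 no_bridge maxSS XS X1 C2.
have [oX _] := many_children_odd vertex3 no_bridge maxSS XS X1 C2.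
have := C2; rewrite leq_eqVlt => /orP[/eqP/esym C3|C4]; last first.
  have C5 : (4 < #|Ch X|)%N by move: C4 oCh; case: #|Ch X| => [|[|[|[|[|k]]]]].
  left; rewrite /substantial.
  have := node_gain R vertex3 no_bridge maxSS XS X1 C2 posC C5.
  by have := @sumr_ge0 R _ (index_enum _) (mem (Ch X)) potential (fun Y _ => potential_ge0 R src dst Y); lra.
have [/exists_inP[Y YC Y3]|] := boolP [exists Y in Ch X, #|Y| == 3%N].
  have [s [l [lY sX _ [_ le _]]]] := k4_step vertex3 no_bridge maxSS XS X1 C3 posC YC.
  have := tC _ YC; rewrite /tiny (eqP Y3) /= => t0.
  have := posC _ YC; rewrite /positive (eqP Y3) /= => /forall_inP /(_ l lY) n0.
  left; rewrite /substantial; apply: (@le_trans _ _ (ln 2%:R)); first by lra.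
  apply: (odd_potential oX (sX _ lY)) => //; apply: leq_trans le.
  by move: t0 n0; case: (N Y _) => // a; case: (N Y _) => // b; rewrite addSn addnS.
rewrite negb_exists_in => /forall_inP no3; right.
have c1 Y : Y \in Ch X -> #|Y| = 1%N.
  by move=> YC; have := tC _ YC; rewrite /tiny (negPf (no3 _ YC)) orbF => /eqP.
rewrite /tiny -(sum_card_children XS X1) (eq_bigr _ c1) sum1_card C3 /=.
have /card_gt0P[Y YC] : (0 < #|Ch X|)%N by rewrite C3.
have [s [l [lY sX _ [_ _ le]]]] := k4_step vertex3 no_bridge maxSS XS X1 C3 posC YC.
have := posC _ YC; rewrite /positive c1 //= => /forall_inP /(_ l lY) n0.
exact: leq_trans n0 le.
Qed.

Lemma side_positive X : X \in SS -> positive X.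
Proof. by case/side_substantial_or_tiny. Qed.

Lemma child_positive X Y : Y \in Ch X -> positive Y.
Proof. by case/childP => YS _ _; exact: side_positive. Qed.

Lemma even_substantial X : X \in SS -> ~~ odd #|X| -> substantial X.
Proof. by move=> XS; case: (side_substantial_or_tiny XS) => _ [//|/tiny_odd ->]. Qed.

Lemma child_card_gt1 X Y : Y \in Ch X -> (1 < #|X|)%N.
Proof.
move=> /childP[YS YX _]; apply: leq_ltn_trans (proper_card YX).
by rewrite card_gt0; have /and3P[] := sideP maxSS YS.
Qed.

Lemma child_potential X Y : X \in SS -> Y \in Ch X -> potential Y <= potential X.
Proof.
move=> XS YC; apply: le_trans (child_le_sum YC) _.
by have [] := node_sum XS (child_card_gt1 YC) (@child_positive X).
Qed.

Lemma side_potential X Y : X \in SS -> Y \in SS -> Y \subset X -> potential Y <= potential X.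
Proof.
have [n] := ubnP #|X|; elim: n X => // n IH X Xn XS YS.
rewrite subEproper => /orP[/eqP -> //|YX].
have [Z ZC YZ] := sub_child maxSS YS YX; apply: le_trans (child_potential XS ZC).
have /childP[ZS ZX _] := ZC; apply: IH => //.
by have := proper_card ZX; move: #|Z| #|X| Xn => a b; clear; lia.
Qed.

(** The exceptions are a K4 node, where the gain may be delayed, and an even child, whose odd
    sibling may have potential zero. An even sibling is always substantial. *)
Lemma child_gain X Y : X \in SS -> Y \in Ch X ->
  [\/ potential Y + ln 2 / 2 <= potential X, #|Ch X| = 3%N | ~~ odd #|Y| /\ odd #|X|].
Proof.
move=> XS YC; have X1 := child_card_gt1 YC; have posC := @child_positive X.
have l2 : 0 <= ln 2 :> R by exact: ln_nat_ge0.
have := card_children vertex3 maxSS XS X1; rewrite leq_eqVlt => /orP[/eqP/esym C2|C2]; last first.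
  have := C2; rewrite leq_eqVlt => /orP[/eqP/esym C3|C4]; first by constructor 2.
  have oCh := odd_card_children vertex3 no_bridge maxSS XS X1 C2.
  have C5 : (4 < #|Ch X|)%N by move: C4 oCh; case: #|Ch X| => [|[|[|[|[|k]]]]].
  constructor 1; have := node_gain R vertex3 no_bridge maxSS XS X1 C2 posC C5.
  by have := child_le_sum YC; lra.
have [P [Q [CE PQ _ le alt]]] := two_node XS X1 C2 posC.
have /childP[PS _ _] : P \in Ch X by rewrite CE set21.
have /childP[QS _ _] : Q \in Ch X by rewrite CE set22.
have P0 := potential_ge0 R src dst P; have Q0 := potential_ge0 R src dst Q.
have YPQ : Y \in [set P; Q] by rewrite -CE.
case: alt => [[oP oQ le2]|[eP eQ]|[eP oQ oX]].
- by constructor 1; case/set2P: YPQ => ->; lra.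
- have sP := even_substantial PS eP; have sQ := even_substantial QS eQ.
  by rewrite /substantial in sP sQ; constructor 1; case/set2P: YPQ => ->; lra.
- have sP := even_substantial PS eP; rewrite /substantial in sP.
  by case/set2P: YPQ => ->; [constructor 3 | constructor 1; lra].
Qed.

End Growth.

(* F0 cannot increase strictly along four labels out of three. *)
Lemma label_doubling (F0 F1 F2 F3 F4 : 'I_3 -> nat) (t1 t2 t3 : nat) (l0 l1 l2 l3 : 'I_3) :
  (forall i, F0 i <= F1 i)%N -> (forall i, F1 i <= F2 i)%N ->
  (forall i, F2 i <= F3 i)%N -> (forall i, F3 i <= F4 i)%N ->
  (F1 l1 + t3 <= F2 l1)%N -> (F2 l2 + t2 <= F3 l2)%N -> (F3 l3 + t1 <= F4 l3)%N ->
  (F0 l0 <= t3)%N -> (F1 l1 <= t2)%N -> (F2 l2 <= t1)%N -> exists i, (2 * F0 i <= F4 i)%N.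
Proof.
move=> h1 h2 h3 h4 g1 g2 g3 k0 k1 k2.
(* If [F0 l1 <= F0 l0], then label [l1] receives [t3 >= F0 l0] and has doubled. The next two
   comparisons use [t2] and [t1] in the same way. *)
have [le|lt1] := leqP (F0 l1) (F0 l0).
  exists l1; have := h1 l1; have := h2 l1; have := h3 l1; have := h4 l1; lia.
have [le|lt2] := leqP (F0 l2) (F0 l1).
  exists l2; have := h1 l2; have := h2 l2; have := h3 l2; have := h4 l2; have := h1 l1; lia.
have [le|lt3] := leqP (F0 l3) (F0 l2).
  exists l3; have := h1 l3; have := h2 l3; have := h3 l3; have := h4 l3; have := h1 l2; have := h2 l2; lia.
have : #|[set l0; l1; l2; l3]| = 4.
  have ne a b : (F0 a < F0 b)%N -> (a == b) = false by case: eqVneq => // ->; rewrite ltnn.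
  rewrite -!setUA !cardsU1 cards1 !inE !negb_or !ne //; lia.
by have := max_card (mem [set l0; l1; l2; l3]); rewrite card_ord => /[swap] ->.
Qed.

(** * Growth of the potential along five steps *)

Section Chains.
Variables (R : realType) (V E : finType) (src dst : E -> V) (root : V).
Local Notation bd := (boundary src dst).
Local Notation N := (nstates src dst).
Hypothesis vertex3 : forall v, #|bd [set v]| = 3.
Hypothesis no_bridge : forall X, (#|bd X| != 1)%N.
Variable SS : {set {set V}}.
Hypothesis maxSS : maxset (side_family src dst root) SS.
Local Notation Ch := (children SS).
Implicit Types X Y Z : {set V}.
Local Notation positive := (positive src dst).
Local Notation potential := (potential R src dst).
Local Notation substantial := (substantial R src dst).

(** Labels for the three boundary edges of an odd side, so that counts of nested sides can be
    compared label by label. *)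
Definition frame X (a : 'I_3 -> E) := injective a /\ forall i, a i \in bd X.

Lemma frame_imset X a : X \in SS -> odd #|X| -> frame X a -> bd X = a @: setT.
Proof.
move=> XS oX [ia aX]; apply/esym/eqP; rewrite eqEcard (odd_side vertex3 no_bridge maxSS XS oX).
rewrite card_imset // cardsT card_ord leqnn andbT.
by apply/subsetP => _ /imsetP[i _ ->].
Qed.

Lemma frame_potential X a : X \in SS -> odd #|X| -> frame X a ->
  potential X = \sum_i ln (N X [set a i])%:R.
Proof.
move=> XS oX fa; rewrite /potential oX (frame_imset XS oX fa) big_imset /=.
  by apply: eq_bigl => i; rewrite inE.
by move=> i j _ _; apply: fa.1.
Qed.

Lemma frame_exists X : X \in SS -> odd #|X| -> exists a, frame X a.
Proof.
move=> XS oX; have X3 := odd_side vertex3 no_bridge maxSS XS oX.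
exists (fun i => enum_val (cast_ord (esym X3) i)); split=> [i j /enum_val_inj/cast_ord_inj //|i].
exact: enum_valP.
Qed.

Lemma k4_frame X Y a : X \in SS -> #|Ch X| = 3%N -> Y \in Ch X -> frame Y a ->
  exists b i, [/\ frame X b, (forall j, N Y [set a j] <= N X [set b j])%N,
    (N Y [set a i] + N Y (bd Y) <= N X [set b i])%N & (N Y [set a i] <= N X (bd X))%N].
Proof.
move=> XS C3 YC fa; have X1 := child_card_gt1 maxSS YC.
have [|s [l [lY sX si [mono gain third]]]] := k4_step vertex3 no_bridge maxSS XS X1 C3 _ YC.
  by move=> Z ZC; apply: (child_positive R vertex3 no_bridge maxSS ZC).
have oY : odd #|Y|.
  by have [_] := many_children_odd vertex3 no_bridge maxSS XS X1 (eq_leq (esym C3)); apply.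
have [YS _ _] := childP YC; have [ia aY] := fa.
have [i _ lE] : exists2 i, i \in setT & l = a i by apply/imsetP; rewrite -(frame_imset YS oY fa).
exists (s \o a), i; rewrite /= -lE; split=> //.
  by split=> [j k /= /si h|j /=]; [apply: ia; apply: h | apply: sX].
by move=> j; apply: mono.
Qed.

(** Each K4 step above the lowest adds [N Y (bd Y)] to the count of one label, and this is at least
    some label's count one level below [Y]. Four steps suffice for one label to double, worth
    [ln 2], while the other two do not decrease. *)
Lemma k4_chain X0 X1 X2 X3 X4 : X0 \in SS ->
  X1 \in Ch X0 -> X2 \in Ch X1 -> X3 \in Ch X2 -> X4 \in Ch X3 ->
  #|Ch X0| = 3%N -> #|Ch X1| = 3%N -> #|Ch X2| = 3%N -> #|Ch X3| = 3%N ->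
  potential X4 + ln 2 <= potential X0.
Proof.
move=> S0 C1 C2 C3 C4 k0 k1 k2 k3.
have [S1 _ _] := childP C1; have [S2 _ _] := childP C2; have [S3 _ _] := childP C3.
have [S4 _ _] := childP C4.
have odds X Y : X \in SS -> Y \in Ch X -> #|Ch X| = 3%N -> odd #|X| /\ odd #|Y|.
  move=> XS YC c3; have X1' := child_card_gt1 maxSS YC.
  have [oX oC] := many_children_odd vertex3 no_bridge maxSS XS X1' (eq_leq (esym c3)).
  by split=> //; apply: oC.
have [o3 o4] := odds _ _ S3 C4 k3; have [o0 _] := odds _ _ S0 C1 k0.
have [a4 f4] := frame_exists S4 o4.
have [a3 [l0 [f3 m3 g3 t3]]] := k4_frame S3 k3 C4 f4.
have [a2 [l1 [f2 m2 g2 t2]]] := k4_frame S2 k2 C3 f3.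
have [a1 [l2 [f1 m1 g1 t1]]] := k4_frame S1 k1 C2 f2.
have [a0 [l3 [f0 m0 g0 t0]]] := k4_frame S0 k0 C1 f1.
have [i gi] := label_doubling m3 m2 m1 m0 g2 g1 g0 t3 t2 t1.
rewrite (frame_potential S4 o4 f4) (frame_potential S0 o0 f0) (bigD1 i) //= [leRHS](bigD1 i) //=.
have pos j : (0 < N X4 [set a4 j])%N.
  have := side_positive R vertex3 no_bridge maxSS S4.
  by rewrite /positive o4 => /forall_inP; apply; apply: f4.2.
have : \sum_(j | j != i) ln (N X4 [set a4 j])%:R <= \sum_(j | j != i) ln (N X0 [set a0 j])%:R :> R.
  apply: ler_sum => j _; apply: ler_ln_nat => //.
  by apply: leq_trans (m0 j); apply: leq_trans (m1 j); apply: leq_trans (m2 j).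
have := ler_ln_nat R _ gi; rewrite ln_natM // muln_gt0 pos => /(_ isT).
by move: (\sum_(j | _) _) (\sum_(j | _) _) => u w; lra.
Qed.

Fixpoint descends k X Y : Prop :=
  if k is k'.+1 then exists2 Z, Z \in Ch X & descends k' Z Y else X = Y.

Lemma descends_cat m n X Y : descends (m + n) X Y ->
  exists2 Z, descends m X Z & descends n Z Y.
Proof.
elim: m X => [|m IH] X /=; first by exists X.
by case=> Z ZC /IH[W ZW WY]; exists W => //; exists Z.
Qed.

Lemma descends_side k X Y : X \in SS -> descends k X Y -> Y \in SS.
Proof.
by elim: k X => [|k IH] X XS /=; [move=> <- | case=> Z /childP[ZS _ _]; apply: IH].
Qed.

(** Two consecutive steps gain unless the upper node has three children: after an exceptional step
    to an even child, the next step starts at an even node, which neither has three children nor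
    allows a second exception. Four overlapping pairs of steps leave only a chain of four K4
    nodes. *)
Lemma five_steps X Y : X \in SS -> descends 5 X Y -> potential Y + ln 2 / 2 <= potential X.
Proof.
move=> S0 [X1 C1 [X2 C2 [X3 C3 [X4 C4 [X5 C5 <-]]]]].
have l2 : 0 <= ln 2 :> R by exact: ln_nat_ge0.
have [S1 _ _] := childP C1; have [S2 _ _] := childP C2; have [S3 _ _] := childP C3.
have [S4 _ _] := childP C4.
have mono := child_potential R vertex3 no_bridge maxSS.
have := mono _ _ S0 C1; have := mono _ _ S1 C2; have := mono _ _ S2 C3; have := mono _ _ S3 C4.
have := mono _ _ S4 C5; move=> h5 h4 h3 h2 h1.
have gain := child_gain R vertex3 no_bridge maxSS.
have k4_or (A B C : {set V}) : A \in SS -> B \in Ch A -> C \in Ch B ->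
    potential C + ln 2 / 2 <= potential A \/ #|Ch A| = 3%N.
  move=> AS BA CB; have [BS _ _] := childP BA; have leBA := mono _ _ AS BA; have leCB := mono _ _ BS CB.
  have [le|->|[eB _]] := gain _ _ AS BA; [left; lra | by right |].
  have [le|c3|[_ oB]] := gain _ _ BS CB; [left; lra | | by rewrite oB in eB].
  have B1 := child_card_gt1 maxSS CB.
  have [oB _] := many_children_odd vertex3 no_bridge maxSS BS B1 (eq_leq (esym c3)).
  by rewrite oB in eB.
have [g|k0] := k4_or _ _ _ S0 C1 C2; first by lra.
have [g|k1] := k4_or _ _ _ S1 C2 C3; first by lra.
have [g|k2] := k4_or _ _ _ S2 C3 C4; first by lra.
have [g|k3] := k4_or _ _ _ S3 C4 C5; first by lra.
have := k4_chain S0 C1 C2 C3 C4 k0 k1 k2 k3; lra.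
Qed.

Lemma descends_gain k X Y : X \in SS -> descends (k * 5) X Y ->
  potential Y + k%:R * (ln 2 / 2) <= potential X.
Proof.
elim: k X => [|k IH] X XS; first by move=> /= ->; rewrite mul0r addr0.
rewrite mulSn => /descends_cat[Z XZ ZY].
have := five_steps XS XZ; have := IH Z (descends_side XS XZ) ZY.
rewrite -[k.+1%:R]natr1 mulrDl mul1r; lra.
Qed.

(** Superadditivity allows at most [potential X / (ln 2 / 2)] substantial nodes on each of [n]
    levels. Each has at most [B] children, and a child that is not substantial has at most 3
    vertices. *)
Lemma side_card_le (B : R) n X : 1 <= B -> (forall Y, Y \in SS -> #|Ch Y|%:R <= B) ->
  X \in SS -> substantial X -> (forall Y, descends n X Y -> ~~ substantial Y) ->
  #|X|%:R <= 3 * B * n%:R * (potential X / (ln 2 / 2)).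
Proof.
move=> B1 ChB; have B0 : 0 <= B by lra.
have eta : 0 < ln 2 / 2 :> R by rewrite divr_gt0 // ln_gt0 // ltr1n.
elim: n X => [|n IH] X XS sX nd; first by have := nd X erefl; rewrite sX.
have q1 : 1 <= potential X / (ln 2 / 2) by rewrite ler_pdivlMr // mul1r.
have [X1|X1] := leqP #|X| 1%N.
  apply: (@le_trans _ _ 1); first by rewrite lern1.
  have n1 : 1 <= n.+1%:R :> R by rewrite ler1n.
  rewrite -[leLHS]mulr1; apply: ler_pM => //.
  by rewrite -[leLHS]mulr1; apply: ler_pM => //; lra.
have posC Y : Y \in Ch X -> positive Y by apply: (child_positive R vertex3 no_bridge maxSS).
have [_ sumC] := node_sum R vertex3 no_bridge maxSS XS X1 posC.
have small Y : Y \in Ch X -> #|Y|%:R <= 3 + 3 * B * n%:R * (potential Y / (ln 2 / 2)).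
  move=> YC; have [YS _ _] := childP YC.
  have Y0 : 0 <= 3 * B * n%:R * (potential Y / (ln 2 / 2)).
    by apply: mulr_ge0; [rewrite !mulr_ge0 | rewrite divr_ge0 ?potential_ge0 ?(ltW eta)].
  have [sY|nsY] := boolP (substantial Y).
    apply: (le_trans (IH Y YS sY _)); last by rewrite lerDr.
    by move=> Z YZ; apply: nd; exists Y.
  have [_ [sY|/tiny_le3 t3]] := side_substantial_or_tiny R vertex3 no_bridge maxSS YS.
    by rewrite sY in nsY.
  by apply: (@le_trans _ _ 3); [rewrite ler_nat | rewrite lerDl].
rewrite -(sum_card_children vertex3 maxSS XS X1) natr_sum.
apply: le_trans (ler_sum _ small) _.
rewrite big_split /= sumr_const -mulr_sumr -mulr_suml.
have -> : 3 *+ #|Ch X| = 3 * #|Ch X|%:R :> R by rewrite mulr_natr.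
have h1 := ChB X XS; rewrite -natr1.
set c := #|Ch X|%:R in h1 *; set S := \sum_(_ in _) _ in sumC *; set p := potential X in sumC q1 *.
have h2 : S / (ln 2 / 2) <= p / (ln 2 / 2) by rewrite ler_pM2r ?invr_gt0.
have n0 : 0 <= 3 * B * n%:R by rewrite !mulr_ge0.
have h3 : 3 * B * n%:R * (S / (ln 2 / 2)) <= 3 * B * n%:R * (p / (ln 2 / 2)) by rewrite ler_wpM2l.
have h4 : B <= B * (p / (ln 2 / 2)) by rewrite ler_peMr.
by move: h1 h3 h4; move: (p / _) (S / _) => u w; lra.
Qed.

End Chains.

(** * The tree below the complement of the root *)

Section Total.
Variables (R : realType) (V E : finType) (src dst : E -> V) (root : V).
Local Notation bd := (boundary src dst).
Local Notation N := (nstates src dst).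
Hypothesis vertex3 : forall v, #|bd [set v]| = 3.
Hypothesis no_bridge : forall X, (#|bd X| != 1)%N.
Variable SS : {set {set V}}.
Hypothesis maxSS : maxset (side_family src dst root) SS.
Local Notation Ch := (children SS).
Implicit Types X Y Z : {set V}.
Local Notation potential := (potential R src dst).
Let m := #|[set M | matches src dst setT M]|.
Let T := ~: [set root].
Local Notation D := (potential T).
Local Notation K := (12 * 12 * 10 * 100 : R).
Let B := (K * (D / 3 + 5)) ^+ 2.

Let oT : odd #|T|.
Proof. by rewrite -(odd_boundary vertex3) boundaryC vertex3. Qed.

Let TS : T \in SS.
Proof.
by apply: (top_side vertex3 maxSS); apply: contraTneq oT; rewrite /T => ->; rewrite cards0.
Qed.

(** The root is saturated as well, because [bd T] is also the boundary of [[set root]]. *)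
Lemma states_top_le e : e \in bd T -> (N T [set e] <= m)%N.
Proof.
move=> eT; apply: subset_leq_card; apply/subsetP => M; rewrite !inE => /and3P[_ /eqP Me /matchesP MT].
apply/matchesP => v _; have [->|vr] := eqVneq v root; last by apply: MT; rewrite !inE.
by rewrite -boundaryC Me cards1.
Qed.

Lemma matchings_gt0 : (0 < m)%N.
Proof.
have /card_gt0P[e eT] : (0 < #|bd T|)%N by rewrite boundaryC vertex3.
apply: leq_trans (states_top_le eT); have := side_positive R vertex3 no_bridge maxSS TS.
by rewrite /positive oT => /forall_inP; apply.
Qed.

Lemma potential_top_le : D <= 3 * ln m%:R.
Proof.
rewrite {1}/potential oT; have -> : 3 * ln m%:R = \sum_(e in bd T) ln m%:R :> R.
  by rewrite sumr_const boundaryC vertex3 mulr_natl.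
apply: ler_sum => e eT; apply: ler_ln_nat (states_top_le eT).
have := side_positive R vertex3 no_bridge maxSS TS.
by rewrite /positive oT => /forall_inP; apply.
Qed.

(** Beyond six children this is [node_size] and monotonicity of the potential; up to six, the
    constant term of [B] suffices. *)
Lemma children_le X : X \in SS -> #|Ch X|%:R <= B.
Proof.
move=> XS; have D0 := potential_ge0 R src dst T.
have [C6|C6] := leqP #|Ch X| 6.
  apply: (@le_trans _ _ 6); first by rewrite ler_nat.
  rewrite /B; move: (potential T) D0 => D D0; nra.
have X1 : (1 < #|X|)%N.
  have /card_gt0P[Y YC] : (0 < #|Ch X|)%N by apply: leq_trans C6.
  exact: (child_card_gt1 maxSS YC).
have C2 : (2 < #|Ch X|)%N by apply: leq_trans C6.
have posC Y : Y \in Ch X -> positive src dst Y by apply: (child_positive R vertex3 no_bridge maxSS).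
have := node_size R vertex3 no_bridge maxSS XS X1 C2 posC C6.
have XT : X \subset T by rewrite subsetC sub1set inE; have /and3P[] := sideP maxSS XS.
have leXT := side_potential R vertex3 no_bridge maxSS TS XS XT => sq.
have {}sq : Num.sqrt #|Ch X|.+1%:R <= K * (D / 3 + 5).
  apply: le_trans sq _; rewrite ler_wpM2l ?mulr_ge0 // lerD2r ler_wpM2r ?invr_ge0 //.
apply: (@le_trans _ _ #|Ch X|.+1%:R); first by rewrite ler_nat.
rewrite -[leLHS]sqr_sqrtr ?ler0n // /B; apply: lerXn2r sq; rewrite nnegrE ?sqrtr_ge0 //.
by rewrite !mulr_ge0 ?addr_ge0 ?divr_ge0.
Qed.

Lemma card_top_le : #|V|%:R <= (4 + 15 * K ^+ 2 * ((ln 2 / 2)^-1 + 1) ^+ 2) * (3 * ln m%:R + 5) ^+ 4.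
Proof.
have D0 := potential_ge0 R src dst T; have Dm := potential_top_le.
have eta : 0 < ln 2 / 2 :> R by rewrite divr_gt0 // ln_gt0 // ltr1n.
set q := (ln 2 / 2)^-1; have q0 : 0 < q by rewrite invr_gt0.
set d := 3 * ln m%:R in Dm *.
have B1 : 1 <= B by rewrite /B; move: (potential T) D0 => D D0; nra.
have cT : #|V|%:R = 1 + #|T|%:R :> R.
  have := cardsC [set root]; rewrite cards1 -/T => <-; by rewrite natrD.
have d4 : 1 <= (d + 5) ^+ 4 by rewrite exprn_ege1 //; lra.
have C0 : 0 <= 15 * K ^+ 2 * (q + 1) ^+ 2 by rewrite !mulr_ge0 ?exprn_ge0 ?addr_ge0 ?ltW.
have [_ [sT|/tiny_le3 t3]] := side_substantial_or_tiny R vertex3 no_bridge maxSS TS; last first.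
  have {}t3 : #|T|%:R <= 3 :> R by rewrite ler_nat.
  rewrite cT; apply: (@le_trans _ _ (4 * (d + 5) ^+ 4)); first by lra.
  by rewrite ler_wpM2r ?lerDl //; lra.
(* [k] blocks of five steps would gain more than [D], so nothing substantial lies at depth [5 k]. *)
set k := (Num.trunc (D * q)).+1.
have Dq : 0 <= D * q by rewrite mulr_ge0 // ltW.
have kD : D * q < k%:R by rewrite -truncn_lt_nat.
have kD1 : k%:R <= D * q + 1 by rewrite -natr1 lerD2r -truncn_ge_nat.
have nd Y : descends SS (k * 5) T Y -> ~~ substantial R src dst Y.
  move=> TY; apply/negP; rewrite /substantial => sY.
  have := descends_gain R vertex3 no_bridge maxSS TS TY; apply/negP; rewrite -ltNge.
  apply: (@lt_le_trans _ _ (k%:R * (ln 2 / 2))); last by rewrite lerDr (le_trans _ sY) // ltW.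
  by rewrite -ltr_pdivrMr.
have := side_card_le vertex3 no_bridge maxSS B1 children_le TS sT nd; rewrite -/q.
rewrite natrM -/q => le; rewrite cT.
have h1 : k%:R * (D * q) <= (q + 1) ^+ 2 * (d + 5) ^+ 2.
  rewrite -exprMn expr2; apply: ler_pM => //.
    apply: le_trans kD1 _; nra.
  nra.
have h2 : B <= K ^+ 2 * (d + 5) ^+ 2.
  rewrite /B -exprMn; apply: lerXn2r; rewrite ?nnegrE; nra.
have h3 : B * (k%:R * (D * q)) <= (K ^+ 2 * (d + 5) ^+ 2) * ((q + 1) ^+ 2 * (d + 5) ^+ 2).
  apply: ler_pM => //; [lra | by rewrite mulr_ge0].
have -> : (4 + 15 * K ^+ 2 * (q + 1) ^+ 2) * (d + 5) ^+ 4 = 4 * (d + 5) ^+ 4 + 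
   15 * (K ^+ 2 * (d + 5) ^+ 2 * ((q + 1) ^+ 2 * (d + 5) ^+ 2)) by ring.
move: le h3; rewrite (_ : 3 * B * _ * _ = 15 * (B * (k%:R * (D * q)))); last by ring.
lra.
Qed.

End Total.

Lemma matchings_growth (R : realType) : exists2 C : R, 0 < C &
  forall (V E : finType) (src dst : E -> V) (root : V),
    (forall v, #|boundary src dst [set v]| = 3) -> (forall X, (#|boundary src dst X| != 1)%N) ->
    let m := #|[set M | matches src dst setT M]| in
    (0 < m)%N /\ #|V|%:R <= C * (3 * ln m%:R + 5) ^+ 4.
Proof.
exists (4 + 15 * (12 * 12 * 10 * 100) ^+ 2 * ((ln 2 / 2)^-1 + 1) ^+ 2).
  by rewrite ltr_wpDr //; apply: mulr_ge0; [apply: mulr_ge0 => // | ]; exact: sqr_ge0.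
move=> V E src dst root vertex3 no_bridge m.
have [|SS maxSS] := @ex_maxset _ (side_family src dst root).
  by exists set0; rewrite /side_family /laminar; apply/andP; split; apply/forall_inP => X; rewrite inE.
split; first exact: (matchings_gt0 R vertex3 no_bridge maxSS).
exact: (card_top_le R vertex3 no_bridge maxSS).
Qed.

(** * Cubic bridgeless graphs *)

Section Bridgeless.
Variables (V E : finType) (src dst : E -> V).
Local Notation bd := (boundary src dst).
Hypotheses (cubicG : cubic src dst) (bridgelessG : bridgeless src dst).

(** If [e] were the whole boundary of [X], deleting it would make [X] closed under adjacency and
    separate the ends of [e]. *)
Lemma bridgeless_boundary X : (#|bd X| != 1)%N.
Proof.
apply/negP => /cards1P[e Xe]; apply: (bridgelessG (e := e)); exists (src e), (dst e); split.
  by apply: connect1; apply/existsP; exists e; rewrite inE !eqxx.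
have closedX : closed (adj_in src dst (setT :\ e)) (mem X).
  move=> x y /exists_inP[f]; rewrite in_setD1 => /andP[fe _] xy.
  have : f \notin bd X by rewrite Xe inE.
  by rewrite inE negbK; case/orP: xy => /andP[/eqP <- /eqP <-] /eqP.
apply/negP => /(closed_connect closedX); rewrite !unfold_in => h.
by have := set11 e; rewrite -Xe inE !unfold_in /= h eqxx.
Qed.

(** A loop counts twice in the degree and not at all in the boundary. *)
Lemma card_boundary_vertex v : (#|bd [set v]| + 2 * #|[set e | src e == v] :&: [set e | dst e == v]| = 3)%N.
Proof.
have := cubicG v; rewrite /degree; set A := [set e | src e == v]; set B := [set e | dst e == v].
have -> : bd [set v] = (A :|: B) :\: (A :&: B).
  by apply/setP => e; rewrite !inE; case: (src e == v); case: (dst e == v).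
have sub : A :&: B \subset A :|: B := subset_trans (subsetIl A B) (subsetUl A B).
rewrite cardsD (setIidPr sub); have := subset_leq_card sub; have := cardsUI A B.
by move: #|A| #|B| #|A :|: B| #|A :&: B| => a b u i; clear; lia.
Qed.

(** A loop would use two of the three degrees and leave a boundary of one edge, a bridge. *)
Lemma no_loop e : src e != dst e.
Proof.
apply/eqP => ee; have := card_boundary_vertex (dst e); have := bridgeless_boundary [set dst e].
rewrite (cardsD1 e (_ :&: _)) !inE ee eqxx /=.
by move: #|bd _| #|_ :\ _| => a b; clear; lia.
Qed.

Lemma cubic_boundary v : #|bd [set v]| = 3%N.
Proof.
have := card_boundary_vertex v; set L := _ :&: _; suff -> : L = set0 by rewrite cards0 muln0 addn0.
apply/setP => e; rewrite !inE; apply/negP => /andP[/eqP s /eqP d].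
by have := no_loop e; rewrite s d eqxx.
Qed.

Lemma matches_perfect : (#|[set M | matches src dst setT M]| <= num_perfect_matchings src dst)%N.
Proof.
apply: subset_leq_card; apply/subsetP => M; rewrite !inE => /matchesP Mm; apply/andP; split.
  by apply/forall_inP => e _; exact: no_loop.
apply/forallP => v; rewrite -(Mm v) ?inE //; apply/eqP; congr #|pred_of_set _|.
have one e : ~~ ((src e == v) && (dst e == v)).
  by apply: contra (no_loop e) => /andP[/eqP -> /eqP ->].
by apply/setP => e; rewrite !inE /incident; move: (one e); case: (src e == v); case: (dst e == v).
Qed.

End Bridgeless.

Lemma perfect_matchings_superlinear (R : realType) (alpha : R) : 0 < alpha ->
  exists2 beta : R, 0 < beta & forall (V E : finType) (src dst : E -> V),
    cubic src dst -> bridgeless src dst ->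
    alpha * #|V|%:R - beta <= (num_perfect_matchings src dst)%:R.
Proof.
move=> a0; have [C C0 growth] := matchings_growth R.
(* The factor 24 comes from [3 ln m + 5 <= 24 s] below; the summand 1 keeps [beta] positive. *)
pose A := alpha * C * 24 ^+ 4; exists (A ^+ 2 + 1); first by rewrite ltr_wpDl ?sqr_ge0.
move=> V E src dst cub bri.
(* An empty graph offers no root. *)
have [V0|] := posnP #|V|.
  rewrite V0 mulr0 add0r; apply: (@le_trans _ _ 0) => //.
  by rewrite oppr_le0 addr_ge0 ?sqr_ge0.
case/card_gt0P => root _.
have [m0 le] := growth V E src dst root (cubic_boundary cub bri) (bridgeless_boundary bri).
have mN := matches_perfect cub bri; set m := #|_| in m0 le mN.
rewrite lerBlDr; apply: (@le_trans _ _ (m%:R + A ^+ 2)); last first.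
  by rewrite addrA ler_wpDr // lerD2r ler_nat.
(* From [1 + z <= exp z], [s^8 <= m], while [alpha n <= A s^4]; the proof ends with
   [A u <= u^2 + A^2] at [u = s^4]. *)
pose s := 1 + ln m%:R / 8 : R; have t0 := ln_nat_ge0 R m.
have s1 : 1 <= s by rewrite lerDl divr_ge0.
have ms : s ^+ 8 <= m%:R.
  have -> : m%:R = expR (ln m%:R / 8) ^+ 8 :> R.
    by rewrite -expRM_natl mulrC divfK ?pnatr_eq0 // lnK // posrE ltr0n.
  by apply: lerXn2r; rewrite ?nnegrE ?expR_ge0 ?expR_ge1Dx //; lra.
have Vs : alpha * #|V|%:R <= A * s ^+ 4.
  have -> : A * s ^+ 4 = alpha * (C * (24 * s) ^+ 4) by rewrite /A; ring.
  rewrite ler_pM2l //; apply: le_trans le _; rewrite ler_pM2l //.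
  by apply: lerXn2r; rewrite ?nnegrE /s; lra.
apply: le_trans Vs _; apply: (@le_trans _ _ (s ^+ 8 + A ^+ 2)); last by rewrite lerD2r.
have -> : s ^+ 8 = (s ^+ 4) ^+ 2 by rewrite -exprM.
by move: (s ^+ 4) => u; nra.
Qed.

Close Scope ring_scope.
(* MathComp binds %R to ring_scope. *)
Delimit Scope R_scope with R.

Theorem theorem1 :
  forall alpha : R, (0 < alpha)%R ->
  exists beta : R, (0 < beta)%R /\
    forall (V E : finType) (src dst : E -> V),
      cubic src dst -> bridgeless src dst ->
      (alpha * INR #|V| - beta <= INR (num_perfect_matchings src dst))%R.
Proof.
move=> alpha /RltP a0; have [beta /RltP b0 bound] := perfect_matchings_superlinear a0.
exists beta; split=> // V E src dst cub bri.
by apply/RleP; have := bound V E src dst cub bri; rewrite !INRE.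
Qed.
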